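(* Let $h:[2,\infty)\to(0,\infty)$ be continuous and non-decreasing, and suppose that for some positive constant $C$ $$\sum_{n\le x}\ \sum_{p^{\nu}\| n}\nu\,h(p)=(C+o(1))\,h(x)\,\frac{x}{\log x}\qquad(x\to\infty).$$ Then $h$ is regularly varying with index $\rho$, where $\rho$ is the unique positive solution of the equation $C=\zeta(\rho+1)/(\rho+1)$.
   Context: A positive continuous function $h$ is regularly varying with index $\rho\in\mathbb{R}$ if $\lim_{x\to\infty}h(cx)/h(x)=c^{\rho}$ for every $c>0$. The letter $p$ denotes primes; $p^{\nu}\|n$ means that $p^{\nu}$ divides $n$ but $p^{\nu+1}$ does not, and the inner sum runs over all prime powers $p^\nu$ with $\nu\ge1$ and $p^\nu\|n$ (it is $0$ for $n=1$). $\zeta$ is the Riemann zeta-function. *)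

(* Defs.v *)
From HB Require Import structures.
From mathcomp Require Import all_boot all_order all_algebra.
From mathcomp Require Import all_classical all_reals all_analysis.
Import Order.TTheory GRing.Theory Num.Theory.
Import numFieldNormedType.Exports.

Set Implicit Arguments.
Unset Strict Implicit.
Unset Printing Implicit Defensive.

Local Open Scope classical_set_scope.
Local Open Scope ring_scope.

(* [riemannR s] is the sequence n |-> 1 / (n + 1)^s, so this is the Dirichlet
   series of the Riemann zeta-function; it is meaningful for s > 1 only. *)
Definition zeta (R : realType) (s : R) : R := limn (series (riemannR s)).

(* Intended for h positive and continuous on a half-line [a, +oo[; the values
   of h off that half-line are irrelevant. *)
Definition regularly_varying (R : realType) (h : R -> R) (rho : R) : Prop :=
  forall c : R, 0 < c -> h (c * x) / h x @[x --> +oo] --> c `^ rho.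

(* For n > 0, p^nu || n with p prime and nu >= 1 holds exactly when p is in
   [primes n] and nu = logn p n. *)
Definition prime_power_sum (R : realType) (h : R -> R) (n : nat) : R :=
  \sum_(p <- primes n) (logn p n)%:R * h p%:R.

Definition summatory (R : realType) (f : nat -> R) (x : R) : R :=
  \sum_(1 <= n < (Num.truncn x).+1) f n.

(* Main.v *)
Require Import Defs.
From mathcomp Require Import all_boot all_order all_algebra.
From mathcomp Require Import all_classical all_reals all_analysis.
From mathcomp Require Import ring lra zify.
Import Order.TTheory GRing.Theory Num.Theory.
Import numFieldNormedType.Exports.

(* Let S(x) be the given sum and Phi(y) the sum of h(p) over the prime powers
   p^k <= y, so that S(x) = sum_(m <= x) Phi(x / m).  By the prime number theorem
   and the monotonicity of h, Phi(b x) - Phi(a x) lies between (b - a) h(a x) and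
   (b - a) h(b x) times x / log x, up to o(h(x) x / log x).

   Fix 0 < c < 1 and an ultrafilter of x -> oo along which h(c x) / h(x) tends to
   its limsup.  Along it h(l x) / h(x) and Phi(l x) log x / (x h(x)) have limits
   g(l) and B(l) for 0 < l <= 1, and
     (b - a) g(a) <= B(b) - B(a) <= (b - a) g(b),   C l g(l) = sum_m B(l / m).
   By extremality g(c l) <= g(c) g(l), so c g(c) B(l) - B(c l) is nondecreasing;
   as its values at 1/m sum to 0, it vanishes.  Hence B(l) is comparable to l^s
   with c^s = c g(c), and B <= q l^s implies B <= q k l^s for
   k = zeta(s) / (s C), likewise for lower bounds; iterating, k = 1.  So
   g(c) = c^rho with C = zeta(rho + 1) / (rho + 1), and the same argument applies
   to the liminf.

   The prime number theorem is obtained from Selberg's inequality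
     |R(x)| log^2 x <= 2 sum_(n <= x) log n |R(x / n)| + O(x log x),
   R(x) = psi(x) - x, derived with the Tatuzawa-Iseki identity. *)

Set Implicit Arguments.
Unset Strict Implicit.
Unset Printing Implicit Defensive.

Local Open Scope classical_set_scope.
Local Open Scope ring_scope.

(** * Arithmetic functions *)

(** The obstacle is that monotonicity bounds the ratios h(l x) / h(x) with l <= 1 but gives no
    convergence. The ultrafilter supplies limits for the uncountably many l at once, with no
    subsequences to extract. A limit profile from an arbitrary ultrafilter has no evident reason to
    be multiplicative. The extremal choice of it helps because the limsup bound holds at every large
    point, in particular at l x, and not only along the ultrafilter. The normalisation g(1) = 1 then
    matters: it gives the two sides of the resulting inequality the same total over the points 1/m.
    Since g is known only to be monotone, integrals of g are replaced throughout by the two-sided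
    bounds on B(b) - B(a).

    The exponent is not obtained by solving C = zeta(rho + 1) / (rho + 1): it is read off from the
    profile, so that a solution exists is a by-product. Uniqueness comes from the monotonicity of
    zeta(s) / s, and it also identifies the exponent of the limsup with that of the liminf, and the
    exponents found for different c. *)

Lemma big_divisorsE (V : zmodType) (G : nat -> V) (N k : nat) :
  (0 < k <= N)%N ->
  \sum_(d <- divisors k) G d = \sum_(1 <= d < N.+1 | (d %| k)%N) G d.
Proof.
case/andP => k0 kN; rewrite -[RHS]big_filter; apply: perm_big.
apply: uniq_perm; first exact: divisors_uniq.
  by rewrite filter_uniq // iota_uniq.
move=> d; rewrite -dvdn_divisors // mem_filter mem_index_iota.
case dk: (d %| k)%N => //=; have := dvdn_leq k0 dk; have := dvdn_gt0 k0 dk; lia.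
Qed.

Lemma sum_multiples (V : zmodType) (F : nat -> V) (d N : nat) : (0 < d)%N ->
  \sum_(1 <= k < N.+1 | (d %| k)%N) F (k %/ d)%N =
  \sum_(1 <= m < (N %/ d).+1) F m.
Proof.
move=> d0; elim: N => [|N IH]; first by rewrite div0n !big_geq.
have := divnS N d0; case dN: (d %| N.+1)%N => e;
  rewrite big_mkcond big_nat_recr //= -big_mkcond /= IH dN e ?addr0 ?add0n //.
by rewrite add1n [RHS]big_nat_recr //=.
Qed.

Lemma sum_divisors_swap (V : zmodType) (F : nat -> nat -> V) (N : nat) :
  \sum_(1 <= k < N.+1) \sum_(d <- divisors k) F d (k %/ d)%N =
  \sum_(1 <= d < N.+1) \sum_(1 <= m < (N %/ d).+1) F d m.
Proof.
transitivity (\sum_(1 <= k < N.+1) \sum_(1 <= d < N.+1 | (d %| k)%N) F d (k %/ d)%N).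
  by apply: eq_big_nat => k /andP[k1 kN]; rewrite (@big_divisorsE _ _ N) //; lia.
rewrite (exchange_big_dep_nat xpredT) //=; apply: eq_big_nat => d /andP[d1 _].
by rewrite -sum_multiples.
Qed.

Lemma sum_divisors_swap_mul (R : pzRingType) (a b f : nat -> R) (N : nat) :
  \sum_(1 <= d < N.+1) a d * (\sum_(1 <= m < (N %/ d).+1) b m * f (d * m)%N) =
  \sum_(1 <= k < N.+1) (\sum_(d <- divisors k) a d * b (k %/ d)%N) * f k.
Proof.
under eq_big_nat => d _ do rewrite big_distrr /=.
rewrite -(sum_divisors_swap (fun d m => a d * (b m * f (d * m)%N))).
apply: eq_big_nat => k /andP[k1 _]; rewrite big_distrl /=.
rewrite !big_seq; apply: eq_bigr => d; rewrite -dvdn_divisors // => dk.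
by rewrite mulnC divnK // mulrA.
Qed.

(** [primes n] is a singleton exactly for the prime powers p^k with k >= 1. One encoding serves
    three weights: log gives von Mangoldt's function, 1 the indicator of prime powers, and h the
    summand of Phi. *)
Definition lam (R : pzRingType) (f : nat -> R) (n : nat) : R :=
  if primes n is [:: p] then f p else 0.

Lemma primes_pfactor p k : prime p -> (0 < k)%N -> primes (p ^ k) = [:: p].
Proof. by move=> pp k0; rewrite primesX // primes_prime. Qed.

Lemma primes_eq1 n p : primes n = [:: p] ->
  [/\ prime p, (0 < logn p n)%N & n = (p ^ logn p n)%N].
Proof.
move=> e; have: p \in primes n by rewrite e inE.
rewrite mem_primes => /and3P[pp n0 pn]; split=> //.
  by rewrite logn_gt0 mem_primes pp n0.
by rewrite {1}[n]prod_prime_decomp // prime_decompE e /= big_seq1 /=.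
Qed.

Lemma lam_pfactor (R : pzRingType) (f : nat -> R) p k :
  prime p -> (0 < k)%N -> lam f (p ^ k)%N = f p.
Proof. by move=> pp k0; rewrite /lam primes_pfactor. Qed.

(** The divisors of n that are powers of a given p are p, ..., p^nu with nu = [logn p n], so p is
    counted nu times. This turns the inner sum of the hypothesis into the Dirichlet convolution of
    [lam f] with 1. *)
Lemma sum_divisors_lam (R : pzRingType) (f : nat -> R) n : (0 < n)%N ->
  \sum_(d <- divisors n) lam f d = \sum_(p <- primes n) (logn p n)%:R * f p.
Proof.
move=> n0.
transitivity (\sum_(d <- divisors n) \sum_(p <- primes n)
   (if primes d == [:: p] then f p else 0)).
  rewrite !big_seq; apply: eq_bigr => d; rewrite -dvdn_divisors // => dn.
  rewrite /lam; case e: (primes d) => [|p [|q s]].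
  - by rewrite big1.
  - have pn : p \in primes n.
      have : p \in primes d by rewrite e inE.
      rewrite !mem_primes n0 => /and3P[-> _ pd]; exact: dvdn_trans dn.
    rewrite (bigD1_seq p) ?primes_uniq //= eqxx big1 ?addr0 // => q qp.
    by rewrite eqseq_cons eq_sym (negbTE qp).
  - by rewrite big1 // => r _; rewrite eqseq_cons andbF.
rewrite exchange_big /= !big_seq; apply: eq_bigr => p pn.
have pp : prime p by move: pn; rewrite mem_primes => /and3P[].
rewrite -big_mkcond /= big_const_seq iter_addr_0 mulr_natl -size_filter; congr (_ *+ _).
have -> : size [seq d <- divisors n | primes d == [:: p]] =
          size [seq (p ^ k)%N | k <- iota 1 (logn p n)].
  apply: perm_size; apply: uniq_perm.
  - by rewrite filter_uniq ?divisors_uniq.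
  - rewrite map_inj_in_uniq ?iota_uniq // => i j _ _ /eqP.
    by rewrite eqn_exp2l ?prime_gt1 // => /eqP.
  - move=> d; rewrite mem_filter -dvdn_divisors //.
    apply/andP/mapP => [[/eqP /primes_eq1[_ k0 dE] dn]|[k]].
      exists (logn p d) => //; rewrite mem_iota.
      by have := dvdn_leq_log p n0 dn; lia.
    rewrite mem_iota => kn ->; rewrite primes_pfactor ?eqxx; [|by []|lia].
    by rewrite pfactor_dvdn //; lia.
by rewrite size_map size_iota.
Qed.

(** * The Moebius function *)

Definition mu (R : pzRingType) (n : nat) : R :=
  \prod_(p <- primes n) (if logn p n == 1%N then -1 else 0).

Lemma normr_mu_le1 (R : numDomainType) n : `|mu R n| <= 1.
Proof.
rewrite normr_prod; suff /andP[] : 0 <= \prod_(p <- primes n)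
  `|(if logn p n == 1%N then -1 else 0 : R)| <= 1 by [].
elim/big_ind: _ => [|x y /andP[x0 x1] /andP[y0 y1]|p _]; first by rewrite ler01 lexx.
  by rewrite mulr_ge0 // mulr_ile1.
by case: ifP => _; rewrite ?normrN ?normr1 ?normr0 ?ler01 ?lexx.
Qed.

Lemma mu1 (R : pzRingType) : mu R 1 = 1.
Proof. by rewrite /mu big_nil. Qed.

Lemma mu_prime_mul (R : comPzRingType) p d : prime p -> (0 < d)%N ->
  mu R (p * d) = if (p %| d)%N then 0 else - mu R d.
Proof.
move=> pp d0; have p0 := prime_gt0 pp.
case: ifP => pd.
  rewrite /mu (bigD1_seq p) ?primes_uniq //=; last first.
    by rewrite mem_primes pp muln_gt0 p0 d0 dvdn_mulr.
  rewrite lognM // (logn_prime p pp) eqxx; have : (0 < logn p d)%N.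
    by rewrite logn_gt0 mem_primes pp d0.
  by case: (logn p d) => // k _; rewrite mul0r.
have pnd : p \notin primes d by rewrite mem_primes pp d0 pd.
have -> : mu R (p * d) = \prod_(q <- p :: primes d)
    (if logn q (p * d) == 1%N then -1 else 0).
  apply: perm_big; apply: uniq_perm; rewrite ?primes_uniq /= ?pnd ?primes_uniq //.
  by move=> q; rewrite primesM // primes_prime // !inE.
rewrite big_cons lognM // (logn_prime p pp) eqxx.
have -> : logn p d = 0%N by apply/eqP; move: pnd; rewrite -logn_gt0 lt0n negbK.
rewrite addn0 eqxx mulN1r; congr (- _); rewrite /mu !big_seq; apply: eq_bigr => q qd.
rewrite lognM // (logn_prime q pp).
by case: (eqVneq q p) => [e|_]; [move: pnd; rewrite -e qd | rewrite add0n].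
Qed.

(* With p the least prime factor of n, the divisors d prime to p cancel
   against the divisors p d; the remaining ones are divisible by p^2. *)
Lemma sum_divisors_mu (R : comPzRingType) n : (0 < n)%N ->
  \sum_(d <- divisors n) mu R d = (n == 1%N)%:R.
Proof.
move=> n0; have [->|n1] := eqVneq n 1%N; first by rewrite big_seq1 mu1.
have pp : prime (pdiv n) by rewrite pdiv_prime //; lia.
have pn := pdiv_dvd n; set p := pdiv n in pp pn; have p0 := prime_gt0 pp.
rewrite (bigID (fun d => p %| d)%N) /=.
have m0 : (0 < n %/ p)%N by rewrite divn_gt0 // dvdn_leq.
have nE : n = (p * (n %/ p))%N by rewrite mulnC divnK.
have -> : \sum_(d <- divisors n | (p %| d)%N) mu R d =
   \sum_(d <- divisors (n %/ p)) mu R (p * d)%N.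
  rewrite -[LHS]big_filter -(big_map (muln p) xpredT) /=; apply: perm_big.
  apply: uniq_perm.
  - by rewrite filter_uniq // divisors_uniq.
  - by rewrite map_inj_uniq ?divisors_uniq // => i j /eqP; rewrite eqn_pmul2l // => /eqP.
  - move=> d; rewrite mem_filter -dvdn_divisors //; apply/andP/mapP => [[pd dn]|[e]].
      exists (d %/ p)%N; last by rewrite mulnC divnK.
      by rewrite -dvdn_divisors // -(@dvdn_pmul2l p) // -nE mulnC divnK.
    rewrite -dvdn_divisors // => em ->; rewrite dvdn_mulr //; split=> //.
    by rewrite nE dvdn_pmul2l.
have -> : \sum_(d <- divisors (n %/ p)) mu R (p * d)%N =
   - \sum_(d <- divisors (n %/ p) | ~~ (p %| d)%N) mu R d.
  rewrite -sumrN [RHS]big_mkcond /= !big_seq; apply: eq_bigr => d.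
  rewrite -dvdn_divisors // => dn; rewrite mu_prime_mul ?(dvdn_gt0 _ dn) //.
  by case: ifP.
apply/eqP; rewrite addrC subr_eq0; apply/eqP.
rewrite -[LHS]big_filter -[RHS]big_filter; apply: perm_big; apply: uniq_perm.
- by rewrite filter_uniq // divisors_uniq.
- by rewrite filter_uniq // divisors_uniq.
- move=> d; rewrite !mem_filter -!dvdn_divisors //; case pd: (p %| d)%N => //=.
  apply/idP/idP => [|dn]; last by apply: (dvdn_trans dn); rewrite {2}nE dvdn_mull.
  by rewrite {1}nE Gauss_dvdr // coprime_sym prime_coprime // pd.
Qed.

(** * Logarithmic sums *)

Section Elementary.
Variable R : realType.
Implicit Types (x y a b : R) (n N : nat).

Lemma ln_sub_le a b : 0 < a -> 0 < b -> ln a - ln b <= (a - b) / b.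
Proof.
move=> a0 b0; rewrite -ln_div ?posrE //.
have -> : a / b = 1 + (a - b) / b by field; rewrite gt_eqF.
by apply: le_ln1Dx; rewrite ltr_pdivlMr // mulN1r ltrBrDr addrC subrr.
Qed.

Lemma ln_sub_ge a b : 0 < a -> 0 < b -> (a - b) / a <= ln a - ln b.
Proof.
move=> a0 b0; have := ln_sub_le b0 a0.
by rewrite -lerN2 opprB -mulNr opprB.
Qed.

Lemma ln_succ_bounds n : (0 < n)%N ->
  n.+1%:R^-1 <= ln (n.+1%:R : R) - ln n%:R <= n%:R^-1.
Proof.
move=> n0; have p : 0 < n%:R :> R by rewrite ltr0n.
have q : 0 < n.+1%:R :> R by rewrite ltr0n.
have e : n.+1%:R - n%:R = 1 :> R by rewrite -natr1; lra.
have := ln_sub_le q p; have := ln_sub_ge q p.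
by rewrite e !mul1r => -> ->.
Qed.

Lemma truncn_divn x n : 0 <= x -> (0 < n)%N ->
  Num.truncn (x / n%:R) = (Num.truncn x %/ n)%N.
Proof.
move=> x0 n0; have p : 0 < n%:R :> R by rewrite ltr0n.
apply: truncn_def; rewrite ler_pdivlMr // ltr_pdivrMr // -!natrM.
rewrite -truncn_ge_nat // -truncn_lt_nat //.
by rewrite leq_divM /= mulnC [X in (_ < X)%N]mulnC ltn_ceil.
Qed.

Lemma truncn_bounds x : 1 <= x ->
  [/\ (0 < Num.truncn x)%N, (Num.truncn x)%:R <= x, x < (Num.truncn x)%:R + 1
    & 1 <= (Num.truncn x)%:R :> R].
Proof.
move=> x1; have x0 : 0 <= x by lra.
have /andP[h1 h2] := truncn_itv x0.
have h3 : (0 < Num.truncn x)%N by rewrite truncn_gt0.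
by split => //; [rewrite natr1 | rewrite ler1n].
Qed.

(** The constant is Euler's: [u] decreases, [v] increases, and they differ by 1/(n + 1), so the
    supremum of [v] lies below every [u]. *)
Lemma harmonic_asymp : exists g : R, forall x, 1 <= x ->
  `|summatory (fun n => n%:R^-1) x - ln x - g| <= 2 / x.
Proof.
pose u n : R := \sum_(1 <= k < n.+2) k%:R^-1 - ln n.+1%:R.
pose v n : R := u n - n.+1%:R^-1.
have uS n : u n.+1 = u n + n.+2%:R^-1 - (ln n.+2%:R - ln n.+1%:R).
  rewrite /u [X in X - _ = _]big_nat_recr //=; set S := \sum_(_ <= _ < _) _; ring.
have umono n m : (n <= m)%N -> u m <= u n.
  move=> /subnK <-; elim: (m - n)%N => [|k IH]; first by rewrite add0n.
  apply: le_trans IH; rewrite addSn uS -addrA gerDl subr_le0.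
  by have /andP[] := @ln_succ_bounds (k + n).+1 isT.
have vmono n m : (n <= m)%N -> v n <= v m.
  move=> /subnK <-; elim: (m - n)%N => [|k IH]; first by rewrite add0n.
  apply: (le_trans IH); rewrite addSn /v uS.
  have aux (a i d j : R) : d <= j -> a - j <= a + i - d - i by lra.
  by apply: aux; have /andP[] := @ln_succ_bounds (k + n).+1 isT.
have vu n m : v n <= u m.
  apply: (le_trans (vmono n (maxn n m) (leq_maxl _ _))).
  apply: (le_trans _ (umono m (maxn n m) (leq_maxr _ _))).
  by rewrite /v lerBlDr lerDl invr_ge0 ler0n.
have hs : has_sup (range v).
  split; first by exists (v 0%N); exists 0%N.
  by exists (u 0%N) => _ [n _ <-].
pose g := sup (range v).
have vg n : v n <= g by apply: ub_le_sup; [case: hs | exists n].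
have gu n : g <= u n by apply: ge_sup; [case: hs | move=> _ [m _ <-]].
exists g => x x1; rewrite /summatory.
have [N0 Nx xN N1] := truncn_bounds x1.
set N := Num.truncn x in N0 Nx xN N1 *.
have p : 0 < N%:R :> R by lra.
have p' : 0 < x by lra.
have := ln_sub_le p' p; have := ln_sub_ge p' p.
have := vg N.-1; have := gu N.-1; rewrite /v /u (prednK N0).
set S := \sum_(_ <= _ < _) _ => h1 h2 h3 h4.
have i1 : 0 <= (x - N%:R) / x by rewrite divr_ge0; lra.
have i2 : (x - N%:R) / N%:R <= N%:R^-1 by rewrite ler_pdivrMr // mulVf ?gt_eqF //; lra.
have i3 : N%:R^-1 <= 2 / x.
  by rewrite ler_pdivlMr // mulrC ler_pdivrMr //; lra.
rewrite ler_norml; apply/andP; split; lra.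
Qed.

Lemma lnfact_nat_bounds N : (0 < N)%N ->
  N%:R * ln N%:R - N%:R + 1 <= \sum_(1 <= n < N.+1) ln (n%:R : R)
  <= N%:R * ln N%:R - N%:R + 1 + ln N%:R.
Proof.
case: N => // N _; elim: N => [|N /andP[I1 I2]].
  by rewrite big_nat1 ln1; lra.
rewrite big_nat_recr //=.
have /andP[] := @ln_succ_bounds N.+1 isT.
have p : 0 < N.+1%:R :> R by rewrite ltr0n.
have e : N.+2%:R = N.+1%:R + 1 :> R by rewrite natr1.
have q : 0 < N.+1%:R + 1 :> R by lra.
rewrite e -(ler_pM2l q) mulfV ?gt_eqF // => h1.
rewrite -(ler_pM2l p) mulfV ?gt_eqF // => h2.
by apply/andP; split; lra.
Qed.

Lemma lnfact_asymp x : 1 <= x ->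
  `|summatory (fun n => ln n%:R) x - (x * ln x - x)| <= 1 + ln x.
Proof.
move=> x1; rewrite /summatory.
have [N0 Nx xN N1] := truncn_bounds x1.
have /andP[] := lnfact_nat_bounds N0.
set N := Num.truncn x in N0 Nx xN N1 *.
have p : 0 < N%:R :> R by lra.
have p' : 0 < x by lra.
have := ln_sub_le p' p; have := ln_sub_ge p' p.
rewrite ler_pdivrMr // ler_pdivlMr // => h1 h2 h3 h4.
have l0 : 0 <= ln (N%:R : R) by apply: ln_ge0.
have lx0 : 0 <= ln x by apply: ln_ge0.
have : ln N%:R <= ln x by rewrite ler_ln ?posrE.
move=> h5.
have h6 : (x - N%:R) * ln x <= ln x by rewrite ler_piMl //; lra.
have h7 : 0 <= (x - N%:R) * ln N%:R by rewrite mulr_ge0 //; lra.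
by rewrite ler_norml; apply/andP; split; lra.
Qed.

Lemma sum_ln_over_le N : (0 < N)%N ->
  \sum_(1 <= n < N.+1) ln n%:R / n%:R <= ln N%:R ^+ 2 / 2 + 1 :> R.
Proof.
(* Each induction step loses at most (1/n - 1/(n + 1)) / 2, which telescopes; hence the sharper
   constant (1 - 1/N) / 2. *)
move=> N0; apply: (@le_trans _ _ (ln N%:R ^+ 2 / 2 + (1 - N%:R^-1) / 2)); last first.
  have : 0 <= N%:R^-1 :> R by rewrite invr_ge0.
  lra.
case: N N0 => // N _; elim: N => [|N IH].
  by rewrite big_nat1 ln1 mul0r invr1 expr0n /= subrr !mul0r addr0.
rewrite big_nat_recr //=; apply: (le_trans (lerD IH (lexx _))).
have /andP[] := @ln_succ_bounds N.+1 isT.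
have p : 0 < N.+1%:R :> R by rewrite ltr0n.
have e : N.+2%:R = N.+1%:R + 1 :> R by rewrite natr1.
have q : 0 < N.+1%:R + 1 :> R by lra.
have l0 : 0 <= ln (N.+1%:R : R) by apply: ln_ge0; rewrite ler1n.
rewrite e; set n := N.+1%:R in p q l0 *; set a := ln n in l0 *.
set b := ln _; set i := (n + 1)^-1; set j := n^-1 => h1 h2.
have ij : i * j = j - i.
  by rewrite /i /j; field; rewrite !gt_eqF.
have i0 : 0 <= i by rewrite invr_ge0 ltW.
have h3 : 0 <= (b - a - i) * (a + b) by rewrite mulr_ge0; lra.
have h4 : 0 <= i * (j - (b - a)) by rewrite mulr_ge0; lra.
by nra.
Qed.

Lemma sum_sqrt_div_le x : 1 <= x ->
  summatory (fun n => Num.sqrt (x / n%:R)) x <= 2 * x.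
Proof.
move=> x1; rewrite /summatory.
have [N0 Nx xN N1] := truncn_bounds x1.
set N := Num.truncn x in N0 Nx xN N1 *.
have x0 : 0 <= x by lra.
under eq_bigr do rewrite sqrtrM //.
rewrite -mulr_sumr.
have : \sum_(1 <= i < N.+1) Num.sqrt (i%:R^-1 : R) <= 2 * Num.sqrt N%:R.
  elim: {N0 Nx xN N1} N => [|n IH]; first by rewrite big_geq // sqrtr0 mulr0.
  rewrite big_nat_recr //=; apply: (le_trans (lerD IH (lexx _))).
  rewrite sqrtrV ?ler0n //.
  have p : 0 < Num.sqrt n.+1%:R :> R by rewrite sqrtr_gt0 ltr0n.
  have q : 0 <= Num.sqrt n%:R :> R by rewrite sqrtr_ge0.
  have e : Num.sqrt n.+1%:R ^+ 2 = Num.sqrt n%:R ^+ 2 + 1 :> R.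
    by rewrite !sqr_sqrtr ?ler0n // natr1.
  rewrite -(ler_pM2l p) mulrDr mulfV ?gt_eqF //.
  have := sqr_ge0 (Num.sqrt n.+1%:R - Num.sqrt n%:R : R).
  by nra.
move=> h; apply: (le_trans (ler_wpM2l (sqrtr_ge0 x) h)).
have h2 : Num.sqrt N%:R <= Num.sqrt x by rewrite ler_wsqrtr.
have h3 : Num.sqrt x * Num.sqrt x = x by rewrite -expr2 sqr_sqrtr.
have h4 := sqrtr_ge0 x.
by nra.
Qed.

(** With t the fourth root of x, 1 + ln x = 1 + 4 ln t <= 4 t - 3 <= 4 t. *)
Lemma ln1_sqr_le x : 1 <= x -> (1 + ln x) ^+ 2 <= 16 * Num.sqrt x.
Proof.
move=> x1; have x0 : 0 < x by lra.
pose s := Num.sqrt x; pose t := Num.sqrt s.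
have s1 : 1 <= s by rewrite -sqrtr1 ler_wsqrtr.
have t1 : 1 <= t by rewrite -sqrtr1 ler_wsqrtr.
have ts : t ^+ 2 = s by rewrite sqr_sqrtr //; lra.
have sx : s ^+ 2 = x by rewrite sqr_sqrtr //; lra.
have : ln x = 4 * ln t.
  by rewrite -sx -ts !lnXn ?mulr_natl -?mulrnA //; nra.
have := @ln_sub_le t 1; rewrite ln1 => h ->; rewrite -/s -ts.
have {h} : ln t <= t - 1 by have := h; rewrite divr1 subr0; apply; lra.
have : 0 <= ln t by apply: ln_ge0.
by nra.
Qed.

End Elementary.

(** * The Chebyshev function psi *)

Section Chebyshev.
Variable R : realType.
Implicit Types (x y : R) (f g a b : nat -> R) (n N : nat).

Lemma summatory_nat f N : summatory f (N%:R : R) = \sum_(1 <= n < N.+1) f n.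
Proof. by rewrite /summatory natrK. Qed.

Lemma summatory_indexP x n : (1 <= n < (Num.truncn x).+1)%N ->
  [/\ (0 < n)%N, n%:R <= x, 0 < n%:R :> R & 1 <= x / n%:R].
Proof.
case/andP => n1; rewrite ltnS => nx.
have x1 : 1 <= x by rewrite -truncn_gt0; exact: leq_trans nx.
have x0 : 0 <= x by lra.
have nx' : n%:R <= x by rewrite -truncn_ge_nat.
have n0 : 0 < n%:R :> R by rewrite ltr0n.
by split => //; rewrite ler_pdivlMr // mul1r.
Qed.

Lemma ler_summatory f g x :
  (forall n, (0 < n)%N -> n%:R <= x -> f n <= g n) ->
  summatory f x <= summatory g x.
Proof.
by move=> fg; apply: ler_sum_nat => n /summatory_indexP[n0 nx _ _]; exact: fg.
Qed.

Lemma eq_summatory f g x :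
  (forall n, (0 < n)%N -> n%:R <= x -> f n = g n) ->
  summatory f x = summatory g x.
Proof.
by move=> fg; apply: eq_big_nat => n /summatory_indexP[n0 nx _ _]; exact: fg.
Qed.

Lemma summatoryD f g x :
  summatory (fun n => f n + g n) x = summatory f x + summatory g x.
Proof. exact: big_split. Qed.

Lemma summatoryB f g x :
  summatory (fun n => f n - g n) x = summatory f x - summatory g x.
Proof. exact: sumrB. Qed.

Lemma summatoryZ (c : R) f x :
  summatory (fun n => c * f n) x = c * summatory f x.
Proof. by rewrite /summatory mulr_sumr. Qed.

Lemma normr_summatory f x :
  `|summatory f x| <= summatory (fun n => `|f n|) x.
Proof. exact: ler_norm_sum. Qed.

Lemma summatory_ge0 f x : (forall n, (0 < n)%N -> 0 <= f n) -> 0 <= summatory f x.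
Proof.
move=> f0; rewrite /summatory big_nat_cond sumr_ge0 // => n /andP[/andP[n1 _] _].
exact: f0.
Qed.

Lemma summatory_mono f x y : (forall n, (0 < n)%N -> 0 <= f n) -> x <= y ->
  summatory f x <= summatory f y.
Proof.
move=> f0 xy; rewrite /summatory; have h := le_truncn xy.
rewrite [leRHS](@big_cat_nat _ _ _ (Num.truncn x).+1) //= lerDl.
rewrite big_nat_cond sumr_ge0 // => n /andP[/andP[n1 _] _].
by apply: f0; apply: leq_ltn_trans n1.
Qed.

(** Both sides run over the pairs (d, m) with d m <= x; the right one groups them by k = d m. Most
    convolution identities below are instances. *)
Lemma summatory_swap a b (f : R -> R) x : 0 <= x ->
  summatory (fun d => a d * summatory (fun m => b m * f (x / d%:R / m%:R)) (x / d%:R)) x =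
  summatory (fun k => (\sum_(d <- divisors k) a d * b (k %/ d)%N) * f (x / k%:R)) x.
Proof.
move=> x0; rewrite /summatory -(sum_divisors_swap_mul a b (fun k => f (x / k%:R))).
apply: eq_big_nat => d /summatory_indexP[d0 _ _ _]; rewrite truncn_divn //.
by congr (_ * _); apply: eq_bigr => m _; rewrite natrM invfM mulrA.
Qed.

Lemma sum_primes_ln n : (0 < n)%N ->
  \sum_(p <- primes n) (logn p n)%:R * ln (p%:R : R) = ln n%:R.
Proof.
move=> n0; rewrite {3}[n]prod_prime_decomp // prime_decompE big_map /=.
rewrite natr_prod; have : all prime (primes n).
  by apply/allP => p; rewrite mem_primes => /and3P[].
move=> ap; suff [] : 0 < \prod_(p <- primes n) (p ^ logn p n)%:R :> R /\
  \sum_(p <- primes n) (logn p n)%:R * ln (p%:R : R) =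
  ln (\prod_(p <- primes n) (p ^ logn p n)%:R) by [].
elim: (primes n) ap => [_|p s IH /= /andP[pp /IH[s0 es]]]; first by rewrite !big_nil ln1.
have p0 : 0 < p%:R :> R by rewrite ltr0n prime_gt0.
have q0 : 0 < (p ^ logn p n)%:R :> R by rewrite natrX exprn_gt0.
rewrite !big_cons es lnM ?posrE // mulr_gt0 //; split=> //.
by rewrite natrX lnXn // mulr_natl.
Qed.

Definition mangoldt : nat -> R := lam (fun p => ln p%:R).
Definition psi (x : R) : R := summatory mangoldt x.

Lemma sum_divisors_mangoldt n : (0 < n)%N ->
  \sum_(d <- divisors n) mangoldt d = ln n%:R.
Proof. by move=> n0; rewrite sum_divisors_lam // sum_primes_ln. Qed.

Lemma mangoldt_ge0 n : 0 <= mangoldt n.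
Proof.
rewrite /mangoldt /lam; case e: (primes n) => [|p [|q s]] //.
by apply: ln_ge0; rewrite ler1n; have [/prime_gt0] := primes_eq1 e.
Qed.

Lemma mangoldt_le_ln n : (0 < n)%N -> mangoldt n <= ln n%:R.
Proof.
move=> n0; have l0 : 0 <= ln (n%:R : R) by apply: ln_ge0; rewrite ler1n.
rewrite /mangoldt /lam; case e: (primes n) => [|p [|q s]] //.
have : p \in primes n by rewrite e inE.
rewrite mem_primes => /and3P[/prime_gt0 p0 _ pn].
by rewrite ler_ln ?posrE ?ltr0n // ler_nat dvdn_leq.
Qed.

Lemma psi_ge0 x : 0 <= psi x.
Proof. by apply: summatory_ge0 => n _; exact: mangoldt_ge0. Qed.

Lemma psi_mono x y : x <= y -> psi x <= psi y.
Proof. by apply: summatory_mono => n _; exact: mangoldt_ge0. Qed.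

Lemma psi_natS N : psi N.+1%:R = psi N%:R + mangoldt N.+1.
Proof. by rewrite /psi !summatory_nat big_nat_recr. Qed.

Lemma psi_truncn x : psi x = psi (Num.truncn x)%:R.
Proof. by rewrite /psi summatory_nat. Qed.

Lemma sum_mangoldt_divn N :
  \sum_(1 <= n < N.+1) mangoldt n * (N %/ n)%:R = \sum_(1 <= n < N.+1) ln n%:R.
Proof.
transitivity (\sum_(1 <= d < N.+1) \sum_(1 <= m < (N %/ d).+1) mangoldt d).
  by apply: eq_bigr => d _; rewrite sumr_const_nat subSS subn0 mulr_natr.
rewrite -(sum_divisors_swap (fun d _ => mangoldt d)).
by apply: eq_big_nat => k /andP[k0 _]; exact: sum_divisors_mangoldt.
Qed.

Lemma sum_mangoldt_divn_wide M N : (M <= N)%N ->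
  \sum_(1 <= n < N.+1) mangoldt n * (M %/ n)%:R = \sum_(1 <= n < M.+1) ln n%:R.
Proof.
move=> MN; rewrite (@big_cat_nat _ _ _ M.+1) //= sum_mangoldt_divn.
rewrite [X in _ + X]big_nat [X in _ + X]big1 ?addr0 // => n /andP[Mn _].
by rewrite divn_small // mulr0.
Qed.

(** Chebyshev's argument: the logarithm of the central binomial coefficient is the sum of Lambda(n)
    (floor(2M/n) - 2 floor(M/n)), where the factor is never negative and is at least 1 for M < n <=
    2M. *)
Lemma psi_double_le M : (0 < M)%N -> psi (2 * M)%:R - psi M%:R <= 4 * M%:R.
Proof.
move=> M0; have M2 : (M <= 2 * M)%N by lia.
have m1 : 1 <= M%:R :> R by rewrite ler1n.
have /andP[h1 _] := lnfact_nat_bounds R M0.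
have /andP[_ h2] : _ && _ := lnfact_nat_bounds R (leq_trans M0 M2).
apply: (@le_trans _ _ (\sum_(1 <= n < (2 * M).+1) ln n%:R - 2 * \sum_(1 <= n < M.+1) ln n%:R)).
  rewrite -sum_mangoldt_divn -(sum_mangoldt_divn_wide M2) mulr_sumr -sumrB.
  rewrite /psi !summatory_nat (@big_cat_nat _ _ _ M.+1) //= addrAC subrr add0r.
  rewrite (@big_cat_nat _ _ _ M.+1 1 (2 * M).+1) //= -[leLHS]add0r lerD //.
    rewrite big_nat_cond sumr_ge0 // => n /andP[/andP[n1 _] _].
    rewrite mulrCA -mulrBr mulr_ge0 ?mangoldt_ge0 // subr_ge0 -natrM ler_nat.
    by rewrite leq_divRL // -mulnA leq_mul2l leq_divM.
  apply: ler_sum_nat => n /andP[n1 n2].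
  rewrite (@divn_small M) // mulr0 mulr0 subr0 -[leLHS]mulr1 ler_wpM2l ?mangoldt_ge0 //.
  by rewrite ler1n divn_gt0 //; lia.
apply: (le_trans (lerB h2 (ler_wpM2l _ h1))) => //.
rewrite natrM; have p : 0 < M%:R :> R by lra.
have l2 : ln (2 : R) <= 1 by have := @ln_sub_le R 2 1; rewrite ln1; lra.
have lM : ln (M%:R : R) <= M%:R - 1 by have := @ln_sub_le R M%:R 1; rewrite ln1; lra.
rewrite lnM ?posrE //; have : M%:R * ln (2 : R) <= M%:R by rewrite ler_piMr //; lra.
by lra.
Qed.

(** With u = [uphalf N], psi(N) <= psi(2u) <= psi(u) + 4u <= 16u by induction, and 16u <= 8(N + 1)
    <= 12N once N >= 2. *)
Lemma psi_le x : 0 <= x -> psi x <= 12 * x.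
Proof.
move=> x0; rewrite psi_truncn; have /andP[h _] := truncn_itv x0.
apply: (@le_trans _ _ (12 * (Num.truncn x)%:R)); last by rewrite ler_wpM2l.
move: (Num.truncn x) => {h x0 x} N; elim/ltn_ind: N => N IH.
have [N1|N1] := leqP N 1.
  suff -> : psi N%:R = 0 by rewrite mulr_ge0.
  rewrite /psi summatory_nat; case: N N1 {IH} => [|[|//]] _; first by rewrite big_geq.
  by rewrite big_nat1.
have uN : (uphalf N < N)%N by lia.
have u0 : (0 < uphalf N)%N by lia.
have := IH _ uN; have := psi_double_le u0.
have : psi N%:R <= psi (2 * uphalf N)%:R by apply: psi_mono; rewrite ler_nat; lia.
have : (uphalf N).*2%:R <= N%:R + 1 :> R by rewrite natr1 ler_nat; lia.
rewrite -mul2n natrM; have : 2 <= N%:R :> R by rewrite ler_nat.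
lra.
Qed.

(** The logarithm of the factorial of floor(x) is x ln x + O(x) and equals the sum of Lambda(n)
    floor(x/n); removing the floors costs at most psi(x) <= 12x. *)
Lemma mertens x : 1 <= x ->
  `|summatory (fun n => mangoldt n / n%:R) x - ln x| <= 14.
Proof.
move=> x1; have x0 : 0 < x by lra.
have l0 : ln x <= x - 1 by have := @ln_sub_le R x 1; rewrite ln1; lra.
have := lnfact_asymp x1; rewrite /summatory -sum_mangoldt_divn => h.
have : 0 <= summatory (fun n => mangoldt n * (x / n%:R - (Num.truncn x %/ n)%:R)) x <= 12 * x.
  apply/andP; split.
    rewrite /summatory big_nat_cond sumr_ge0 // => n /andP[/summatory_indexP[n0 nx n0' _] _].
    rewrite mulr_ge0 ?mangoldt_ge0 // subr_ge0 -truncn_divn ?(ltW x0) //.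
    by rewrite truncn_le divr_ge0 // ltW.
  apply: le_trans (psi_le (ltW x0)); apply: ler_summatory => n n0 nx.
  rewrite -[leRHS]mulr1 ler_wpM2l ?mangoldt_ge0 // -truncn_divn ?(ltW x0) //.
  have /andP[_] : _ && _ := @truncn_itv _ (x / n%:R) (divr_ge0 (ltW x0) (ler0n _ _)).
  rewrite -natr1; lra.
rewrite /summatory; under eq_bigr => n _.
  rewrite mulrBr mulrCA; over.
rewrite sumrB -mulr_sumr; move: h; set S := \sum_(_ <= _ < _) _; set T := \sum_(_ <= _ < _) _.
rewrite !ler_norml => /andP[h1 h2] /andP[h3 h4].
apply/andP; split; rewrite -(ler_pM2l x0); nra.
Qed.

End Chebyshev.

(** * Selberg's formula *)

Lemma sum_divisors_rev (V : zmodType) (G : nat -> V) n : (0 < n)%N ->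
  \sum_(d <- divisors n) G (n %/ d)%N = \sum_(d <- divisors n) G d.
Proof.
move=> n0; rewrite -(big_map (fun d => n %/ d)%N xpredT G); apply: perm_big.
have inv d : (d %| n)%N -> (n %/ (n %/ d))%N = d.
  by move=> dn; rewrite divnA // mulKn.
apply: uniq_perm; rewrite ?divisors_uniq //.
  rewrite map_inj_in_uniq ?divisors_uniq // => i j.
  by rewrite -!dvdn_divisors // => /inv {2}<- /inv {2}<- ->.
move=> d; apply/mapP/idP => [[e]|].
  by rewrite -!dvdn_divisors // => en ->; rewrite dvdn_div.
rewrite -dvdn_divisors // => dn; exists (n %/ d)%N; last by rewrite inv.
by rewrite -dvdn_divisors // dvdn_div.
Qed.

Section Selberg.
Variable R : realType.
Implicit Types (x y : R).
Local Notation mangoldt := (mangoldt R).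

Lemma sum_psi_div x : 0 <= x ->
  summatory (fun n => psi (x / n%:R)) x = summatory (fun n => ln n%:R) x.
Proof.
move=> x0; have := @summatory_swap R (fun=> 1) mangoldt (fun=> 1) x x0.
rewrite (@eq_summatory _ _ (fun n => psi (x / n%:R))); last first.
  by move=> n _ _; rewrite mul1r; apply: eq_summatory => m _ _; rewrite mulr1.
move=> ->; apply: eq_summatory => k k0 _; rewrite mulr1 -(sum_divisors_mangoldt R k0).
by under eq_bigr do rewrite mul1r; rewrite sum_divisors_rev.
Qed.

(** For F = psi this is the left side of Selberg's symmetry formula. *)
Definition selberg_op (F : R -> R) x :=
  F x * ln x + summatory (fun n => mangoldt n * F (x / n%:R)) x.

(* Tatuzawa-Iseki: log is a derivation, and log = Lambda * 1. *)
Lemma sum_selberg_op (F : R -> R) x : 1 <= x ->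
  summatory (fun n => selberg_op F (x / n%:R)) x =
  ln x * summatory (fun n => F (x / n%:R)) x.
Proof.
move=> x1; have x0 : 0 < x by lra.
rewrite summatoryD.
have := @summatory_swap R (fun=> 1) mangoldt F x (ltW x0).
rewrite (@eq_summatory _ _ (fun n => summatory (fun m => mangoldt m * F (x / n%:R / m%:R)) (x / n%:R))); last first.
  by move=> n _ _; rewrite mul1r.
move=> ->; rewrite -summatoryZ -summatoryD; apply: eq_summatory => k k0 _.
under eq_bigr do rewrite mul1r.
by rewrite sum_divisors_rev // sum_divisors_mangoldt // ln_div ?posrE ?ltr0n //; ring.
Qed.

Lemma mobius_inversion (u : R -> R) x : 1 <= x ->
  u x = summatory (fun d => mu R d * summatory (fun m => u (x / d%:R / m%:R)) (x / d%:R)) x.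
Proof.
move=> x1; have x0 : 0 < x by lra.
have := @summatory_swap R (mu R) (fun=> 1) u x (ltW x0).
rewrite (@eq_summatory _ _ (fun d => mu R d * summatory (fun m => u (x / d%:R / m%:R)) (x / d%:R))); last first.
  by move=> n _ _; congr (_ * _); apply: eq_summatory => m _ _; rewrite mul1r.
move=> ->; rewrite /summatory.
have [N0 _ _ _] := truncn_bounds x1.
rewrite big_ltn // big_seq1 mu1 !mulr1 mul1r divr1 big_nat big1 ?addr0 // => k /andP[k2 _].
under eq_bigr do rewrite mulr1.
by rewrite sum_divisors_mu ?(ltnW k2) // gtn_eqF // mul0r.
Qed.

(** Moebius inversion of [sum_selberg_op] writes [selberg_op F x] as the sum over d of mu(d) ln(x/d)
    times the sum of F(x/(d m)) over m. Each term is O((1 + ln(x/d))^2), hence O(sqrt(x/d)), and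
    these add up to O(x). *)
Lemma selberg_op_bound (F : R -> R) (K : R) : 0 <= K ->
  (forall x, 1 <= x -> `|summatory (fun n => F (x / n%:R)) x| <= K * (1 + ln x)) ->
  forall x, 1 <= x -> `|selberg_op F x| <= 32 * K * x.
Proof.
move=> K0 H x x1; rewrite (mobius_inversion (selberg_op F) x1).
apply: (le_trans (normr_summatory _ _)).
apply: (@le_trans _ _ (summatory (fun n => 16 * K * Num.sqrt (x / n%:R)) x)); last first.
  rewrite summatoryZ; have := sum_sqrt_div_le x1; nra.
apply: ler_sum_nat => d /summatory_indexP[d0 dx _ xd1].
rewrite normrM -[leRHS]mul1r ler_pM ?normr_mu_le1 //.
rewrite sum_selberg_op // normrM.
have l0 : 0 <= ln (x / d%:R) by apply: ln_ge0.
rewrite (ger0_norm l0).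
have h1 := H _ xd1; have h2 := ln1_sqr_le xd1.
apply: (le_trans (ler_wpM2l l0 h1)).
have : K * (1 + ln (x / d%:R)) ^+ 2 <= K * (16 * Num.sqrt (x / d%:R)) by rewrite ler_wpM2l.
nra.
Qed.

Lemma selberg_rem : exists2 K : R, 0 <= K & forall x, 1 <= x ->
  `|selberg_op (fun t => psi t - t) x| <= K * x.
Proof.
(* Up to O(1 + ln x), the sum of psi(x/n) is x ln x - x and the sum of x/n is x ln x + g x; adding c
   = g + 1 to each term cancels what is linear in x. *)
have [g Hg] := harmonic_asymp R; pose c := g + 1.
pose K0 := 3 + `|c|; have K00 : 0 <= K0 by rewrite addr_ge0.
have H : forall x, 1 <= x ->
    `|summatory (fun n => psi (x / n%:R) - x / n%:R + c) x| <= K0 * (1 + ln x).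
  move=> x x1; have x0 : 0 < x by lra.
  rewrite summatoryD summatoryB summatoryZ sum_psi_div ?(ltW x0) //.
  have -> : summatory (fun=> c) x = (Num.truncn x)%:R * c.
    by rewrite /summatory sumr_const_nat subSS subn0 mulr_natl.
  have [_ N1 N2 _] := truncn_bounds x1.
  have := Hg x x1; have := lnfact_asymp x1.
  set S := summatory _ _; set T := summatory _ _; rewrite !ler_norml.
  move=> /andP[s1 s2] /andP[]; rewrite -(ler_pM2l x0) -[in X in _ -> X -> _](ler_pM2l x0).
  have -> : x * (2 / x) = 2 by rewrite mulrCA mulfV ?mulr1 // gt_eqF.
  have -> : x * - (2 / x) = -2 by rewrite mulrN mulrCA mulfV ?mulr1 // gt_eqF.
  move=> t1 t2; have l0 : 0 <= ln x by apply: ln_ge0.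
  set N := (Num.truncn x)%:R in N1 N2 *.
  have cc : - `|c| <= (N - x) * c <= `|c|.
    rewrite -ler_norml normrM -[leRHS]mul1r ler_wpM2r // ler_norml; lra.
  have gE : g = c - 1 by rewrite /c; ring.
  rewrite gE in t1 t2; have nc := normr_ge0 c; rewrite /K0.
  move: cc => /andP[c1 c2]; apply/andP; split; nra.
exists (32 * K0 + `|c| * 13); first by rewrite addr_ge0 ?mulr_ge0.
move=> x x1; have x0 : 0 <= x by lra.
have h := @selberg_op_bound (fun t => psi t - t + c) K0 K00 H x x1.
(* Removing the constant c from F changes the operator by c (ln x + psi x), which is O(x). *)
have -> : selberg_op (fun t => psi t - t) x =
    selberg_op (fun t => psi t - t + c) x - c * (ln x + psi x).
  have e : summatory (fun n => mangoldt n * (psi (x / n%:R) - x / n%:R + c)) x =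
    summatory (fun n => mangoldt n * (psi (x / n%:R) - x / n%:R)) x + c * psi x.
    rewrite -summatoryZ -summatoryD; apply: eq_summatory => n _ _; ring.
  rewrite /selberg_op e; ring.
apply: (le_trans (ler_normB _ _)); rewrite [leRHS]mulrDl lerD // normrM -mulrA ler_wpM2l //.
have l0 : 0 <= ln x by apply: ln_ge0.
have l1 : ln x <= x - 1 by have := @ln_sub_le R x 1; rewrite ln1; lra.
have h1 := psi_le x0; have h2 := psi_ge0 x.
rewrite ger0_norm; lra.
Qed.

(** The main term is the value of the operator at F(t) = t: one x ln x from F(x) ln x, the other
    from Mertens' sum. *)
Lemma selberg_psi : exists2 K : R, 0 <= K & forall x, 1 <= x ->
  `|selberg_op (@psi R) x - 2 * x * ln x| <= K * x.
Proof.
have [K K0 H] := selberg_rem; exists (K + 14); first by lra.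
move=> x x1; have x0 : 0 < x by lra.
have := H x x1; have := mertens x1.
have -> : selberg_op (@psi R) x = selberg_op (fun t => psi t - t) x + x * ln x
   + x * summatory (fun n => mangoldt n / n%:R) x.
  rewrite /selberg_op -summatoryZ.
  have -> : summatory (fun n => mangoldt n * psi (x / n%:R)) x =
    summatory (fun n => mangoldt n * (psi (x / n%:R) - x / n%:R)) x +
    summatory (fun n => x * (mangoldt n / n%:R)) x.
    rewrite -summatoryD; apply: eq_summatory => n _ _; ring.
  ring.
set S := summatory _ _; set T := selberg_op _ _.
rewrite !ler_norml => /andP[s1 s2] /andP[t1 t2].
apply/andP; split; nra.
Qed.

End Selberg.

(** * Selberg's inequality for the remainder psi(x) - x *)

Section SelbergIteration.
Variable R : realType.
Implicit Types (x y : R).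
Local Notation mangoldt := (mangoldt R).

Definition psi_rem x := psi x - x.

Lemma norm_psi_rem_le x : 0 <= x -> `|psi_rem x| <= 12 * x.
Proof.
move=> x0; have h1 := psi_le x0; have h2 := psi_ge0 x.
by rewrite /psi_rem ler_norml; apply/andP; split; lra.
Qed.

Lemma norm_psi_rem_sub_le x y : x <= y ->
  `|psi_rem y - psi_rem x| <= (psi y + y) - (psi x + x).
Proof.
move=> xy; have h := psi_mono xy.
by rewrite /psi_rem ler_norml; apply/andP; split; lra.
Qed.

Lemma harmonic_le N : (0 < N)%N ->
  \sum_(1 <= n < N.+1) n%:R^-1 <= 1 + ln (N%:R : R).
Proof.
case: N => // N _; elim: N => [|N IH]; first by rewrite big_nat1 ln1 invr1 addr0.
rewrite big_nat_recr //=; apply: (le_trans (lerD IH (lexx _))).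
have /andP[h _] := @ln_succ_bounds R N.+1 isT.
by rewrite -addrA lerD2l addrC -lerBrDr.
Qed.

(** Discrete form of the integral of psi(t)/t: passing from N to N + 1 adds psi(N) (ln(N + 1) - ln
    N), which is at most 12. *)
Lemma sum_mangoldt_ln_sub N : (0 < N)%N ->
  0 <= \sum_(1 <= k < N.+1) mangoldt k * (ln N%:R - ln k%:R) <= 12 * N%:R.
Proof.
case: N => // N _; elim: N => [|N /andP[I1 I2]].
  by rewrite big_nat1 ln1 subrr mulr0 lexx mulr1 ler0n.
have -> : \sum_(1 <= k < N.+3) mangoldt k * (ln N.+2%:R - ln k%:R) =
   \sum_(1 <= k < N.+2) mangoldt k * (ln N.+1%:R - ln k%:R) +
   psi N.+1%:R * (ln N.+2%:R - ln N.+1%:R).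
  rewrite big_nat_recr //= subrr mulr0 addr0 /psi summatory_nat mulr_suml -big_split /=.
  by apply: eq_bigr => k _; ring.
have /andP[h1 h2] := @ln_succ_bounds R N.+1 isT.
have p : 0 < N.+1%:R :> R by rewrite ltr0n.
have h0 : 0 <= N.+2%:R^-1 :> R by rewrite invr_ge0.
have c := psi_le (ltW p); have c0 := psi_ge0 (N.+1%:R : R).
have d0 : 0 <= ln N.+2%:R - ln N.+1%:R :> R by apply: le_trans h1.
rewrite addr_ge0 ?mulr_ge0 //=.
apply: (@le_trans _ _ (12 * N.+1%:R + 12 * N.+1%:R * N.+1%:R^-1)).
  by rewrite lerD // ler_pM.
by rewrite mulfK ?gt_eqF // -[X in _ <= 12 * X]natr1 mulrDr mulr1.
Qed.

(** Selberg's function Lambda_2, the convolution of mu with log^2; by [sum_selberg_weight] it is 2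
    log k on average. *)
Definition selberg_weight k : R :=
  mangoldt k * ln k%:R + \sum_(d <- divisors k) mangoldt d * mangoldt (k %/ d)%N.

Lemma sum_selberg_weight : exists2 K : R, 0 <= K & forall N, (0 < N)%N ->
  `|\sum_(1 <= k < N.+1) (selberg_weight k - 2 * ln k%:R)| <= K * N%:R.
Proof.
have [K K0 HK] := selberg_psi R; exists (K + 16); first by lra.
move=> N N0; have N1 : 1 <= N%:R :> R by rewrite ler1n.
have n0 : 0 <= N%:R :> R by rewrite ler0n.
have := HK _ N1; have := sum_mangoldt_ln_sub N0; have := lnfact_asymp N1.
rewrite summatory_nat.
have l0 : ln (N%:R : R) <= N%:R - 1 by have := @ln_sub_le R N%:R 1; rewrite ln1; lra.
rewrite sumrB /selberg_weight big_split /= -mulr_sumr.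
have -> : \sum_(1 <= k < N.+1) \sum_(d <- divisors k) mangoldt d * mangoldt (k %/ d)%N =
    summatory (fun n => mangoldt n * psi (N%:R / n%:R)) (N%:R : R).
  rewrite -(@summatory_nat R).
  have := @summatory_swap R mangoldt mangoldt (fun=> 1) N%:R n0.
  rewrite (@eq_summatory _ _ (fun n => mangoldt n * psi (N%:R / n%:R))); last first.
    move=> n _ _; congr (_ * _).
    by apply: eq_summatory => m _ _; rewrite mulr1.
  by move=> ->; apply: eq_summatory => k _ _; rewrite mulr1.
under [X in 0 <= X <= _]eq_bigr do rewrite mulrBr.
rewrite sumrB -mulr_suml.
have -> : \sum_(1 <= i < N.+1) mangoldt i = psi (N%:R : R) by rewrite /psi summatory_nat.
rewrite /selberg_op.
set L := \sum_(_ <= _ < _) ln _; set M := \sum_(_ <= _ < _) _; set T := summatory _ _.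
move=> s /andP[m1 m2]; move: s.
rewrite !ler_norml => /andP[s1 s2] /andP[t1 t2].
apply/andP; split; lra.
Qed.

Lemma abel_summation (b w : nat -> R) N :
  \sum_(1 <= k < N.+1) b k * w k =
  \sum_(1 <= k < N.+1) (\sum_(1 <= j < k.+1) b j) * (w k - w k.+1)
  + (\sum_(1 <= j < N.+1) b j) * w N.+1.
Proof.
elim: N => [|N IH]; first by rewrite !big_geq // mul0r addr0.
rewrite big_nat_recr //= IH [in RHS]big_nat_recr //= [X in _ + X * w N.+2]big_nat_recr //=.
rewrite [X in _ + X * (w N.+1 - _)]big_nat_recr //=; ring.
Qed.

(** Selberg's formula is used twice. Let E = [selberg_op psi_rem]; in ln x E(x) minus the sum of
    Lambda(m) E(x/m), the mixed terms ln x Lambda(m) R(x/m) cancel. The remaining weight is the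
    convolution square of Lambda minus Lambda log, in absolute value at most [selberg_weight]. *)
Lemma norm_psi_rem_ln2_le_weight : exists2 K : R, 0 <= K & forall x, 1 <= x ->
  `|psi_rem x| * ln x ^+ 2 <=
  summatory (fun k => selberg_weight k * `|psi_rem (x / k%:R)|) x + K * x * (1 + ln x).
Proof.
have [K K0 HK] := selberg_rem R; exists (15 * K); first by lra.
move=> x x1; have x0 : 0 < x by lra.
have l0 : 0 <= ln x by apply: ln_ge0.
pose E := selberg_op psi_rem.
have e : psi_rem x * ln x ^+ 2 = ln x * E x - summatory (fun m => mangoldt m * E (x / m%:R)) x
  + summatory (fun k => (\sum_(d <- divisors k) mangoldt d * mangoldt (k %/ d)%N - mangoldt k * ln k%:R)
    * psi_rem (x / k%:R)) x.
  have -> : summatory (fun m => mangoldt m * E (x / m%:R)) x =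
     summatory (fun m => mangoldt m * (psi_rem (x / m%:R) * (ln x - ln m%:R))) x +
     summatory (fun k => (\sum_(d <- divisors k) mangoldt d * mangoldt (k %/ d)%N) * psi_rem (x / k%:R)) x.
    rewrite -(@summatory_swap R mangoldt mangoldt psi_rem x (ltW x0)) -summatoryD.
    apply: eq_summatory => m m0 _; rewrite /E /selberg_op mulrDr; congr (_ + _).
    by rewrite ln_div ?posrE ?ltr0n.
  rewrite /E /selberg_op.
  have -> : summatory (fun m => mangoldt m * (psi_rem (x / m%:R) * (ln x - ln m%:R))) x =
     ln x * summatory (fun m => mangoldt m * psi_rem (x / m%:R)) x -
     summatory (fun m => mangoldt m * ln m%:R * psi_rem (x / m%:R)) x.
    rewrite -summatoryZ -summatoryB; apply: eq_summatory => m m0 _; ring.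
  have -> : summatory (fun k => (\sum_(d <- divisors k) mangoldt d * mangoldt (k %/ d)%N
        - mangoldt k * ln k%:R) * psi_rem (x / k%:R)) x =
     summatory (fun k => (\sum_(d <- divisors k) mangoldt d * mangoldt (k %/ d)%N)
        * psi_rem (x / k%:R)) x
     - summatory (fun m => mangoldt m * ln m%:R * psi_rem (x / m%:R)) x.
    rewrite -summatoryB; apply: eq_summatory => m m0 _; ring.
  ring.
have -> : `|psi_rem x| * ln x ^+ 2 = `|psi_rem x * ln x ^+ 2|.
  by rewrite normrM [X in _ = _ * X]ger0_norm // sqr_ge0.
rewrite e; apply: (le_trans (ler_normD _ _)); rewrite addrC lerD //.
  apply: (le_trans (normr_summatory _ _)); apply: ler_summatory => k k0 _.
  rewrite normrM ler_wpM2r // (le_trans (ler_normB _ _)) // addrC /selberg_weight.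
  have l1 : 0 <= ln (k%:R : R) by apply: ln_ge0; rewrite ler1n.
  rewrite lerD // ger0_norm // ?mulr_ge0 ?mangoldt_ge0 //.
  by apply: sumr_ge0 => d _; rewrite mulr_ge0 ?mangoldt_ge0.
apply: (le_trans (ler_normB _ _)).
have h1 : `|ln x * E x| <= ln x * (K * x).
  by rewrite normrM (ger0_norm l0) ler_wpM2l // HK.
have h2 : `|summatory (fun m => mangoldt m * E (x / m%:R)) x| <= K * x * (ln x + 14).
  apply: (le_trans (normr_summatory _ _)).
  apply: (@le_trans _ _ (summatory (fun m => K * x * (mangoldt m / m%:R)) x)).
    apply: ler_sum_nat => m /summatory_indexP[m0 mx m0' xm].
    rewrite normrM (ger0_norm (mangoldt_ge0 _ _)).
    have := ler_wpM2l (mangoldt_ge0 R m) (HK _ xm); move/le_trans; apply.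
    by rewrite [leRHS](_ : _ = mangoldt m * (K * (x / m%:R))) //; ring.
  rewrite summatoryZ ler_wpM2l ?mulr_ge0 ?(ltW x0) //.
  have := mertens x1; rewrite ler_norml => /andP[_ h]; lra.
apply: (le_trans (lerD h1 h2)).
have : 0 <= K * x by rewrite mulr_ge0 // ltW.
by nra.
Qed.

(** Abel summation replaces the weight by its average. |R(x/k)| is not monotone in k, but its
    increments are dominated by those of the decreasing [P k] = psi(x/k) + x/k, and the sum of k
    (P(k) - P(k + 1)) is at most that of P(k), which is O(x (1 + ln x)). *)
Lemma norm_psi_rem_ln2_le : exists2 K : R, 0 <= K & forall x, 1 <= x ->
  `|psi_rem x| * ln x ^+ 2 <=
  2 * summatory (fun k => ln k%:R * `|psi_rem (x / k%:R)|) x + K * x * (1 + ln x).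
Proof.
have [K1 K10 H1] := norm_psi_rem_ln2_le_weight; have [C C0 HC] := sum_selberg_weight.
exists (K1 + 25 * C); first by lra.
move=> x x1; have x0 : 0 < x by lra.
apply: (le_trans (H1 x x1)).
suff : summatory (fun k => (selberg_weight k - 2 * ln k%:R) * `|psi_rem (x / k%:R)|) x
   <= 25 * C * x * (1 + ln x).
  have -> : summatory (fun k => (selberg_weight k - 2 * ln k%:R) * `|psi_rem (x / k%:R)|) x =
    summatory (fun k => selberg_weight k * `|psi_rem (x / k%:R)|) x -
    2 * summatory (fun k => ln k%:R * `|psi_rem (x / k%:R)|) x.
    rewrite -summatoryZ -summatoryB; apply: eq_summatory => k _ _; ring.
  by lra.
have [N0 Nx xN _] := truncn_bounds x1.
rewrite /summatory; set N := Num.truncn x in N0 Nx xN *.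
have l0 : 0 <= ln x by apply: ln_ge0.
rewrite abel_summation; pose P k := psi (x / k%:R) + x / k%:R.
have P13 k : P k <= 13 * (x / k%:R).
  have : 0 <= x / k%:R by rewrite divr_ge0 // ltW.
  by move/psi_le; rewrite /P; lra.
have P0 k : 0 <= P k by rewrite addr_ge0 ?psi_ge0 // divr_ge0 // ltW.
have SP n : \sum_(1 <= k < n.+1) k%:R * (P k - P k.+1) =
    \sum_(1 <= k < n.+1) P k - n%:R * P n.+1.
  elim: n => [|n IH]; first by rewrite !big_geq // mul0r subr0.
  by rewrite big_nat_recr //= [X in _ = X - _]big_nat_recr //= IH -natr1; ring.
have h1 : \sum_(1 <= k < N.+1) (\sum_(1 <= j < k.+1) (selberg_weight j - 2 * ln j%:R)) *
   (`|psi_rem (x / k%:R)| - `|psi_rem (x / k.+1%:R)|) <= C * (13 * x * (1 + ln x)).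
  apply: (@le_trans _ _ (\sum_(1 <= k < N.+1) C * (k%:R * (P k - P k.+1)))).
    apply: ler_sum_nat => k /andP[k1 _].
    apply: (le_trans (ler_norm _)); rewrite normrM mulrA ler_pM ?HC //.
    apply: (le_trans (ler_dist_dist _ _)).
    apply: norm_psi_rem_sub_le.
    by rewrite ler_pM2l // lef_pV2 ?posrE ?ltr0n // ler_nat.
  rewrite -mulr_sumr ler_wpM2l // SP.
  apply: (@le_trans _ _ (\sum_(1 <= k < N.+1) P k)).
    by rewrite gerBl mulr_ge0.
  apply: (@le_trans _ _ (\sum_(1 <= k < N.+1) 13 * x * k%:R^-1)).
    by apply: ler_sum => k _; rewrite -mulrA.
  rewrite -mulr_sumr ler_wpM2l //; first by lra.
  apply: (le_trans (harmonic_le N0)); rewrite lerD2l ler_ln ?posrE ?ltr0n //.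
have h2 : (\sum_(1 <= j < N.+1) (selberg_weight j - 2 * ln j%:R)) * `|psi_rem (x / N.+1%:R)|
   <= C * (12 * x).
  apply: (le_trans (ler_norm _)); rewrite normrM normr_id.
  apply: (@le_trans _ _ (C * N%:R * (12 * (x / N.+1%:R)))).
    by rewrite ler_pM // ?HC // norm_psi_rem_le // divr_ge0 // ltW.
  rewrite -!mulrA ler_wpM2l // mulrCA ler_wpM2l // mulrCA -[leRHS]mulr1 ler_wpM2l ?(ltW x0) //.
  by rewrite ler_pdivrMr ?ltr0n // mul1r ler_nat.
apply: (le_trans (lerD h1 h2)); have : 0 <= C * x * ln x by rewrite !mulr_ge0 // ltW.
have : 0 <= C * x by rewrite mulr_ge0 // ltW.
by nra.
Qed.

End SelbergIteration.

(** * The prime number theorem *)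

Section PsiRemainder.
Variable R : realType.
Implicit Types (x y z t : R).
Local Notation mangoldt := (mangoldt R).
Local Notation rem := (@psi_rem R).

Lemma psi_short_interval : exists2 K : R, 0 <= K & forall z t, 1 <= z -> z <= t ->
  (psi t - psi z) * ln t <= 2 * (t - z) * ln t + K * t.
Proof.
have [K K0 HK] := selberg_psi R; exists (2 * K + 2); first by lra.
move=> z t z1 zt; have t1 : 1 <= t by lra.
have := HK _ z1; have := HK _ t1; rewrite /selberg_op.
have : summatory (fun n => mangoldt n * psi (z / n%:R)) z <=
       summatory (fun n => mangoldt n * psi (t / n%:R)) t.
  apply: (@le_trans _ _ (summatory (fun n => mangoldt n * psi (t / n%:R)) z)).
    apply: ler_summatory => n n0 _; rewrite ler_wpM2l ?mangoldt_ge0 // psi_mono //.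
    by rewrite ler_pM2r // invr_gt0 ltr0n.
  by apply: summatory_mono => // n _; rewrite mulr_ge0 ?mangoldt_ge0 ?psi_ge0.
set S := summatory _ _; set T := summatory _ _ => ST.
rewrite !ler_norml => /andP[a1 a2] /andP[b1 b2].
have z0 : 0 < z by lra.
have t0 : 0 < t by lra.
have lz : 0 <= ln t - ln z by rewrite subr_ge0 ler_ln.
have h1 : z * (ln t - ln z) <= t - z.
  by rewrite mulrC -ler_pdivlMr //; exact: ln_sub_le.
have h2 : 0 <= psi z * (ln t - ln z) by rewrite mulr_ge0 ?psi_ge0.
have h3 : K * z <= K * t by rewrite ler_wpM2l.
nra.
Qed.

(** Summation by parts gives Mertens' sum minus the harmonic sum, up to bounded terms; both are ln N
    + O(1). *)
Lemma sum_psi_rem_bounded : exists2 A : R, 0 <= A & forall N,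
  `|\sum_(1 <= n < N.+1) rem n%:R / (n%:R * n.+1%:R)| <= A.
Proof.
exists 30 => // N; case: N => [|N]; first by rewrite big_geq // normr0.
have E M : \sum_(1 <= n < M.+1) rem n%:R / (n%:R * n.+1%:R) =
   \sum_(1 <= n < M.+1) mangoldt n / n%:R - psi M%:R / M.+1%:R
   - (\sum_(1 <= n < M.+2) n%:R^-1 - 1).
  elim: M => [|M IH].
    by rewrite big_nat1 invr1 subrr /psi summatory_nat !big_geq // mul0r !subr0.
  rewrite [LHS]big_nat_recr //= IH [in RHS]big_nat_recr //= [X in _ = _ - (X - 1)]big_nat_recr //=.
  rewrite psi_natS /psi_rem psi_natS.
  set S := \sum_(_ <= _ < _) _; set T := \sum_(_ <= _ < _) _.
  have e1 : M.+2%:R = M.+1%:R + 1 :> R by rewrite natr1.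
  have p : 0 < M.+1%:R :> R by rewrite ltr0n.
  rewrite e1; field.
  by apply/andP; split; apply: lt0r_neq0; lra.
rewrite E.
have N1 : 1 <= N.+1%:R :> R by rewrite ler1n.
have := mertens N1; rewrite summatory_nat.
have l0 : 0 <= ln (N.+1%:R : R) by apply: ln_ge0.
have h1 : 0 <= psi (N.+1%:R : R) / N.+2%:R <= 12.
  rewrite divr_ge0 ?psi_ge0 //= ler_pdivrMr ?ltr0n //.
  have := psi_le (ler0n R N.+1); move/le_trans; apply.
  by rewrite ler_pM2l // ler_nat.
have h2 := @harmonic_le R N.+2 isT.
have /andP[_ h3] := @ln_succ_bounds R N.+1 isT.
have h4 : N.+1%:R^-1 <= 1 :> R by rewrite invf_le1 ?ltr0n.
have h5 : ln (N.+1%:R : R) <= \sum_(1 <= n < N.+3) n%:R^-1.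
  have aux M : ln (M.+1%:R : R) <= \sum_(1 <= n < M.+1) n%:R^-1.
    elim: M => [|M IH]; first by rewrite big_geq // ln1.
    rewrite big_nat_recr //=.
    have /andP[_ h] := @ln_succ_bounds R M.+1 isT.
    by rewrite -lerBlDl (le_trans _ h) // lerD2l lerN2.
  apply: (le_trans (aux N)); rewrite [leRHS](@big_cat_nat _ _ _ N.+1) //=; last by lia.
  by rewrite lerDl sumr_ge0 // => i _; rewrite invr_ge0.
move: h1 => /andP[h1 h1']; rewrite !ler_norml => /andP[m1 m2].
move: h2 h3 h4 h5 h1 h1' m1 m2.
set s := \sum_(1 <= n < N.+3) _; set S := \sum_(_ <= _ < _) _; set a := ln _.
set b := ln _; set c := psi _ / _; set d := _^-1.
by move=> *; apply/andP; split; lra.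
Qed.

Lemma sum_inv_ge M N : (M <= N)%N ->
  ln N.+2%:R - ln M.+1%:R <= \sum_(M <= n < N.+1) n.+1%:R^-1 :> R.
Proof.
move=> MN; rewrite -(@telescope_sumr R M N.+1 (fun k => ln k.+1%:R)); last exact: leqW.
by apply: ler_sum => n _; have /andP[] := @ln_succ_bounds R n.+1 isT.
Qed.

Lemma ln_le_mul_eps (e y : R) : 0 < e -> 0 < y -> 4 / e ^+ 2 <= y -> ln y <= e * y.
Proof.
move=> e0 y0; rewrite ler_pdivrMr ?exprn_gt0 // => h.
pose s := Num.sqrt y; have s0 : 0 < s by rewrite sqrtr_gt0.
have sy : y = s ^+ 2 by rewrite sqr_sqrtr // ltW.
have : ln s <= s - 1 by have := ln_sub_le s0 (@ltr01 R); rewrite ln1 subr0 divr1.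
rewrite sy lnXn // => h1.
have es : 2 <= e * s.
  rewrite -(@ler_pXn2r _ 2) ?nnegrE ?mulr_ge0 ?(ltW e0) ?(ltW s0) //.
  by rewrite exprMn -sy; lra.
rewrite mulr2n; nra.
Qed.

(** If |R(n)| > b n at every integer n of [y, L y], then R keeps its sign there, because its jumps
    are too small to cross the gap. The sum of R(n) / (n (n + 1)) over the interval is then at least
    b ln(L/2) in absolute value, whereas two partial sums differ by at most 2 A. *)
Lemma psi_rem_small_somewhere (b : R) : 0 < b ->
  exists2 L : R, 2 <= L & exists y0 : R, forall y, y0 <= y ->
  exists2 z : R, y <= z <= L * y & `|rem z| <= b * z.
Proof.
move=> b0; have [A A0 HA] := sum_psi_rem_bounded.
(* Chosen so that b ln(L/2) = 2 A + 1 exceeds 2 A. *)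
pose L := 2 * expR ((2 * A + 1) / b).
have ge1 : 1 <= expR ((2 * A + 1) / b) by apply: (le_trans _ (expR_ge1Dx _)); rewrite lerDl divr_ge0; lra.
have L2 : 2 <= L by rewrite /L; lra.
(* The three terms serve y + 2 <= 2 y, 1 <= b n and ln n <= b n respectively. *)
exists L => //; exists (2 + b^-1 + 4 / b ^+ 2) => y yy0.
have ib : 0 < b^-1 by rewrite invr_gt0.
have ib2 : 0 <= 4 / b ^+ 2 by rewrite divr_ge0 // sqr_ge0.
have y0 : 0 < y by lra.
apply: contrapT => noz.
have {}noz n : y <= n%:R -> n%:R <= L * y -> b * n%:R < `|rem n%:R|.
  move=> h1 h2; rewrite ltNge; apply/negP => h3; apply: noz.
  by exists n%:R => //; rewrite h1.
pose N1 := (Num.truncn y).+1; pose N2 := Num.truncn (L * y).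
have Ly0 : 0 <= L * y by rewrite mulr_ge0; lra.
have N1y : y <= N1%:R by apply: ltW; rewrite truncnS_gt.
have N1y1 : N1%:R <= y + 1 by rewrite -natr1 lerD2r truncn_le ltW.
have N2L : N2%:R <= L * y by rewrite truncn_le.
have N2L1 : L * y < N2.+1%:R by rewrite truncnS_gt.
have N12 : (N1 <= N2)%N.
  rewrite truncn_ge_nat //; nra.
have hU : `|\sum_(1 <= n < N1) rem n%:R / (n%:R * n.+1%:R)| <= A by exact: HA.
have N10 : (0 < N1)%N by [].
clearbody N1 N2.
have step n : y <= n%:R -> rem n.+1%:R = rem n%:R + mangoldt n.+1 - 1 /\
    (mangoldt n.+1 <= b * n.+1%:R) /\ 1 <= b * n%:R.
  move=> yn; split; first by rewrite /psi_rem psi_natS -natr1; ring.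
  split.
    apply: (le_trans (mangoldt_le_ln R (ltn0Sn n))); apply: ln_le_mul_eps => //.
    by rewrite -natr1; lra.
  by rewrite -ler_pdivrMl // mulr1; lra.
(* [s] is the sign of R at the first integer [N1]; the induction carries it to [N2]. *)
have key (s : R) : s * s = 1 -> b * N1%:R < s * rem N1%:R ->
   forall m, (N1 + m <= N2)%N -> b * (N1 + m)%:R < s * rem (N1 + m)%:R.
  move=> ss h; elim=> [|m IH] hm; first by rewrite addn0.
  have yn : y <= (N1 + m)%:R by apply: (le_trans N1y); rewrite ler_nat leq_addr.
  have [e1 [e2 e3]] := step _ yn.
  have := IH (leq_trans (leq_add (leqnn _) (leqnSn m)) hm).
  have : b * (N1 + m.+1)%:R < `|rem (N1 + m.+1)%:R|.
    apply: noz; first by apply: (le_trans N1y); rewrite ler_nat leq_addr.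
    by apply: le_trans N2L; rewrite ler_nat.
  rewrite addnS e1; set r := rem _; set w := mangoldt _ in e1 e2 *.
  have w0 : 0 <= w := mangoldt_ge0 _ _.
  have : s = 1 \/ s = -1.
    have : (s - 1) * (s + 1) = 0 by rewrite mulrBl mulrDr ss; ring.
    by move/eqP; rewrite mulf_eq0 subr_eq0 addr_eq0 => /orP[] /eqP; [left|right].
  rewrite -natr1 in e2 *.
  by case=> ->; rewrite ?mul1r ?mulN1r; case: (ger0P (r + w - 1)); lra.
have main (s : R) : s * s = 1 -> b * N1%:R < s * rem N1%:R -> False.
  move=> ss h; have sgn := key s ss h.
  have := HA N2; rewrite (@big_cat_nat _ _ _ N1 1 N2.+1) //=; last by apply: leq_trans N12 _.
  move: hU.
  set U := \sum_(_ <= _ < _) _; set V := \sum_(_ <= _ < _) _.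
  have s1 : `|s| = 1.
    by apply/eqP; rewrite -(@pexpr_eq1 _ _ 2) // expr2 -normrM ss normr1.
  move=> {}hU hUV; have : `|V| <= 2 * A.
    have -> : V = (U + V) - U by ring.
    by apply: (le_trans (ler_normB _ _)); lra.
  have : s * V <= `|V| by apply: (le_trans (ler_norm _)); rewrite normrM s1 mul1r.
  suff : 2 * A + 1 <= s * V by lra.
  have h1 : 2 * A + 1 <= b * (ln N2.+2%:R - ln N1.+1%:R).
    rewrite [leRHS]mulrC -ler_pdivrMr // -[leLHS]expRK.
    rewrite -ln_div ?posrE ?ltr0n // ler_ln ?posrE ?expR_gt0 ?divr_gt0 ?ltr0n //.
    rewrite ler_pdivlMr ?ltr0n // -[N1.+1%:R]natr1.
    have -> : expR ((2 * A + 1) / b) = L / 2 by rewrite /L [2 * expR _]mulrC mulfK.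
    have g1 : L / 2 * (N1%:R + 1) <= L / 2 * (y + 2) by rewrite ler_wpM2l; lra.
    have g2 : L / 2 * (y + 2) <= L / 2 * (2 * y).
      by rewrite ler_wpM2l; lra.
    apply: (le_trans g1); apply: (le_trans g2).
    have -> : L / 2 * (2 * y) = L * y by field.
    by apply: ltW; apply: (lt_le_trans N2L1); rewrite ler_nat.
  apply: (le_trans h1); apply: (le_trans (ler_wpM2l (ltW b0) (sum_inv_ge N12))).
  rewrite /V mulr_sumr [leRHS]mulr_sumr; apply: ler_sum_nat => n /andP[n1 n2].
  have n0 : (0 < n)%N by apply: leq_trans n1.
  have := sgn (n - N1)%N; rewrite subnKC // => /(_ n2) h3.
  have p : 0 < n%:R :> R by rewrite ltr0n.
  have q : 0 < n.+1%:R :> R by rewrite ltr0n.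
  rewrite mulrA ler_pdivlMr ?mulr_gt0 // mulrCA -mulrA mulVf ?mulr1 ?gt_eqF //.
  by rewrite mulrC ltW.
have := noz N1 N1y; case: (ger0P (rem N1%:R)) => r0 /(_ _) h.
- apply: (main 1); rewrite ?mulr1 // mul1r; apply: h.
  by apply: le_trans N2L; rewrite ler_nat.
- apply: (main (-1)); rewrite ?mulrNN ?mulr1 // mulN1r; apply: h.
  by apply: le_trans N2L; rewrite ler_nat.
Qed.

End PsiRemainder.

(** * Intervals on which the remainder is small *)

Section SmallIntervals.
Variable R : realType.
Implicit Types (x y z t : R).
Local Notation rem := (@psi_rem R).

(** A single z with |R(z)| <= (a/4) z spreads to an interval of fixed ratio: R falls by at most t -
    z because psi is monotone, and rises by at most (t - z) + (a/4) t by the short interval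
    bound. *)
Lemma psi_rem_small_interval (a : R) : 0 < a ->
  exists2 L : R, 2 <= L & exists2 y0 : R, 1 <= y0 & forall y, y0 <= y ->
  exists2 z : R, y <= z <= L * y &
    forall t, z <= t <= (1 + a / 4) * z -> `|rem t| <= a * t.
Proof.
move=> a0; have a4 : 0 < a / 4 by lra.
have [L L2 [y1 Hy]] := psi_rem_small_somewhere a4.
have [K K0 HK] := psi_short_interval R.
exists L => //; exists (`|y1| + expR (4 * K / a) + 1).
  by have := normr_ge0 y1; have := expR_gt0 (4 * K / a); lra.
move=> y yy; have ny := normr_ge0 y1; have ne := expR_gt0 (4 * K / a).
have [|z /andP[z1 z2] Hz] := Hy y; first by have := ler_norm y1; lra.
exists z; first by rewrite z1.
move=> t /andP[t1 t2].
have z1' : 1 <= z by lra.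
have te : expR (4 * K / a) < t by lra.
have lt : 4 * K / a < ln t by rewrite -ltr_expR lnK // posrE; lra.
have l0 : 0 < ln t by apply: ln_gt0; lra.
have KL : K <= a / 4 * ln t.
  by move: lt; rewrite ltr_pdivrMr //; lra.
have h1 : psi t - psi z <= 2 * (t - z) + a / 4 * t.
  rewrite -(ler_pM2r l0); apply: (le_trans (HK z t z1' t1)).
  have : K * t <= a / 4 * ln t * t by rewrite ler_wpM2r //; lra.
  by lra.
have h2 := psi_mono t1.
move: Hz; rewrite /psi_rem !ler_norml => /andP[z3 z4].
have h3 : a * z <= a * t by rewrite ler_wpM2l // ltW.
have h4 : t - z <= a / 4 * z by lra.
by apply/andP; split; lra.
Qed.

Lemma sum_nat_ge0 (G : nat -> R) m n : (forall k, (m <= k)%N -> 0 <= G k) ->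
  0 <= \sum_(m <= k < n) G k.
Proof.
by move=> h; rewrite big_nat_cond sumr_ge0 // => k /andP[/andP[k1 _] _]; exact: h.
Qed.

Lemma sum_ge_interval (G : nat -> R) (u v : R) M1 M2 :
  (forall n, 0 <= G n) -> 0 <= v -> v <= u -> 0 < u ->
  (forall n, v < n%:R <= u -> u^-1 <= G n) ->
  (M1 <= Num.truncn v)%N -> (Num.truncn u <= M2)%N ->
  (u - 1 - v) / u <= \sum_(M1.+1 <= n < M2.+1) G n.
Proof.
move=> G0 v0 vu u0 H h1 h2; have h := le_truncn vu.
have s0 m n : 0 <= \sum_(m <= i < n) G i by apply: sumr_ge0.
rewrite (@big_cat_nat _ _ _ (Num.truncn v).+1) //=; last by lia.
rewrite (@big_cat_nat _ _ _ (Num.truncn u).+1 (Num.truncn v).+1) //=.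
apply: (@le_trans _ _ (\sum_((Num.truncn v).+1 <= i < (Num.truncn u).+1) G i)); last first.
  by have := s0 M1.+1 (Num.truncn v).+1; have := s0 (Num.truncn u).+1 M2.+1; lra.
apply: (@le_trans _ _ (\sum_((Num.truncn v).+1 <= i < (Num.truncn u).+1) u^-1)).
  rewrite sumr_const_nat subSS -mulr_natl ler_wpM2r ?invr_ge0 ?(ltW u0) //.
  rewrite natrB //; have /andP[v1 v2] := truncn_itv v0.
  have /andP[u1] := truncn_itv (ltW u0); rewrite -natr1; lra.
apply: ler_sum_nat => n /andP[n1 n2]; apply: H.
by rewrite -truncn_lt_nat // n1 -truncn_ge_nat // ltW.
Qed.

(** Among the n with x/n in a block [y, L' y], those with x/n in the good interval of the block
    contribute at least d/4 to the sum of 1/n. The blocks used stay below sqrt x, so that n > sqrt x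
    and ln n >= (ln x) / 2 there. *)
Lemma psi_rem_small_density (a : R) : 0 < a -> a <= 1 ->
  exists2 k : R, 0 < k & exists X0 : R, forall x, X0 <= x ->
  k * ln x ^+ 2 <= summatory (fun n =>
     if `|rem (x / n%:R)| <= a * (x / n%:R) then ln n%:R / n%:R else 0) x.
Proof.
move=> a0 a1; have [L L2 [y0 y01 Hy]] := psi_rem_small_interval a0.
set d := a / 4 in Hy; have d0 : 0 < d by rewrite /d; lra.
have d1 : d <= 1 by rewrite /d; lra.
(* The factor 2 keeps the good interval inside its block: it reaches up to (1 + d) z <= 2 L y. *)
clearbody d; pose L' := 2 * L; have L'0 : 0 < L' by rewrite /L'; lra.
have lL : 0 < ln L' by apply: ln_gt0; rewrite /L'; lra.
have ly0 : 0 <= ln y0 by apply: ln_ge0.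
have y00 : 0 < y0 by lra.
(* At least ln x / (4 ln L') blocks, each giving d/4, with ln n >= (ln x) / 2. *)
exists (d / (32 * ln L')); first by rewrite divr_gt0 // mulr_gt0.
exists (expR (4 * ln y0 + 4 * ln L') + (4 / d) ^+ 2 + 1) => x xX.
have ex := expR_gt0 (4 * ln y0 + 4 * ln L').
have sd : 0 <= (4 / d) ^+ 2 by apply: sqr_ge0.
have x0 : 0 < x by lra.
have x1 : 1 <= x by lra.
have lx : 4 * ln y0 + 4 * ln L' <= ln x by rewrite -ler_expR lnK ?posrE //; lra.
pose s := Num.sqrt x; have s0 : 0 < s by rewrite sqrtr_gt0.
have ss : s * s = x by rewrite -expr2 sqr_sqrtr // ltW.
have s4 : 4 / d <= s.
  have d4 : 0 <= 4 / d by apply: divr_ge0 => //; exact: ltW.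
  rewrite -(@ler_pXn2r _ 2) ?nnegrE ?(ltW s0) //.
  by rewrite [s ^+ 2]expr2 ss; lra.
have ls : ln x = 2 * ln s by rewrite -ss lnM ?posrE //; ring.
pose G n : R := if `|rem (x / n%:R)| <= a * (x / n%:R) then n%:R^-1 else 0.
have G0 n : 0 <= G n by rewrite /G; case: ifP => // _; rewrite invr_ge0.
have blocks J : y0 * L' ^+ J <= s ->
  J%:R * (d / 4) <= \sum_((Num.truncn (x / (y0 * L' ^+ J))).+1 <= n < (Num.truncn (x / y0)).+1) G n.
  elim: J => [|J IH]; first by rewrite mul0r sumr_ge0.
  rewrite exprS mulrCA => yJ; set y := y0 * L' ^+ J in IH yJ *.
  have Ly1 : 1 <= L' ^+ J by rewrite exprn_ege1 // /L'; lra.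
  have yy : y0 <= y by rewrite /y ler_peMr // ltW.
  have yLy : y <= L' * y by rewrite ler_peMl //; [lra|rewrite /L'; lra].
  have [z /andP[z1 z2] Hz] := Hy y yy.
  have z0 : 0 < z by lra.
  have yp : 0 < y by lra.
  have Lyp : 0 < L' * y by rewrite mulr_gt0.
  have zs : z <= s.
    apply: (le_trans z2); apply: le_trans yJ; rewrite ler_wpM2r ?(ltW yp) // /L'; lra.
  have us : s <= x / z by rewrite ler_pdivlMr // -ss ler_wpM2l // ltW.
  have u0 : 0 < x / z by rewrite divr_gt0.
  have dz0 : 0 < (1 + d) * z by rewrite mulr_gt0 //; lra.
  rewrite (@big_cat_nat _ _ _ (Num.truncn (x / y)).+1) /=; first last.
  - by rewrite ltnS; apply: le_truncn; rewrite ler_pM2l // lef_pV2.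
  - by rewrite ltnS; apply: le_truncn; rewrite ler_pM2l // lef_pV2.
  rewrite -natr1 mulrDl mul1r addrC lerD //; first by apply: IH; apply: le_trans yJ.
  apply: (@le_trans _ _ ((x / z - 1 - x / ((1 + d) * z)) / (x / z))).
    have -> : (x / z - 1 - x / ((1 + d) * z)) / (x / z) = d / (1 + d) - (x / z)^-1.
      by field; rewrite ?gt_eqF //; lra.
    have h1 : (x / z)^-1 <= d / 4.
      by rewrite -[d / 4]invrK lef_pV2 ?posrE ?invr_gt0 ?divr_gt0 // invf_div (le_trans s4).
    have h2 : d / 2 <= d / (1 + d).
      by rewrite ler_pM2l // lef_pV2 ?posrE; lra.
    lra.
  apply: sum_ge_interval => //.
  - by rewrite divr_ge0 // ltW.
  - rewrite ler_pM2l // lef_pV2 ?posrE // ler_peMl ?(ltW z0) //; lra.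
  - move=> n /andP[]; rewrite ltr_pdivrMr // ler_pdivlMr // => n1 n2.
    have n0 : 0 < n%:R :> R.
      rewrite lt0r ler0n andbT; apply: contraTneq n1 => ->; rewrite mul0r -leNgt; lra.
    rewrite /G ifT; first by rewrite lef_pV2 ?posrE // ler_pdivlMr.
    apply: Hz; rewrite ler_pdivlMr // ler_pdivrMr //.
    rewrite mulrC n2 /= mulrC ltW //.
  - apply: le_truncn; rewrite ler_pM2l // lef_pV2 ?posrE //.
    apply: (@le_trans _ _ (2 * (L * y))); last by rewrite /L'; lra.
    by rewrite ler_pM //; lra.
  - by apply: le_truncn; rewrite ler_pM2l // lef_pV2.
pose J := Num.truncn ((ln x / 2 - ln y0) / ln L').
have /andP[J1 J2] : J%:R <= (ln x / 2 - ln y0) / ln L' < J.+1%:R.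
  by apply: truncn_itv; rewrite divr_ge0 //; lra.
clearbody J.
have Js : y0 * L' ^+ J <= s.
  rewrite -ler_ln ?posrE ?mulr_gt0 ?exprn_gt0 // lnM ?posrE ?exprn_gt0 // lnXn //.
  by move: J1; rewrite ler_pdivlMr // -mulr_natl ls; lra.
have J3 : ln x / (4 * ln L') <= J%:R.
  move: J2; rewrite ltr_pdivrMr // -[J.+1%:R]natr1 [(J%:R + 1) * _]mulrDl mul1r => J2.
  have l40 : 0 < 4 * ln L' by lra.
  rewrite ler_pdivrMr // (_ : J%:R * (4 * ln L') = 4 * (J%:R * ln L')); last by ring.
  by move: (J%:R * ln L') J2 => q J2; lra.
have hb := blocks J Js.
have yJ0 : 0 < y0 * L' ^+ J by rewrite mulr_gt0 // exprn_gt0.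
apply: (@le_trans _ _ (ln x / 2 * \sum_((Num.truncn (x / (y0 * L' ^+ J))).+1 <= n < (Num.truncn (x / y0)).+1) G n)).
  apply: (@le_trans _ _ (ln x / 2 * (J%:R * (d / 4)))); last first.
    by rewrite ler_wpM2l //; lra.
  have h : ln x / (4 * ln L') * (d / 4) <= J%:R * (d / 4) by rewrite ler_wpM2r //; lra.
  apply: (@le_trans _ _ (ln x / 2 * (ln x / (4 * ln L') * (d / 4)))); last first.
    by rewrite ler_wpM2l //; lra.
  by rewrite le_eqVlt; apply/orP; left; apply/eqP; field; rewrite gt_eqF.
rewrite mulr_sumr /summatory.
have g0 n : (0 < n)%N -> 0 <= if `|rem (x / n%:R)| <= a * (x / n%:R) then ln n%:R / n%:R else 0.
  by move=> n0; case: ifP => // _; rewrite divr_ge0 // ln_ge0 // ler1n.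
have t1 : (Num.truncn (x / (y0 * L' ^+ J)) <= Num.truncn (x / y0))%N.
  apply: le_truncn; rewrite ler_pM2l // lef_pV2 ?posrE // ler_peMr ?(ltW y00) //.
  by rewrite exprn_ege1 // /L'; lra.
have t2 : (Num.truncn (x / y0) <= Num.truncn x)%N.
  by apply: le_truncn; rewrite ler_pdivrMr // ler_peMr // ltW.
rewrite [leRHS](@big_cat_nat _ _ _ (Num.truncn (x / (y0 * L' ^+ J))).+1) //=; last first.
  by rewrite ltnS; apply: leq_trans t2.
rewrite [X in _ <= _ + X](@big_cat_nat _ _ _ (Num.truncn (x / y0)).+1) //=.
rewrite addrCA -[leLHS]addr0; apply: lerD; last first.
  apply: addr_ge0; apply: sum_nat_ge0 => n hn; apply: g0 => //.
  by apply: leq_trans hn.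
apply: ler_sum_nat => n /andP[n1 n2].
have n0 : (0 < n)%N by apply: leq_trans n1.
have n0' : 0 < n%:R :> R by rewrite ltr0n.
rewrite /G; case: ifP => _; last by rewrite mulr0.
rewrite ler_pM2r ?invr_gt0 //.
have -> : ln x / 2 = ln s by rewrite ls; lra.
rewrite ler_ln ?posrE //.
have : x / (y0 * L' ^+ J) < n%:R by rewrite -truncn_lt_nat // divr_ge0 // ltW.
rewrite ltr_pdivrMr // => h.
have h2 : n%:R * (y0 * L' ^+ J) <= n%:R * s by rewrite ler_wpM2l.
rewrite -(ler_pM2r s0); lra.
Qed.

End SmallIntervals.

Section PsiAsymptotics.
Variable R : realType.
Implicit Types (x y z t : R).
Local Notation rem := (@psi_rem R).

(* If alpha is the limsup of |R(t)| / t, the positive proportion of n at which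
   |R(x/n)| <= (alpha / 2) x/n makes the Selberg inequality beat alpha. *)
Theorem psi_asymp (a : R) : 0 < a -> exists T : R, forall t, T <= t -> `|psi t - t| <= a * t.
Proof.
pose P (a : R) := exists T : R, forall t, T <= t -> `|rem t| <= a * t.
pose E := [set a : R | 0 <= a /\ P a]%classic.
have E12 : E 12.
  by split => //; exists 0 => t; exact: norm_psi_rem_le.
have hE : has_inf E.
  by split; [exists 12 | exists 0 => y []].
pose al := inf E.
have al0 : 0 <= al by apply: lb_le_inf; [case: hE | move=> y []].
suff alz : al = 0.
  move=> a0; have [b [b0 [T HT]] ba] := @inf_adherent R E a a0 hE.
  rewrite -/al alz add0r in ba; exists (`|T|) => t tT.
  apply: (le_trans (HT t (le_trans (ler_norm _) tT))).
  by rewrite ler_wpM2r ?(le_trans _ tT) // ltW.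
apply: contrapT => /eqP an0.
have {al0 an0} al0 : 0 < al by rewrite lt0r an0.
have al12 : al <= 12 by apply: ge_inf => //; case: hE.
(* As [al] <= 12, the level al / 24 is at most 1, as required, and it lies below any [b] >= [al] by
   at least al / 2. *)
have [k k0 [X0 HX]] := @psi_rem_small_density R (al / 24) ltac:(lra) ltac:(lra).
have [K K0 HK] := norm_psi_rem_ln2_le R.
(* The good n save 2 (b - al/24) k >= al k = 4 e, while b < al + e and the lower order terms cost at
   most another e. The total, al - 2 e, is below al - e, so [al] was not the infimum. *)
pose e := al * k / 4; have e0 : 0 < e by rewrite /e; nra.
have [b [b0 [T HT]] ba] := @inf_adherent R E e e0 hE; rewrite -/al in ba.
have alb : al <= b by apply: ge_inf; [case: hE | split=> //; exists T].
pose T1 := `|T| + 1.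
have T10 : 1 <= T1 by rewrite /T1 lerDr.
pose M := 2 * b + 24 * T1 + 2 * K.
have M0 : 0 < M by rewrite /M; lra.
suff HP : forall t, `|X0| + expR (1 + M / e) <= t -> `|rem t| <= (al - e) * t.
  suff /(ge_inf (proj2 hE)) : E (al - e) by rewrite -/al; lra.
  split; last by exists (`|X0| + expR (1 + M / e)).
  have p : 0 < `|X0| + expR (1 + M / e) by rewrite ltr_wpDl // expR_gt0.
  by rewrite -(pmulr_lge0 _ p) (le_trans _ (HP _ (lexx _))).
move=> x xX; have ex := expR_gt0 (1 + M / e); have nX := normr_ge0 X0.
have x0 : 0 < x by lra.
have lx : 1 + M / e <= ln x by rewrite -ler_expR lnK ?posrE //; lra.
have Me : 0 < M / e by rewrite divr_gt0.
have l1 : 1 <= ln x by lra.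
have x1 : 1 <= x.
  by rewrite leNgt; apply/negP => /ltW /ln_le0; lra.
have lM : M <= e * ln x by rewrite mulrC -ler_pdivrMr //; lra.
have xX0 : X0 <= x by have := ler_norm X0; lra.
have h1 := HK x x1; have h2 := HX x xX0.
have [N0 Nx xN N1] := truncn_bounds x1.
have Nx' : ln (Num.truncn x)%:R <= ln x by rewrite ler_ln ?posrE ?ltr0n.
set G := (fun n => if _ then _ else _) in h2.
have h3 : summatory (fun n => ln n%:R * `|rem (x / n%:R)|) x <=
    summatory (fun n => x * (b * (ln n%:R / n%:R) - (b - al / 24) * G n) + 12 * T1 * ln x) x.
  apply: ler_sum_nat => n /summatory_indexP[n0 nx n0' xn1].
  have ln0 : 0 <= ln (n%:R : R) by apply: ln_ge0; rewrite ler1n.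
  have lnx : ln n%:R <= ln x by rewrite ler_ln ?posrE.
  have q0 : 0 <= ln (n%:R : R) / n%:R by rewrite divr_ge0 // ltW.
  have xl : x * (ln n%:R / n%:R) = ln n%:R * (x / n%:R) by ring.
  have TL : 0 <= 12 * T1 * ln x by rewrite !mulr_ge0 //; lra.
  have [tT|tT] := leP T1 (x / n%:R); last first.
    apply: (@le_trans _ _ (0 + 12 * T1 * ln x)).
      rewrite add0r mulrC ler_pM //.
      by have := @norm_psi_rem_le R (x / n%:R); lra.
    rewrite lerD2r mulr_ge0 ?(ltW x0) //.
    apply: (@le_trans _ _ (b * (ln n%:R / n%:R) - (b - al / 24) * (ln n%:R / n%:R))).
      rewrite -mulrBl mulr_ge0 //; lra.
    rewrite lerD2l lerN2 ler_wpM2l //; first by lra.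
    by rewrite /G; case: ifP.
  apply: (@le_trans _ _ (x * (b * (ln n%:R / n%:R) - (b - al / 24) * G n))); last first.
    by rewrite lerDl.
  have hb := HT (x / n%:R).
  rewrite /G; case: ifP => hg.
    have -> : x * (b * (ln n%:R / n%:R) - (b - al / 24) * (ln n%:R / n%:R)) =
       ln n%:R * (al / 24 * (x / n%:R)) by ring.
    by rewrite ler_wpM2l.
  have -> : x * (b * (ln n%:R / n%:R) - (b - al / 24) * 0) = ln n%:R * (b * (x / n%:R)) by ring.
  rewrite ler_wpM2l //; apply: hb; apply: le_trans tT; rewrite /T1.
  by have := ler_norm T; lra.
have h4 : summatory (fun n => x * (b * (ln n%:R / n%:R) - (b - al / 24) * G n) + 12 * T1 * ln x) x
   <= x * (b * (ln x ^+ 2 / 2 + 1) - (b - al / 24) * (k * ln x ^+ 2)) + 12 * T1 * ln x * x.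
  rewrite summatoryD summatoryZ summatoryB !summatoryZ lerD //.
    rewrite ler_wpM2l ?(ltW x0) // lerB //.
      rewrite ler_wpM2l // (le_trans (sum_ln_over_le R N0)) // lerD2r ler_pM2r //.
      by rewrite ler_pXn2r ?nnegrE ?ln_ge0 //; lra.
    by rewrite ler_wpM2l //; lra.
  rewrite /summatory sumr_const_nat subSS subn0 -[ln x *+ _]mulr_natr mulrA ler_wpM2l //.
  by rewrite !mulr_ge0 //; lra.
clear h2; have {h3 h4} := le_trans h3 h4 => h34.
rewrite -(@ler_pM2r _ (ln x ^+ 2)) ?exprn_gt0 //; last by lra.
move: h1 h34; set S := summatory _ _; set l := ln x in l1 lM *; set r := `|rem x|.
move=> h1 h2; apply: (le_trans h1).
have h5 : 24 * T1 * l + 2 * b + K * (1 + l) <= M * l.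
  have := ler_wpM2l b0 l1; have := ler_wpM2l K0 l1; rewrite /M; lra.
have h6 : M * l <= e * l ^+ 2 by rewrite expr2 mulrA ler_wpM2r //; lra.
have h7 : 4 * e <= 2 * ((b - al / 24) * k).
  have : al / 2 * k <= (b - al / 24) * k by rewrite ler_wpM2r ?(ltW k0) //; lra.
  by rewrite /e; lra.
have l2 : 0 <= l ^+ 2 by apply: sqr_ge0.
have h8 : 4 * e * l ^+ 2 <= 2 * ((b - al / 24) * k) * l ^+ 2 by rewrite ler_wpM2r.
have h9 : b * l ^+ 2 <= (al + e) * l ^+ 2 by rewrite ler_wpM2r // ltW.
apply: (@le_trans _ _ (x * ((al - e) * l ^+ 2))); last by rewrite le_eqVlt; apply/orP; left; apply/eqP; ring.
apply: (@le_trans _ _ (x * (b * l ^+ 2 - 2 * ((b - al / 24) * k) * l ^+ 2 + (24 * T1 * l + 2 * b + K * (1 + l))))).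
  have -> : x * (b * l ^+ 2 - 2 * ((b - al / 24) * k) * l ^+ 2 + (24 * T1 * l + 2 * b + K * (1 + l)))
    = 2 * (x * (b * (l ^+ 2 / 2 + 1) - (b - al / 24) * (k * l ^+ 2)) + 12 * T1 * l * x) + K * x * (1 + l).
    by field.
  by rewrite lerD2r ler_pM2l.
rewrite ler_pM2l //; have : 0 <= e * l ^+ 2 by rewrite mulr_ge0 // ltW.
rewrite -/l; clear - h5 h6 h8 h9; lra.
Qed.

End PsiAsymptotics.

(** * Prime powers in intervals *)

Section PrimeCounts.
Variable R : realType.
Implicit Types (x y z t : R) (f g : nat -> R).
Local Notation mangoldt := (mangoldt R).

Lemma ler_summatory_sub f g x y : 0 <= x -> x <= y ->
  (forall n, x < n%:R <= y -> f n <= g n) ->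
  summatory f y - summatory f x <= summatory g y - summatory g x.
Proof.
move=> x0 xy H; have y0 := le_trans x0 xy; rewrite /summatory.
have E u : \sum_(1 <= n < (Num.truncn y).+1) u n - \sum_(1 <= n < (Num.truncn x).+1) u n =
    \sum_((Num.truncn x).+1 <= n < (Num.truncn y).+1) u n :> R.
  rewrite (@big_cat_nat _ _ _ (Num.truncn x).+1 1 (Num.truncn y).+1) //=; last first.
    by rewrite ltnS le_truncn.
  by rewrite addrAC subrr add0r.
rewrite !E; apply: ler_sum_nat => n /andP[n1 n2]; apply: H.
by rewrite -truncn_lt_nat // n1 -truncn_ge_nat.
Qed.

Definition prime_ind n : R := (prime n)%:R.
Definition ppow_ind : nat -> R := lam (fun=> 1).

Lemma prime_ind_le_ppow n : prime_ind n <= ppow_ind n.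
Proof.
rewrite /prime_ind /ppow_ind /lam; case: (boolP (prime n)) => pn; first by rewrite primes_prime.
by case: (primes n) => [|p [|q s]].
Qed.

(* A prime power p^k with k >= 2 is m^2 or m^2 p, where m = p^(k/2). *)
Lemma ppow_ind_le M n : (n < M.+1 ^ 2)%N ->
  ppow_ind n <= prime_ind n + \sum_(1 <= m < M.+1) ((n == m ^ 2)%N%:R + (n == m ^ 2 * pdiv m)%N%:R).
Proof.
move=> nM; have s0 : 0 <= \sum_(1 <= m < M.+1) ((n == m ^ 2)%N%:R + (n == m ^ 2 * pdiv m)%N%:R) :> R.
  by apply: sumr_ge0 => m _; rewrite addr_ge0.
rewrite {1}/ppow_ind /lam; case e: (primes n) => [|p [|q s]]; try by rewrite addr_ge0.
have [pp k0 nE] := primes_eq1 e; set k := logn p n in k0 nE.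
have [k1|k1] := leqP k 1.
  have kE : k = 1%N by lia.
  have pn : prime n by rewrite nE kE expn1.
  by rewrite /prime_ind pn lerDl.
set m := (p ^ k./2)%N; have m0 : (0 < m)%N by rewrite expn_gt0 prime_gt0.
have k2 : (0 < k./2)%N by lia.
have pm : pdiv m = p by rewrite /m -(prednK k2) pdiv_pfactor.
have mn : (m ^ 2 <= n)%N.
  by rewrite nE -expnM leq_exp2l ?prime_gt1 //; lia.
have mM : (m < M.+1)%N by rewrite -(@ltn_exp2r _ _ 2) //; apply: leq_ltn_trans nM.
have hm : 1 <= (n == m ^ 2)%N%:R + (n == m ^ 2 * pdiv m)%N%:R :> R.
  have [ko|ke] := boolP (odd k).
    have -> : n == (m ^ 2 * pdiv m)%N.
      rewrite pm nE -expnM -expnSr; apply/eqP; congr (_ ^ _)%N; lia.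
    by rewrite lerDr.
  have -> : n == (m ^ 2)%N.
    rewrite nE -expnM; apply/eqP; congr (_ ^ _)%N; lia.
  by rewrite lerDl.
apply: (le_trans hm); rewrite (bigD1_seq m) ?iota_uniq ?mem_index_iota ?m0 //=.
by rewrite addrCA lerDl addr_ge0 // sumr_ge0 // => i _; rewrite addr_ge0.
Qed.

Lemma sum_eq_ind_le1 N c : \sum_(1 <= n < N.+1) (n == c)%:R <= 1 :> R.
Proof.
have [h|h] := boolP (c \in index_iota 1 N.+1).
  rewrite (bigD1_seq c) ?iota_uniq //= eqxx big1 ?addr0 // => i ic.
  by rewrite (negbTE ic).
rewrite big1_seq // => i /andP[_ ii]; case: eqP => // ic.
by move: h; rewrite -ic ii.
Qed.

Lemma ppow_sub_prime_le y : 0 <= y ->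
  summatory ppow_ind y - summatory prime_ind y <= 2 * Num.sqrt y.
Proof.
move=> y0; set M := Num.truncn (Num.sqrt y).
have hM : y < (M.+1 ^ 2)%:R.
  rewrite natrX -[y]sqr_sqrtr // ltr_pXn2r ?nnegrE ?sqrtr_ge0 //.
  exact: truncnS_gt.
have M1 : M%:R <= Num.sqrt y by rewrite truncn_le sqrtr_ge0.
rewrite -summatoryB; apply: (@le_trans _ _ (summatory (fun n => \sum_(1 <= m < M.+1)
   ((n == m ^ 2)%N%:R + (n == m ^ 2 * pdiv m)%N%:R)) y)).
  apply: ler_summatory => n _ ny; rewrite lerBlDl; apply: ppow_ind_le.
  by rewrite -(@ltr_nat R) (le_lt_trans ny).
rewrite /summatory exchange_big_nat /=.
apply: (@le_trans _ _ (\sum_(1 <= m < M.+1) 2)).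
  apply: ler_sum => m _; rewrite big_split /= (_ : 2 = 1 + 1 :> R) //.
  by rewrite lerD ?sum_eq_ind_le1.
by rewrite sumr_const_nat subSS subn0 -[leLHS]mulr_natr ler_pM2l.
Qed.

Lemma ppow_sub_prime_small (e : R) : 0 < e -> exists T : R, forall y, T <= y ->
  (summatory ppow_ind y - summatory prime_ind y) * ln y <= e * y.
Proof.
move=> e0; have e4 : 0 < e / 4 by lra.
exists ((4 / (e / 4) ^+ 2) ^+ 2 + 1) => y yT.
have c0 : 0 <= (4 / (e / 4) ^+ 2) ^+ 2 :> R by apply: sqr_ge0.
have y0 : 0 < y by lra.
have s0 : 0 < Num.sqrt y by rewrite sqrtr_gt0.
have ss : Num.sqrt y ^+ 2 = y by rewrite sqr_sqrtr // ltW.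
have h : 4 / (e / 4) ^+ 2 <= Num.sqrt y.
  have c1 : 0 <= 4 / (e / 4) ^+ 2 by apply: divr_ge0 => //; exact: sqr_ge0.
  by rewrite -(@ler_pXn2r _ 2) ?nnegrE ?(ltW s0) // ss; lra.
have hl := ln_le_mul_eps e4 s0 h.
have l0 : 0 <= ln y by apply: ln_ge0; lra.
apply: (le_trans (ler_wpM2r l0 (ppow_sub_prime_le (ltW y0)))).
rewrite -{2 3}ss lnXn // mulr2n expr2.
have := ler_wpM2l (ltW s0) hl; lra.
Qed.

(** The increment of psi is at least ln(a x) times the number of primes and at most ln(b x) times
    the number of prime powers. The surplus of higher powers is O(sqrt x), and ln(a x), ln(b x)
    differ from ln x by constants. *)
Lemma prime_count_interval (a b e : R) : 0 < a -> a <= b -> 0 < e ->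
  exists T : R, forall x, T <= x ->
  (b - a - e) * x <= (summatory prime_ind (b * x) - summatory prime_ind (a * x)) * ln x
  /\ (summatory ppow_ind (b * x) - summatory ppow_ind (a * x)) * ln x <= (b - a + e) * x.
Proof.
move=> a0 ab e0; have b0 : 0 < b by lra.
pose n := e / 8; have n0 : 0 < n by rewrite /n; lra.
pose n' := n / (a + b); have n'0 : 0 < n' by rewrite divr_gt0 //; lra.
have nn : n' * (a + b) = n by rewrite divfK //; apply: lt0r_neq0; lra.
have nb0 : 0 < n / b by rewrite divr_gt0.
have [T1 H1] := psi_asymp n'0; have [T2 H2] := ppow_sub_prime_small nb0.
pose k := `|ln a| + `|ln b|.
have k0 : 0 <= k by rewrite addr_ge0.
(* Once ln x >= B, trading ln(a x) for ln x in D ln(a x) costs at most n x; n = e/8 leaves room for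
   all such errors. *)
pose B := k * (b - a + n) / n + 2 * k + 1.
exists ((`|T1| + `|T2|) / a + expR B) => x xT.
have eB := expR_gt0 B; have t1 := normr_ge0 T1; have t2 := normr_ge0 T2.
have t0 : 0 <= (`|T1| + `|T2|) / a by rewrite divr_ge0 ?(ltW a0) //; lra.
have x0 : 0 < x by lra.
have aT : `|T1| + `|T2| <= a * x by rewrite -ler_pdivrMl // mulrC; lra.
have bT : a * x <= b * x by rewrite ler_pM2r.
have a1 := H1 (a * x) ltac:(have := ler_norm T1; lra).
have b1 := H1 (b * x) ltac:(have := ler_norm T1; lra).
have b2 := H2 (b * x) ltac:(have := ler_norm T2; lra).
have lB : B <= ln x by rewrite -ler_expR lnK ?posrE //; lra.
have ax0 : 0 < a * x by rewrite mulr_gt0.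
have bx0 : 0 < b * x by rewrite mulr_gt0.
have la : ln (a * x) = ln a + ln x by rewrite lnM.
have lb : ln (b * x) = ln b + ln x by rewrite lnM.
have h0 : 0 <= k * (b - a + n) / n.
  by rewrite divr_ge0 ?mulr_ge0 ?(ltW n0) //; lra.
have ka : `|ln a| <= k by rewrite /k lerDl.
have kb : `|ln b| <= k by rewrite /k lerDr.
have [ka1 ka2] : - k <= ln a /\ ln a <= k by apply/andP; rewrite -ler_norml.
have [kb1 kb2] : - k <= ln b /\ ln b <= k by apply/andP; rewrite -ler_norml.
have la0 : 0 < ln (a * x) by rewrite la; move: lB; rewrite /B; lra.
have lb0 : 0 < ln (b * x) by rewrite lb; move: lB; rewrite /B; lra.
set D := summatory prime_ind (b * x) - _; set P := summatory ppow_ind (b * x) - _.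
set Q := summatory ppow_ind (b * x) - summatory prime_ind (b * x) in b2.
have u1 : ln (a * x) * D <= psi (b * x) - psi (a * x).
  rewrite /D mulrBr -!summatoryZ; apply: ler_summatory_sub => //; first exact: ltW.
  move=> m /andP[m1 m2]; rewrite /prime_ind.
  case: (boolP (prime m)) => pm; last by rewrite mulr0 mangoldt_ge0.
  rewrite mulr1 -[m in leRHS]expn1 /mangoldt lam_pfactor // ler_ln ?posrE //; first exact: ltW.
  by rewrite ltr0n prime_gt0.
have u2 : psi (b * x) - psi (a * x) <= ln (b * x) * P.
  rewrite /P mulrBr -!summatoryZ; apply: ler_summatory_sub => //; first exact: ltW.
  move=> m /andP[m1 m2]; rewrite /mangoldt /ppow_ind /lam.
  case em: (primes m) => [|p [|q s]]; rewrite ?mulr0 ?mulr1 //.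
  have : p \in primes m by rewrite em inE.
  rewrite mem_primes => /and3P[/prime_gt0 p0 mm0 pm].
  rewrite ler_ln ?posrE ?ltr0n // (le_trans _ m2) // ler_nat dvdn_leq //.
have u3 : P <= D + Q.
  have : summatory prime_ind (a * x) <= summatory ppow_ind (a * x).
    by apply: ler_summatory => m _ _; exact: prime_ind_le_ppow.
  rewrite /P /D /Q; lra.
have D0 : 0 <= D by rewrite subr_ge0; apply: summatory_mono.
have Q0 : 0 <= Q.
  by rewrite subr_ge0; apply: ler_summatory => m _ _; exact: prime_ind_le_ppow.
have {}b2 : Q * ln (b * x) <= n * x.
  by apply: (le_trans b2); rewrite mulrA divfK // gt_eqF.
have [p1 p2] : (b - a - n) * x <= psi (b * x) - psi (a * x) /\
   psi (b * x) - psi (a * x) <= (b - a + n) * x.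
  move: a1 b1; rewrite !ler_norml => /andP[a1 a2] /andP[b1 b3].
  have : n * x = n' * (a * x) + n' * (b * x) by rewrite -nn; ring.
  by split; lra.
have Dk : D * k <= n * x.
  have h1 : k * (b - a + n) <= n * ln (a * x).
    rewrite -ler_pdivrMl // mulrC la; move: lB; rewrite /B; lra.
  have h2 : ln (a * x) * D <= (b - a + n) * x by lra.
  have h3 : k * (ln (a * x) * D) <= k * ((b - a + n) * x) by rewrite ler_wpM2l.
  have h4 : k * (b - a + n) * x <= n * ln (a * x) * x by rewrite ler_wpM2r // ltW.
  rewrite -(ler_pM2l la0); lra.
have kl : 2 * k <= ln x by move: lB; rewrite /B; lra.
have Dla : D * ln (a * x) = D * ln a + D * ln x by rewrite la mulrDr.
have Dlb : D * ln (b * x) = D * ln b + D * ln x by rewrite lb mulrDr.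
have Da : - (D * k) <= D * ln a by rewrite -mulrN ler_wpM2l.
have Db : D * ln b <= D * k by rewrite ler_wpM2l.
have Ql : Q * ln x <= 2 * (Q * ln (b * x)).
  by rewrite mulrCA ler_wpM2l // lb; lra.
have Pl : P * ln (b * x) <= (D + Q) * ln (b * x) by rewrite ler_wpM2r // ltW.
have Px : P * ln x <= (D + Q) * ln x by rewrite ler_wpM2r //; lra.
have ex : e * x = 8 * (n * x) by rewrite /n; field.
have nx : 0 <= n * x by rewrite mulr_ge0 // ltW.
by split; lra.
Qed.

End PrimeCounts.

(** * Gradient pairs and powers *)

Section PowerInequalities.
Variable R : realType.
Implicit Types (x y t s : R).

(** Young's inequality for t and 1 with the conjugate exponents s and s / (s - 1). *)
Lemma bernoulli_powR s t : 1 <= s -> 0 < t -> 1 + s * (t - 1) <= t `^ s.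
Proof.
move=> s1 t0; have [->|sn] := eqVneq s 1; first by rewrite powRr1 ?(ltW t0) //; lra.
have s2 : 1 < s by rewrite lt_neqAle eq_sym sn.
have s0 : 0 < s by lra.
pose q := s / (s - 1); have q0 : 0 < q by rewrite divr_gt0 //; lra.
have := @conjugate_powR R t 1 s q (ltW t0) ler01 s0 q0.
have qE : q^-1 = 1 - s^-1 by rewrite /q invf_div mulrBl divff ?mul1r // gt_eqF.
have -> : s^-1 + q^-1 = 1 by rewrite qE; ring.
rewrite mulr1 powR1 mul1r qE => /(_ erefl).
rewrite -(ler_pM2l s0) mulrDr mulrBr mulr1 mulfV ?gt_eqF // mulrCA mulfV ?gt_eqF // mulr1.
lra.
Qed.

Lemma powR_tangent s x y : 1 <= s -> 0 < x -> 0 < y ->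
  x `^ s + s * x `^ (s - 1) * (y - x) <= y `^ s.
Proof.
move=> s1 x0 y0; have t0 : 0 < y / x by rewrite divr_gt0.
have := bernoulli_powR s1 t0; have xs : 0 < x `^ s by rewrite powR_gt0.
move/(ler_wpM2l (ltW xs)); rewrite -powRM ?(ltW x0) ?(ltW t0) //.
have -> : x * (y / x) = y by rewrite mulrCA mulfV ?mulr1 // gt_eqF.
apply: le_trans; rewrite -(@mulr_powRB1 _ x s) ?(ltW x0) //; last by lra.
by rewrite le_eqVlt; apply/orP; left; apply/eqP; field; rewrite gt_eqF.
Qed.

End PowerInequalities.

Section Gradient.
Variable R : realType.
Implicit Types (a b x y t s : R) (B g : R -> R).

(** Says without integration that B is a primitive of a nondecreasing g, that is, B is convex with
    subgradient g. *)
Definition gradient_pair B g := forall a b, 0 < a -> a <= b -> b <= 1 ->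
  (b - a) * g a <= B b - B a <= (b - a) * g b.

(** Riemann sums over n + 1 equal pieces: right-end values of g1 bound B1 from above, left-end
    values of g2 bound B2 from below. Shifting the nodes by one costs only the telescoped (b - a)
    (g2(b) - g2(a)) / (n + 1). *)
Lemma gradient_compare B1 g1 B2 g2 :
  gradient_pair B1 g1 -> gradient_pair B2 g2 ->
  (forall x, 0 < x -> x <= 1 -> g1 x <= g2 x) ->
  forall a b, 0 < a -> a <= b -> b <= 1 -> B1 b - B1 a <= B2 b - B2 a.
Proof.
move=> P1 P2 g12 a b a0 ab b1.
pose D x := B2 x - B1 x; suff : 0 <= D b - D a by rewrite /D; lra.
have key n : - ((b - a) * (g2 b - g2 a)) <= n.+1%:R * (D b - D a).
  have n0 : 0 < n.+1%:R :> R by rewrite ltr0n.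
  pose d := (b - a) / n.+1%:R; have d0 : 0 <= d by rewrite divr_ge0 // subr_ge0.
  have dn : n.+1%:R * d = b - a by rewrite mulrC divfK // gt_eqF.
  have H i : (i <= n.+1)%N -> d * (g2 a - g2 (a + i%:R * d)) <= D (a + i%:R * d) - D a.
    elim: i => [|i IH] hi; first by rewrite mul0r addr0 !subrr mulr0.
    have {}IH := IH (ltnW hi).
    have i0 : 0 <= i%:R * d by rewrite mulr_ge0.
    have hi' : i.+1%:R * d <= b - a by rewrite -dn ler_wpM2r // ler_nat.
    have e : a + i.+1%:R * d - (a + i%:R * d) = d by rewrite -natr1; ring.
    have p0 : 0 < a + i%:R * d by lra.
    have p1 : a + i%:R * d <= a + i.+1%:R * d by rewrite -subr_ge0 e.
    have p2 : a + i.+1%:R * d <= 1 by lra.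
    have /andP[_ q1] := P1 _ _ p0 p1 p2; have /andP[q2 _] := P2 _ _ p0 p1 p2.
    have := g12 _ (lt_le_trans p0 p1) p2; move/(ler_wpM2l d0).
    rewrite e in q1 q2; move: IH q1 q2; rewrite /D.
    set u := g2 _; set v := g2 _; set w := g1 _; set z := g2 _.
    set X := B2 (a + i.+1%:R * d); set Y := B1 (a + i.+1%:R * d).
    set Z := B2 (a + i%:R * d); set W := B1 (a + i%:R * d); lra.
  have := H n.+1 (leqnn _); rewrite dn.
  have -> : a + (b - a) = b by ring.
  move/(ler_wpM2l (ltW n0)); rewrite mulrA dn; lra.
rewrite leNgt; apply/negP => Dn.
pose z := (b - a) * (g2 b - g2 a) / - (D b - D a).
have := key (Num.truncn z); have : z < (Num.truncn z).+1%:R by apply: truncnS_gt.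
rewrite /z ltr_pdivrMr; last by lra.
lra.
Qed.

Lemma gradient_pair_powR s : 1 <= s ->
  gradient_pair (fun x => x `^ s) (fun x => s * x `^ (s - 1)).
Proof.
move=> s1 a b a0 ab b1; have b0 : 0 < b by lra.
have h1 := powR_tangent s1 a0 b0; have h2 := powR_tangent s1 b0 a0.
by apply/andP; split; lra.
Qed.

Lemma gradient_pairZ k B g : 0 <= k -> gradient_pair B g ->
  gradient_pair (fun x => k * B x) (fun x => k * g x).
Proof.
move=> k0 P a b a0 ab b1; have /andP[h1 h2] := P a b a0 ab b1.
by have := ler_wpM2l k0 h1; have := ler_wpM2l k0 h2 => *; apply/andP; split; lra.
Qed.

Lemma gradient_pair_scale c B g : 0 < c -> c <= 1 -> gradient_pair B g ->
  gradient_pair (fun x => B (c * x)) (fun x => c * g (c * x)).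
Proof.
move=> c0 c1 P a b a0 ab b1; have := P (c * a) (c * b).
have -> : c * b - c * a = (b - a) * c by ring.
rewrite -!mulrA; apply; first by rewrite mulr_gt0.
  by rewrite ler_pM2l.
by rewrite mulr_ile1 //; lra.
Qed.

(* B2 - B1 is nonnegative and nondecreasing, and the bound on the sums makes it
   vanish at 1. *)
Lemma gradient_eq B1 g1 B2 g2 K :
  gradient_pair B1 g1 -> gradient_pair B2 g2 ->
  (forall x, 0 < x -> x <= 1 -> g1 x <= g2 x) ->
  (forall x, 0 < x -> x <= 1 -> B1 x <= K * x) ->
  (forall x, 0 < x -> x <= 1 -> 0 <= B2 x) ->
  (forall e : R, 0 < e -> exists n, (0 < n)%N /\
     \sum_(1 <= m < n.+1) (B2 m%:R^-1 - B1 m%:R^-1) <= e) ->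
  forall x, 0 < x -> x <= 1 -> B1 x = B2 x.
Proof.
move=> P1 P2 g12 hK h0 hs.
have mono := gradient_compare P1 P2 g12.
have ge0 x : 0 < x -> x <= 1 -> B1 x <= B2 x.
  move=> x0 x1; rewrite leNgt; apply/negP => hx.
  pose d := B1 x - B2 x; have d0 : 0 < d by rewrite /d; lra.
  have k1 : 0 < `|K| + 1 by have := normr_ge0 K; lra.
  pose y := Num.min x (d / (2 * (`|K| + 1))).
  have y0 : 0 < y by rewrite lt_min x0 divr_gt0 // mulr_gt0.
  have yx : y <= x by rewrite ge_min lexx.
  have yd : y <= d / (2 * (`|K| + 1)) by rewrite ge_min lexx orbT.
  have := mono y x y0 yx x1; have := hK y y0 (le_trans yx x1); have := h0 y y0 (le_trans yx x1).
  have : K * y <= (`|K| + 1) * y by rewrite ler_wpM2r ?(ltW y0) //; have := ler_norm K; lra.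
  move: yd; rewrite ler_pdivlMr ?mulr_gt0 // /d; lra.
move=> x x0 x1; apply/eqP; rewrite eq_le ge0 //=.
suff h1 : B2 1 <= B1 1 by have := mono x 1 x0 x1 (lexx _); lra.
rewrite leNgt; apply/negP => hx.
have [|n [n0 hn]] := hs ((B2 1 - B1 1) / 2); first by lra.
move: hn; rewrite big_ltn // invr1.
have : 0 <= \sum_(2 <= m < n.+1) (B2 m%:R^-1 - B1 m%:R^-1).
  rewrite big_nat_cond sumr_ge0 // => m /andP[/andP[m2 _] _]; rewrite subr_ge0.
  by apply: ge0; [rewrite invr_gt0 ltr0n; lia | rewrite invf_le1 ?ler1n ?ltr0n; lia].
lra.
Qed.

End Gradient.

(** * Limit profiles *)

(** [lp_lower] and [lp_upper] express the series for C x g(x) by partial sums, with the tail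
    controlled by g(x/n). The passage to the limit yields C x g(x/n) for the tail; the factor 2 is
    slack. *)
Record limit_profile (R : realType) (C : R) (g B : R -> R) : Prop := LimitProfile {
  lp_g1 : g 1 = 1;
  lp_g_ge0 : forall x, 0 < x -> x <= 1 -> 0 <= g x;
  lp_g_mono : forall x y, 0 < x -> x <= y -> y <= 1 -> g x <= g y;
  lp_B_ge0 : forall x, 0 < x -> x <= 1 -> 0 <= B x;
  lp_grad : gradient_pair B g;
  lp_lower : forall n x, 0 < x -> x <= 1 ->
    \sum_(1 <= m < n.+1) B (x / m%:R) <= C * x * g x;
  lp_upper : forall n x, (0 < n)%N -> 0 < x -> x <= 1 ->
    C * x * g x <= \sum_(1 <= m < n.+1) B (x / m%:R) + 2 * C * x * g (x / n%:R) }.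

Section LimitProfile.
Variables (R : realType) (C : R) (g B : R -> R).
Hypotheses (C0 : 0 < C) (P : limit_profile C g B).
Implicit Types (x y a b c e M : R).

Lemma lp_g_le1 x : 0 < x -> x <= 1 -> g x <= 1.
Proof. by move=> x0 x1; rewrite -(lp_g1 P); apply: (lp_g_mono P). Qed.

Lemma div_nat_itv x m : 0 < x -> x <= 1 -> (0 < m)%N ->
  [/\ 0 < x / m%:R, x / m%:R <= x & x / m%:R <= 1].
Proof.
move=> x0 x1 m0; have p : 0 < m%:R :> R by rewrite ltr0n.
have h : x / m%:R <= x by rewrite ler_pdivrMr // ler_peMr ?(ltW x0) // ler1n.
by split => //; [rewrite divr_gt0 | apply: le_trans x1].
Qed.

Lemma lp_B_le_g x : 0 < x -> x <= 1 -> B x <= C * x * g x.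
Proof. by move=> x0 x1; have := lp_lower P 1 x0 x1; rewrite big_nat1 divr1. Qed.

Lemma lp_B_le x : 0 < x -> x <= 1 -> B x <= C * x.
Proof.
move=> x0 x1; apply: (le_trans (lp_B_le_g x0 x1)).
by rewrite ler_piMr ?lp_g_le1 // mulr_ge0 // ltW.
Qed.

(** With q = g(1/(2N)), the gradient bound on [1/(2m), 1/m] gives B(1/m) >= q/(2m) for all m <= N.
    These terms sum to at most C, so divergence of the harmonic series makes q small. Hence the
    tails in [lp_upper] vanish as n grows. *)
Lemma lp_g_small e : 0 < e -> exists n, (0 < n)%N /\
  forall x, 0 < x -> x <= n%:R^-1 -> g x <= e.
Proof.
move=> e0; pose N := (Num.truncn (expR (2 * C / e))).+1.
have N0 : 0 < N%:R :> R by rewrite ltr0n.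
have lN : 2 * C / e <= ln N%:R.
  rewrite -[leLHS]expRK ler_ln ?posrE ?expR_gt0 //.
  by apply: ltW; apply: truncnS_gt.
exists (2 * N)%N; split=> // x x0 xN.
have N2 : 0 < ((2 * N)%:R : R)^-1 <= 1 by rewrite invr_gt0 ltr0n invf_le1 ?ltr0n // ler1n.
have /andP[Na Nb] := N2.
apply: (le_trans (lp_g_mono P x0 xN Nb)).
have : \sum_(1 <= m < N.+1) g (2 * N)%:R^-1 / 2 * m%:R^-1 <= C.
  apply: (@le_trans _ _ (\sum_(1 <= m < N.+1) B (1 / m%:R))); last first.
    by have := lp_lower P N ltr01 (lexx 1); rewrite (lp_g1 P) !mulr1.
  apply: ler_sum_nat => m /andP[m1 m2].
  have m0 : 0 < m%:R :> R by rewrite ltr0n.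
  have [p1 p2 p3] := div_nat_itv ltr01 (lexx (1:R)) m1.
  have q0 : 0 < 1 / m%:R / 2 :> R by rewrite divr_gt0.
  have q1 : 1 / m%:R / 2 <= 1 / m%:R :> R by rewrite ler_pdivrMr // ler_peMr ?(ltW p1) // ler1n.
  have /andP[h _] := lp_grad P q0 q1 p3.
  have hB := lp_B_ge0 P q0 (le_trans q1 p3).
  have hg : g (2 * N)%:R^-1 <= g (1 / m%:R / 2).
    apply: (lp_g_mono P) => //; last exact: le_trans q1 p3.
    by rewrite mul1r -invfM -natrM lef_pV2 ?posrE ?ltr0n ?muln_gt0 ?m1 // ler_nat mulnC leq_mul2l.
  apply: (@le_trans _ _ ((1 / m%:R - 1 / m%:R / 2) * g (1 / m%:R / 2))); last by lra.
  have -> : 1 / m%:R - 1 / m%:R / 2 = m%:R^-1 / 2 :> R by field; rewrite gt_eqF.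
  rewrite [leLHS](_ : _ = m%:R^-1 / 2 * g (2 * N)%:R^-1); last by ring.
  by rewrite ler_wpM2l // divr_ge0 // invr_ge0.
rewrite -mulr_sumr => h.
have hH : ln (N%:R : R) <= \sum_(1 <= m < N.+1) m%:R^-1.
  have := sum_inv_ge R (leq0n N.-1); rewrite ln1 subr0 prednK // big_add1 /=.
  apply: le_trans; rewrite ler_ln ?posrE ?ltr0n // ler_nat //.
rewrite leNgt; apply/negP => eg.
have h2 : e / 2 * ln N%:R <= g (2 * N)%:R^-1 / 2 * \sum_(1 <= m < N.+1) m%:R^-1.
  by rewrite ler_pM //; [lra | rewrite ln_ge0 // ler1n | lra].
have h3 : C <= e / 2 * ln N%:R.
  by move: lN; rewrite ler_pdivrMr //; lra.
have h4 : e / 2 * ln N%:R < g (2 * N)%:R^-1 / 2 * ln N%:R.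
  rewrite ltr_pM2r; first by lra.
  by move: lN; apply: lt_le_trans; rewrite divr_gt0 // mulr_gt0.
have h5 : g (2 * N)%:R^-1 / 2 * ln N%:R <= g (2 * N)%:R^-1 / 2 * \sum_(1 <= m < N.+1) m%:R^-1.
  by rewrite ler_wpM2l //; lra.
lra.
Qed.

(** Since b/2 < a, the values B(a), g(b/2) and B(b/2) vanish with g(a), and [lp_upper] for n = 2
    leaves C b g(b) <= B(b) <= (b - a) g(b). *)
Lemma lp_g_zero_step a b : 0 < a -> a <= b -> b <= 1 -> b < 2 * a ->
  b - a < C * b -> g a = 0 -> g b = 0.
Proof.
move=> a0 ab b1 b2 bC ga; have b0 : 0 < b by lra.
have [p1 p2 p3] := @div_nat_itv b 2 b0 b1 isT.
have hb2 : b / 2%:R <= a by lra.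
have gb2 : g (b / 2%:R) = 0.
  apply/eqP; rewrite eq_le (lp_g_ge0 P) // andbT -ga; apply: (lp_g_mono P) => //; lra.
have a1 : a <= 1 by lra.
have := lp_upper P (isT : (0 < 2)%N) b0 b1.
rewrite gb2 mulr0 addr0 big_ltn // big_nat1 divr1.
have := lp_B_le_g a0 a1; rewrite ga mulr0.
have := lp_B_le_g p1 p3; rewrite gb2 mulr0.
have /andP[_] := lp_grad P a0 ab b1.
have g0 := lp_g_ge0 P b0 b1.
move=> h1 h2 h3 h4; apply/eqP; rewrite eq_le g0 andbT leNgt; apply/negP => gp.
have : (b - a) * g b < C * b * g b by rewrite ltr_pM2r.
lra.
Qed.

Lemma lp_g_gt0 x : 0 < x -> x <= 1 -> 0 < g x.
Proof.
move=> x0 x1; rewrite lt0r (lp_g_ge0 P) // andbT; apply/negP => /eqP gx.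
(* The ratio 1 + h satisfies both conditions of [lp_g_zero_step], so a zero of g would propagate up
   to 1, where g is 1. *)
pose h := Num.min (C / 2) (1 / 2 : R).
have h0 : 0 < h by rewrite lt_min !divr_gt0.
have hC : h <= C / 2 by rewrite ge_min lexx.
have h2 : h <= 1 / 2 by rewrite ge_min lexx orbT.
have key k : g (Num.min 1 (x * (1 + h) ^+ k)) = 0.
  elim: k => [|k IH]; first by rewrite expr0 mulr1 min_r.
  have r0 : 0 < (1 + h) ^+ k by rewrite exprn_gt0 //; lra.
  have y0 : 0 < x * (1 + h) ^+ k by rewrite mulr_gt0.
  have [h1|h1] := leP 1 (x * (1 + h) ^+ k).
    by move: IH; rewrite min_l // (lp_g1 P) => /eqP; rewrite oner_eq0.
  rewrite min_r ?(ltW h1) // in IH.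
  have yy : 0 < h * (x * (1 + h) ^+ k) by rewrite mulr_gt0.
  have yC : h * (x * (1 + h) ^+ k) <= C / 2 * (x * (1 + h) ^+ k) by rewrite ler_pM2r.
  have y2 : h * (x * (1 + h) ^+ k) <= 1 / 2 * (x * (1 + h) ^+ k) by rewrite ler_pM2r.
  have e : x * (1 + h) ^+ k.+1 = x * (1 + h) ^+ k + h * (x * (1 + h) ^+ k).
    by rewrite exprS; ring.
  rewrite e; set y := x * _ in IH h1 y0 yy yC y2 *.
  set z := Num.min 1 _.
  have zy : y <= z by rewrite le_min (ltW h1) /=; lra.
  have z1 : z <= 1 by rewrite ge_min lexx.
  have z2 : z <= y + h * y by rewrite ge_min lexx orbT.
  have Cy : C * y <= C * z by rewrite ler_wpM2l // ltW.
  have Cy0 : 0 < C * y by rewrite mulr_gt0.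
  by apply: (lp_g_zero_step y0 zy z1) => //; lra.
have bern k : 1 + k%:R * h <= (1 + h) ^+ k.
  elim: k => [|k IH]; first by rewrite mul0r addr0 expr0.
  rewrite exprS -natr1; have kh : 0 <= k%:R * h by rewrite mulr_ge0 // ltW.
  have : (1 + h) * (1 + k%:R * h) <= (1 + h) * (1 + h) ^+ k by rewrite ler_wpM2l //; lra.
  have : 0 <= h * (k%:R * h) by rewrite mulr_ge0 // ltW.
  lra.
pose k := (Num.truncn (1 / (x * h))).+1.
have kx : 1 / (x * h) < k%:R by apply: truncnS_gt.
move: kx; rewrite ltr_pdivrMr ?mulr_gt0 // => kx.
have := key k; rewrite min_l; first by rewrite (lp_g1 P) => /eqP; rewrite oner_eq0.
have := ler_wpM2l (ltW x0) (bern k); lra.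
Qed.

(** [gradient_eq] is applied to B(c x) and c g(c) B(x), in the order dictated by the hypothesis.
    Over the points 1/m both have total C c g(c): the first by the series at c, the second by the
    series at 1 and g(1) = 1. *)
Lemma lp_eigen c : 0 < c -> c < 1 ->
  (forall x, 0 < x -> x <= 1 -> g (c * x) <= g c * g x) \/
  (forall x, 0 < x -> x <= 1 -> g c * g x <= g (c * x)) ->
  forall x, 0 < x -> x <= 1 -> B (c * x) = c * g c * B x.
Proof.
move=> c0 c1 H; have M0 := lp_g_gt0 c0 (ltW c1); set M := g c in M0 H *.
have cx x : 0 < x -> x <= 1 -> 0 < c * x /\ c * x <= 1.
  by move=> x0 x1; split; [rewrite mulr_gt0 | rewrite mulr_ile1 // ltW].
have cM : 0 < c * M by rewrite mulr_gt0.
have P1 := gradient_pair_scale c0 (ltW c1) (lp_grad P).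
have P2 := gradient_pairZ (ltW cM) (lp_grad P).
have small e : 0 < e -> exists n, [/\ (0 < n)%N, 2 * C * c * g (c / n%:R) <= e
    & 2 * C * c * M * g (1 / n%:R) <= e].
  move=> e0; have k0 : 0 < 2 * C * c * (1 + M) by rewrite !mulr_gt0 //; lra.
  have [n [n0 hn]] := lp_g_small (divr_gt0 e0 k0).
  have nn : 0 < n%:R :> R by rewrite ltr0n.
  have [p1 _ p2] := div_nat_itv c0 (ltW c1) n0.
  have [q1 _ q2] := div_nat_itv ltr01 (lexx (1:R)) n0.
  exists n; split=> //.
    have : g (c / n%:R) <= e / (2 * C * c * (1 + M)).
      by apply: hn => //; rewrite ler_piMl ?invr_ge0 // ltW.
    rewrite ler_pdivlMr // => h.
    have : 0 <= g (c / n%:R) * (2 * C * c * M).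
      by rewrite mulr_ge0 ?(lp_g_ge0 P) // !mulr_ge0 // ltW.
    lra.
  have : g (1 / n%:R) <= e / (2 * C * c * (1 + M)) by apply: hn => //; rewrite mul1r.
  rewrite ler_pdivlMr // => h.
  have : 0 <= g (1 / n%:R) * (2 * C * c).
    by rewrite mulr_ge0 ?(lp_g_ge0 P) // !mulr_ge0 // ltW.
  lra.
have Sc n : \sum_(1 <= m < n.+1) B (c * m%:R^-1) = \sum_(1 <= m < n.+1) B (c / m%:R) by [].
have S1 n : \sum_(1 <= m < n.+1) B m%:R^-1 = \sum_(1 <= m < n.+1) B (1 / m%:R).
  by apply: eq_bigr => m _; rewrite mul1r.
have hB1 x : 0 < x -> x <= 1 -> 0 <= B (c * x).
  by move=> x0 x1; have [? ?] := cx x x0 x1; exact: (lp_B_ge0 P).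
have hB2 x : 0 < x -> x <= 1 -> 0 <= c * M * B x.
  by move=> x0 x1; rewrite mulr_ge0 ?(ltW cM) //; exact: (lp_B_ge0 P).
have kB1 x : 0 < x -> x <= 1 -> B (c * x) <= C * c * x.
  by move=> x0 x1; have [? ?] := cx x x0 x1; rewrite -mulrA lp_B_le.
have kB2 x : 0 < x -> x <= 1 -> c * M * B x <= c * M * C * x.
  by move=> x0 x1; rewrite -[leRHS]mulrA ler_wpM2l ?(ltW cM) // lp_B_le.
have s1 n := lp_lower P n ltr01 (lexx 1).
have s2 n (n0 : (0 < n)%N) := lp_upper P n0 ltr01 (lexx 1).
have t1 n := lp_lower P n c0 (ltW c1).
have t2 n (n0 : (0 < n)%N) := lp_upper P n0 c0 (ltW c1).
rewrite (lp_g1 P) !mulr1 in s1 s2.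
case: H => H.
  apply: (gradient_eq P1 P2 _ kB1 hB2) => [x x0 x1|e e0].
    by rewrite -[leRHS]mulrA ler_pM2l // H.
  have [n [n0 hn _]] := small e e0; exists n; split=> //.
  rewrite sumrB -mulr_sumr Sc S1.
  have := t2 n n0; have := ler_wpM2l (ltW cM) (s1 n); rewrite -/M; lra.
have H' x : 0 < x -> x <= 1 -> c * M * g x <= c * g (c * x).
  by move=> x0 x1; rewrite -mulrA ler_pM2l // H.
move=> x x0 x1; apply/esym; apply: (gradient_eq P2 P1 H' kB2 hB1) => // e e0.
have [n [n0 _ hn]] := small e e0; exists n; split=> //.
rewrite sumrB -mulr_sumr Sc S1.
have := t1 n; have := ler_wpM2l (ltW cM) (s2 n n0); rewrite -/M; lra.
Qed.

End LimitProfile.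

(** * The zeta-function on the half-line s > 1 *)

Section Zeta.
Variable R : realType.
Implicit Types (x y s t : R).

Lemma exprn_unbounded x K : 1 < x -> exists n, K < x ^+ n.
Proof.
move=> x1; have x0 : 0 < x - 1 by lra.
have bern k : 1 + k%:R * (x - 1) <= x ^+ k.
  elim: k => [|k IH]; first by rewrite mul0r addr0 expr0.
  rewrite exprS -natr1; have kh : 0 <= k%:R * (x - 1) by rewrite mulr_ge0 // ltW.
  have : x * (1 + k%:R * (x - 1)) <= x * x ^+ k by rewrite ler_wpM2l //; lra.
  have : 0 <= (x - 1) * (k%:R * (x - 1)) by rewrite mulr_ge0 // ltW.
  lra.
exists (Num.truncn (K / (x - 1))).+1; apply: lt_le_trans (bern _).
have : K / (x - 1) < (Num.truncn (K / (x - 1))).+1%:R by apply: truncnS_gt.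
rewrite ltr_pdivrMr //; lra.
Qed.

Lemma powR_div_nat x s m : 0 < x -> (0 < m)%N ->
  (x / m%:R) `^ s = x `^ s * (m%:R `^ s)^-1.
Proof.
move=> x0 m0; have p : 0 < m%:R :> R by rewrite ltr0n.
rewrite powRM ?invr_ge0 ?(ltW x0) ?(ltW p) //; congr (_ * _).
apply: (@mulfI _ (m%:R `^ s)); first by rewrite gt_eqF // powR_gt0.
rewrite -powRM ?invr_ge0 ?(ltW p) // !mulfV ?powR1 ?gt_eqF ?powR_gt0 //.
Qed.

Lemma series_riemannR s n :
  series (riemannR s) n = \sum_(1 <= m < n.+1) (m%:R `^ s)^-1 :> R.
Proof. by rewrite big_add1 /= /series. Qed.

Lemma series_riemannR_mono s : nondecreasing_seq (series (riemannR s)).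
Proof.
by apply: nondecreasing_series => n _ _; rewrite /riemannR invr_ge0 powR_ge0.
Qed.

Lemma zeta_cvg_of_bounded s K : (forall n, series (riemannR s) n <= K) ->
  cvgn (series (riemannR s)).
Proof.
move=> h; apply: nondecreasing_is_cvgn; first exact: series_riemannR_mono.
by exists K => _ [n _ <-].
Qed.

Lemma series_le_zeta s n : cvgn (series (riemannR s)) ->
  series (riemannR s) n <= zeta s.
Proof. by move=> h; apply: nondecreasing_cvgn_le => //; exact: series_riemannR_mono. Qed.

Lemma zeta_le s K : cvgn (series (riemannR s)) ->
  (forall n, series (riemannR s) n <= K) -> zeta s <= K.
Proof. by move=> h hK; apply: limr_le => //; near=> n; exact: hK. Unshelve. all: by end_near. Qed.

Lemma zeta_ge1 s : cvgn (series (riemannR s)) -> 1 <= zeta s.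
Proof.
move=> h; apply: le_trans (series_le_zeta 1 h).
by rewrite series_riemannR big_nat1 powR1 invr1.
Qed.

(* Cauchy condensation: S(2 n + 1) <= 1 + 2^(1 - s) S(n). *)
Lemma cvg_riemannR s : 1 < s -> cvgn (series (riemannR s)).
Proof.
move=> s1; pose r : R := 2 `^ (1 - s).
have r0 : 0 < r by rewrite powR_gt0.
have r1 : r < 1.
  have -> : r = expR ((1 - s) * ln 2) by rewrite /r /powR pnatr_eq0.
  rewrite -[X in _ < X]expR0 ltr_expR.
  have : 0 < ln (2 : R) by apply: ln_gt0; lra.
  by move=> l2; rewrite pmulr_llt0 //; lra.
have half n : series (riemannR s) n.*2.+1 <= 1 + r * series (riemannR s) n.
  elim: n => [|n IH].
    by rewrite !series_riemannR big_nat1 big_geq // powR1 invr1 mulr0 addr0.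
  have SS k : series (riemannR s) k.+1 = series (riemannR s) k + (k.+1%:R `^ s)^-1 :> R.
    by rewrite !series_riemannR big_nat_recr.
  rewrite doubleS (SS n.*2.+2) (SS n.*2.+1) (SS n) mulrDr.
  suff : (n.*2.+2%:R `^ s)^-1 + (n.*2.+3%:R `^ s)^-1 <= r * (n.+1%:R `^ s)^-1 by lra.
  have n0 : 0 < n.+1%:R :> R by rewrite ltr0n.
  have m0 : 0 < n.*2.+2%:R :> R by rewrite ltr0n.
  have -> : r * (n.+1%:R `^ s)^-1 = (n.*2.+2%:R `^ s)^-1 + (n.*2.+2%:R `^ s)^-1.
    have -> : n.*2.+2%:R = 2 * n.+1%:R :> R by rewrite -natrM mul2n doubleS.
    rewrite powRM ?(ltW n0) // /r powRB ?pnatr_eq0 ?implybT // powRr1 //.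
    by field; rewrite !gt_eqF ?powR_gt0.
  rewrite lerD2l lef_pV2 ?posrE ?powR_gt0 ?ltr0n //.
  by apply: ge0_ler_powR; rewrite ?nnegrE ?ler_nat //; lra.
apply: (@zeta_cvg_of_bounded _ (1 / (1 - r))) => n.
elim/ltn_ind: n => n IH.
have r2 : 0 < 1 - r by lra.
rewrite ler_pdivlMr //.
have [n0|n0] := posnP n.
  by rewrite n0 series_riemannR big_geq // mul0r.
have h1 : series (riemannR s) n <= series (riemannR s) (n./2).*2.+1.
  by apply: series_riemannR_mono; lia.
have := half n./2; have := IH n./2 ltac:(lia); rewrite ler_pdivlMr // => h2 h3.
have : r * (series (riemannR s) n./2 * (1 - r)) <= r * 1 by rewrite ler_wpM2l // ltW.
have : (series (riemannR s) n) * (1 - r) <= (1 + r * series (riemannR s) n./2) * (1 - r).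
  by rewrite ler_wpM2r ?(ltW r2) // (le_trans h1).
lra.
Qed.

(** zeta is nonincreasing and 1/s strictly decreasing. *)
Lemma zeta_div_inj s t : 1 < s -> 1 < t -> zeta s / s = zeta t / t -> s = t.
Proof.
suff key x y : 1 < x -> x < y -> zeta y / y < zeta x / x.
  move=> s1 t1 e; apply/eqP; rewrite eq_le !leNgt; apply/andP; split; apply/negP => h.
    by have := key _ _ t1 h; rewrite e ltxx.
  by have := key _ _ s1 h; rewrite e ltxx.
move=> x1 xy; have y1 : 1 < y by lra.
have cx := cvg_riemannR x1; have cy := cvg_riemannR y1.
have zxy : zeta y <= zeta x.
  apply: zeta_le => // n; apply: le_trans (series_le_zeta n cx).
  rewrite !series_riemannR; apply: ler_sum_nat => m /andP[m1 _].
  have m0 : 1 <= m%:R :> R by rewrite ler1n.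
  rewrite lef_pV2 ?posrE ?powR_gt0 ?ltr0n //.
  by rewrite ler_powR // ltW.
apply: (@le_lt_trans _ _ (zeta x / y)).
  by rewrite ler_pM2r // invr_gt0; lra.
have zx := zeta_ge1 cx.
rewrite ltr_pM2l; last by lra.
by rewrite ltf_pV2 ?posrE; lra.
Qed.

End Zeta.

(** * The exponent of a limit profile *)

Section Exponent.
Variables (R : realType) (C : R) (g B : R -> R).
Hypotheses (C0 : 0 < C) (P : limit_profile C g B).
Implicit Types (x y a b c e q s M : R).

(** Lets a tend to 0; below it lets increments over [a, b] bound B(b) itself. *)
Lemma le_of_le_add_mul (u v K b : R) : 0 < b ->
  (forall a, 0 < a -> a <= b -> u <= v + K * a) -> u <= v.
Proof.
move=> b0 H; rewrite leNgt; apply/negP => uv.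
have k1 : 0 < `|K| + 1 by have := normr_ge0 K; lra.
pose a := Num.min b ((u - v) / (2 * (`|K| + 1))).
have a0 : 0 < a by rewrite lt_min b0 divr_gt0 ?mulr_gt0 //; lra.
have ab : a <= b by rewrite ge_min lexx.
have : a <= (u - v) / (2 * (`|K| + 1)) by rewrite ge_min lexx orbT.
rewrite ler_pdivlMr ?mulr_gt0 // => h.
have : K * a <= (`|K| + 1) * a.
  by rewrite ler_wpM2r ?(ltW a0) //; have := ler_norm K; lra.
have := H a a0 ab; lra.
Qed.

Lemma lp_B_gt0 x : 0 < x -> x <= 1 -> 0 < B x.
Proof.
move=> x0 x1; have h0 : 0 < x / 2 by lra.
have h1 : x / 2 <= x by lra.
have /andP[h _] := lp_grad P h0 h1 x1.
have gx := lp_g_gt0 C0 P h0 ltac:(lra).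
have := lp_B_ge0 P h0 ltac:(lra).
have : 0 < (x - x / 2) * g (x / 2) by rewrite mulr_gt0 //; lra.
lra.
Qed.

Lemma lp_B_mono x y : 0 < x -> x <= y -> y <= 1 -> B x <= B y.
Proof.
move=> x0 xy y1; have /andP[h _] := lp_grad P x0 xy y1.
have : 0 <= (y - x) * g x by rewrite mulr_ge0 ?subr_ge0 ?(lp_g_ge0 P) //; lra.
lra.
Qed.

Section Iteration.
Variables (c s : R).
Hypotheses (c0 : 0 < c) (c1 : c < 1).
Hypothesis Bc : forall x, 0 < x -> x <= 1 -> B (c * x) = c `^ s * B x.

(** B(x) / x^s is invariant under x -> c x, so x = c^k t can be moved to t in the period (c, 1]. *)
Lemma B_powR_period x : 0 < x -> x <= 1 -> exists t,
  [/\ c < t, t <= 1 & B x * t `^ s = B t * x `^ s].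
Proof.
move=> x0 x1.
have ex : exists k, c ^+ k.+1 < x.
  have [k hk] := @exprn_unbounded R c^-1 x^-1 ltac:(by rewrite invf_gt1).
  exists k; rewrite exprVn ltf_pV2 ?posrE ?exprn_gt0 // in hk.
  by apply: le_lt_trans hk; rewrite exprS ler_piMl ?(ltW c1) // exprn_ge0 // ltW.
pose k := ex_minn ex; have : c ^+ k.+1 < x /\ x <= c ^+ k.
  rewrite /k; case: ex_minnP => -[|m] hm hmin; split=> //.
  by rewrite leNgt; apply/negP => /hmin; rewrite ltnn.
clearbody k => -[h1 h2]; have ck : 0 < c ^+ k by rewrite exprn_gt0.
pose t := x / c ^+ k; have t0 : 0 < t by rewrite divr_gt0.
have t1 : t <= 1 by rewrite ler_pdivrMr // mul1r.
exists t; split=> //; first by rewrite ltr_pdivlMr // -exprS.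
have xE : x = c ^+ k * t by rewrite mulrC divfK // gt_eqF.
have it n : B (c ^+ n * t) = (c `^ s) ^+ n * B t.
  elim: n => [|n IH]; first by rewrite !expr0 !mul1r.
  have p : 0 < c ^+ n * t by rewrite mulr_gt0 // exprn_gt0.
  have q : c ^+ n * t <= 1 by rewrite mulr_ile1 ?exprn_ge0 ?exprn_ile1 ?(ltW c0) ?(ltW c1) ?(ltW t0).
  by rewrite exprS -mulrA Bc // IH mulrA -exprS.
rewrite xE it powRM ?(ltW ck) ?(ltW t0) // -!powR_mulrn ?powR_ge0 ?(ltW c0) //.
by rewrite -!powRrM [s * _]mulrC; ring.
Qed.

Hypothesis s1 : 1 <= s.

(** On one period the monotone B lies between B(c) and B(1), and t^s between c^s and 1. *)
Lemma B_powR_bounds : exists q1 q2, [/\ 0 < q1, 0 < q2 &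
  forall x, 0 < x -> x <= 1 -> q1 * x `^ s <= B x <= q2 * x `^ s].
Proof.
have cs : 0 < c `^ s by rewrite powR_gt0.
have Bc0 := lp_B_gt0 c0 (ltW c1); have B10 := lp_B_gt0 ltr01 (lexx (1:R)).
exists (B c), (B 1 / c `^ s); split=> //; first by rewrite divr_gt0.
move=> x x0 x1; have [t [ct t1 e]] := B_powR_period x0 x1.
have t0 : 0 < t by apply: lt_trans ct.
have s0 : 0 <= s by apply: le_trans s1.
have xs : 0 < x `^ s by rewrite powR_gt0.
have ts : 0 < t `^ s by rewrite powR_gt0.
have ts1 : t `^ s <= 1.
  by have := @ge0_ler_powR R s s0 t 1; rewrite powR1; apply; rewrite ?nnegrE ?(ltW t0).
have tc : c `^ s <= t `^ s.
  by apply: ge0_ler_powR; rewrite ?nnegrE ?(ltW t0) ?(ltW c0) ?(ltW ct).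
have h1 := lp_B_mono c0 (ltW ct) t1; have h2 := lp_B_mono t0 t1 (lexx 1).
apply/andP; split; rewrite -(ler_pM2r ts) e.
  apply: (@le_trans _ _ (B c * x `^ s)); first by rewrite ler_piMr // mulr_ge0 // ltW.
  by rewrite ler_pM2r.
apply: (@le_trans _ _ (B 1 * x `^ s)); first by rewrite ler_pM2r.
rewrite [leRHS](_ : _ = B 1 * x `^ s * (t `^ s / c `^ s)); last by ring.
by rewrite ler_peMr ?mulr_ge0 ?(ltW B10) ?(ltW xs) // ler_pdivlMr // mul1r.
Qed.

(** The terms q1 m^(-s) are at most B(1/m), whose partial sums are at most C. This excludes s = 1,
    which is why the final exponent is positive. *)
Lemma zeta_cvg_of_profile : cvgn (series (riemannR s)).
Proof.
have [q1 [q2 [q10 q20 H]]] := B_powR_bounds.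
apply: (@zeta_cvg_of_bounded _ _ (C / q1)) => n.
rewrite ler_pdivlMr // mulrC; have := lp_lower P n ltr01 (lexx 1).
rewrite (lp_g1 P) !mulr1; apply: le_trans.
rewrite series_riemannR mulr_sumr; apply: ler_sum_nat => m /andP[m1 _].
have [p1 _ p2] := div_nat_itv ltr01 (lexx (1:R)) m1.
have /andP[h _] := H _ p1 p2; apply: le_trans h.
by rewrite powR_div_nat // powR1 mul1r.
Qed.

Lemma exponent_gt1 : 1 < s.
Proof.
rewrite lt_neqAle s1 andbT; apply/eqP => e.
by apply: (@dvg_riemannR R s); [rewrite -e ler01 lexx | exact: zeta_cvg_of_profile].
Qed.

Let k := zeta s / (C * s).

(** One round trip between B and g: summing q (x/m)^s in [lp_upper] gives C g(x) <= q zeta(s) x^(s -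
    1), and integrating this returns to B with the factor k. *)
Lemma B_upper_step q : 0 <= q ->
  (forall x, 0 < x -> x <= 1 -> B x <= q * x `^ s) ->
  (forall x, 0 < x -> x <= 1 -> B x <= q * k * x `^ s).
Proof.
move=> q0 H; have cz := zeta_cvg_of_profile; have z1 := zeta_ge1 cz.
have s0 : 0 < s by apply: lt_le_trans s1.
have hg x : 0 < x -> x <= 1 -> g x <= q * k * (s * x `^ (s - 1)).
  move=> x0 x1; have xs : 0 < x `^ s by rewrite powR_gt0.
  have : C * x * g x <= q * x `^ s * zeta s.
    apply/ler_addgt0Pr => e e0.
    have k0 : 0 < 2 * C * x by rewrite !mulr_gt0.
    have [n [n0 hn]] := lp_g_small C0 P (divr_gt0 e0 k0).
    have [p1 _ p2] := div_nat_itv x0 x1 n0.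
    apply: (le_trans (lp_upper P n0 x0 x1)); apply: lerD.
      apply: (@le_trans _ _ (q * x `^ s * series (riemannR s) n)).
        rewrite series_riemannR mulr_sumr; apply: ler_sum_nat => m /andP[m1 _].
        have [r1 _ r2] := div_nat_itv x0 x1 m1.
        by apply: (le_trans (H _ r1 r2)); rewrite powR_div_nat // mulrA.
      rewrite ler_wpM2l ?series_le_zeta // mulr_ge0 // ltW //.
    have : g (x / n%:R) <= e / (2 * C * x).
      apply: hn => //; rewrite ler_piMl ?invr_ge0 //.
    by rewrite ler_pdivlMr // mulrC.
  have Cx : 0 < C * x by rewrite mulr_gt0.
  move=> hh; rewrite -(ler_pM2l Cx); apply: (le_trans hh).
  rewrite -(@mulr_powRB1 _ x s) ?(ltW x0) // /k.
  by rewrite le_eqVlt; apply/orP; left; apply/eqP; field; rewrite !gt_eqF.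
have k0 : 0 <= k by rewrite divr_ge0 ?mulr_ge0 ?(ltW s0) ?(ltW C0) //; lra.
have G := gradient_pairZ (mulr_ge0 q0 k0) (gradient_pair_powR s1).
move=> b b0 b1; apply: (@le_of_le_add_mul _ _ C b b0) => a a0 ab.
have := gradient_compare (lp_grad P) G hg a0 ab b1.
have := lp_B_le C0 P a0 (le_trans ab b1).
have : 0 <= q * k * a `^ s by exact: mulr_ge0 (mulr_ge0 q0 k0) (powR_ge0 _ _).
lra.
Qed.

Lemma B_lower_step q : 0 <= q ->
  (forall x, 0 < x -> x <= 1 -> q * x `^ s <= B x) ->
  (forall x, 0 < x -> x <= 1 -> q * k * x `^ s <= B x).
Proof.
move=> q0 H; have cz := zeta_cvg_of_profile; have z1 := zeta_ge1 cz.
have s0 : 0 < s by apply: lt_le_trans s1.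
have hg x : 0 < x -> x <= 1 -> q * k * (s * x `^ (s - 1)) <= g x.
  move=> x0 x1; have xs : 0 < x `^ s by rewrite powR_gt0.
  have : q * x `^ s * zeta s <= C * x * g x.
    have [->|qn] := eqVneq q 0.
      by rewrite !mul0r !mulr_ge0 ?(ltW C0) ?(ltW x0) // (lp_g_ge0 P).
    have qx : 0 < q * x `^ s by rewrite mulr_gt0 // lt0r qn.
    rewrite mulrC -ler_pdivlMr //; apply: zeta_le => // n.
    rewrite ler_pdivlMr // mulrC; apply: le_trans (lp_lower P n x0 x1).
    rewrite series_riemannR mulr_sumr; apply: ler_sum_nat => m /andP[m1 _].
    have [r1 _ r2] := div_nat_itv x0 x1 m1.
    by apply: le_trans (H _ r1 r2); rewrite powR_div_nat // mulrA.
  have Cx : 0 < C * x by rewrite mulr_gt0.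
  move=> hh; rewrite -(ler_pM2l Cx); apply: le_trans hh.
  rewrite -(@mulr_powRB1 _ x s) ?(ltW x0) // /k.
  by rewrite le_eqVlt; apply/orP; left; apply/eqP; field; rewrite !gt_eqF.
have k0 : 0 <= k by rewrite divr_ge0 ?mulr_ge0 ?(ltW s0) ?(ltW C0) //; lra.
have qk := mulr_ge0 q0 k0.
have G := gradient_pairZ qk (gradient_pair_powR s1).
move=> b b0 b1; apply: (@le_of_le_add_mul _ _ (q * k) b b0) => a a0 ab.
have := gradient_compare G (lp_grad P) hg a0 ab b1.
have a1 := le_trans ab b1; have := lp_B_ge0 P a0 a1.
have : q * k * a `^ s <= q * k * a.
  by rewrite ler_wpM2l // ge1r_powR // a0.
lra.
Qed.

Lemma exponent_equation : C = zeta s / s.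
Proof.
have [q1 [q2 [q10 q20 H]]] := B_powR_bounds.
have z1 := zeta_ge1 zeta_cvg_of_profile.
have s0 : 0 < s by apply: lt_le_trans s1.
have k0 : 0 < k by rewrite divr_gt0 ?mulr_gt0 ?C0 //; lra.
have B10 := lp_B_gt0 ltr01 (lexx (1:R)).
have up n x : 0 < x -> x <= 1 -> B x <= q2 * k ^+ n * x `^ s.
  elim: n x => [|n IH] x x0 x1.
    by rewrite expr0 mulr1; have /andP[] := H x x0 x1.
  rewrite exprSr mulrA; apply: B_upper_step => //.
  by rewrite mulr_ge0 ?exprn_ge0 // ltW.
have lo n x : 0 < x -> x <= 1 -> q1 * k ^+ n * x `^ s <= B x.
  elim: n x => [|n IH] x x0 x1.
    by rewrite expr0 mulr1; have /andP[] := H x x0 x1.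
  rewrite exprSr mulrA; apply: B_lower_step => //.
  by rewrite mulr_ge0 ?exprn_ge0 // ltW.
suff k1 : k = 1.
  have : zeta s = C * s.
    have Cs : 0 < C * s by rewrite mulr_gt0.
    have this0 : k * (C * s) = zeta s by rewrite /k divfK // gt_eqF.
    by rewrite -this0 k1 mul1r.
  by move=> ->; rewrite mulfK // gt_eqF.
apply/eqP; rewrite eq_le !leNgt; apply/andP; split; apply/negP => hk.
  (* At x = 1 the bounds read q1 k^n <= B(1) <= q2 k^n for every n: k > 1 contradicts the left one,
     k < 1 the right one because B(1) > 0. *)
  have [n hn] := exprn_unbounded (B 1 / q1) hk.
  have := lo n 1 ltr01 (lexx 1); rewrite powR1 mulr1.
  by move: hn; rewrite ltr_pdivrMr //; lra.
have ki : 1 < k^-1 by rewrite invf_gt1.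
have [n hn] := exprn_unbounded (q2 / B 1) ki.
have := up n 1 ltr01 (lexx 1); rewrite powR1 mulr1.
have kn : 0 < k ^+ n by rewrite exprn_gt0.
move: hn; rewrite exprVn ltr_pdivrMr // [X in _ < X]mulrC ltr_pdivlMr // => h1 h2.
by have := lt_le_trans h1 h2; rewrite ltxx.
Qed.

End Iteration.

Lemma lp_exponent c : 0 < c -> c < 1 ->
  (forall x, 0 < x -> x <= 1 -> g (c * x) <= g c * g x) \/
  (forall x, 0 < x -> x <= 1 -> g c * g x <= g (c * x)) ->
  exists rho, [/\ 0 < rho, C = zeta (rho + 1) / (rho + 1) & g c = c `^ rho].
Proof.
move=> c0 c1 H; have gc := lp_g_gt0 C0 P c0 (ltW c1).
have gc1 := lp_g_le1 P c0 (ltW c1).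
have cg : 0 < c * g c by rewrite mulr_gt0.
have lc : ln c < 0 by apply: ln_lt0; rewrite c0.
pose s := ln (c * g c) / ln c.
have sE : c `^ s = c * g c.
  by rewrite /powR gt_eqF // /s divfK ?lnK ?posrE // lt_eqF.
have s1 : 1 <= s.
  by rewrite /s ler_ndivlMr // mul1r ler_ln ?posrE // ler_piMr // ltW.
have Bc x : 0 < x -> x <= 1 -> B (c * x) = c `^ s * B x.
  by move=> x0 x1; rewrite sE (lp_eigen C0 P c0 c1 H).
exists (s - 1); split.
- by rewrite subr_gt0; exact: (exponent_gt1 c0 c1 Bc s1).
- by rewrite subrK; exact: (exponent_equation c0 c1 Bc s1).
- apply: (@mulfI _ c); first by rewrite gt_eqF.
  by rewrite mulr_powRB1 ?(ltW c0) ?sE //; lra.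
Qed.

End Exponent.

(** * Limits along ultrafilters *)

Section Ultralimit.
Variable R : realType.
Implicit Types (f u v : R -> R) (U : set_system R) (l m e t x : R).

Definition at_infinity U := forall t, U [set x | t <= x].

Definition ulim U f l := forall e, 0 < e -> U [set x | `|f x - l| <= e].

(** The limit is the supremum of the t with f >= t on a set of U; above it, the ultrafilter contains
    the complementary set. *)
Lemma ulim_exists U f K : UltraFilter U -> at_infinity U ->
  (exists t, forall x, t <= x -> `|f x| <= K) -> exists l, ulim U f l.
Proof.
move=> UU Ui [T HT]; pose E := [set t | U [set x | t <= f x]].
have UT := Ui T.
have E1 : E (- K).
  by apply: filterS UT => x /= /HT; rewrite ler_norml => /andP[].
have E2 t : E t -> t <= K.
  move=> Et; have [x [/= x1 x2]] := @filter_ex _ U _ _ (filterI Et UT).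
  by have := HT x x2; rewrite ler_norml => /andP[_]; exact: le_trans.
have hE : has_sup E by split; [exists (- K) | exists K => t; exact: E2].
exists (sup E) => e e0.
have [t Et te] := sup_adherent e0 hE.
have nE : ~ E (sup E + e).
  by move=> h; have := ub_le_sup hE.2 h; lra.
have [//|h] := in_ultra_setVsetC [set x | sup E + e <= f x] UU.
apply: filterS (filterI Et h) => x /= [x1 /negP]; rewrite -ltNge => x2.
by rewrite ler_norml; apply/andP; split; lra.
Qed.

Section Laws.
Variable U : set_system R.
Context {UF : ProperFilter U}.

Lemma ulim_le f u l m : ulim U f l -> ulim U u m ->
  (forall e, 0 < e -> U [set x | f x <= u x + e]) -> l <= m.
Proof.
move=> fl um H; rewrite leNgt; apply/negP => ml.
pose e := (l - m) / 4; have e0 : 0 < e by rewrite /e; lra.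
have [x /= [h1 [h2 h3]]] := @filter_ex _ U _ _ (filterI (H e e0) (filterI (fl e e0) (um e e0))).
move: h2 h3; rewrite !ler_norml => /andP[a1 a2] /andP[b1 b2].
move: h1 a1 b2; rewrite /e; lra.
Qed.

Lemma ulimD f u l m : ulim U f l -> ulim U u m -> ulim U (fun x => f x + u x) (l + m).
Proof.
move=> fl um e e0; have e2 : 0 < e / 2 by lra.
apply: filterS (filterI (fl _ e2) (um _ e2)) => x /= [].
rewrite !ler_norml => /andP[a1 a2] /andP[b1 b2]; apply/andP; split; lra.
Qed.

Lemma ulimZ k f l : ulim U f l -> ulim U (fun x => k * f x) (k * l).
Proof.
move=> fl e e0; have k0 : 0 < `|k| + 1 by have := normr_ge0 k; lra.
apply: filterS (fl _ (divr_gt0 e0 k0)) => x /= h.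
rewrite -mulrBr normrM; apply: (le_trans (ler_wpM2l (normr_ge0 k) h)).
rewrite mulrA ler_pdivrMr //; have := normr_ge0 k; nra.
Qed.

Lemma ulim_cst k : ulim U (fun=> k) k.
Proof. by move=> e e0; apply: filterS filterT => x _ /=; rewrite subrr normr0 ltW. Qed.

Lemma ulim_sum (F : nat -> R -> R) (L : nat -> R) n :
  (forall m : nat, (0 < m)%N -> ulim U (F m) (L m)) ->
  ulim U (fun x => \sum_(1 <= m < n.+1) F m x) (\sum_(1 <= m < n.+1) L m).
Proof.
move=> H; elim: n => [|n IH].
  rewrite [X in ulim _ _ X]big_geq // => e e0; apply: filterS filterT => x _ /=.
  by rewrite big_geq // subrr normr0 ltW.
rewrite [X in ulim _ _ X]big_nat_recr //= => e e0.
by apply: filterS (ulimD IH (H n.+1 isT) e0) => x /=; rewrite [in X in _ -> X]big_nat_recr.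
Qed.

End Laws.

(** U extends the filter generated by the sets where x >= t and f(x) >= M - e. The upper bound is
    stated for all large x and not along U, since it is applied at l x while x follows U. *)
Lemma limsup_ultrafilter f K : (exists t, forall x, t <= x -> `|f x| <= K) ->
  exists M U, [/\ UltraFilter U, at_infinity U,
    forall e, 0 < e -> exists t, forall x, t <= x -> f x <= M + e &
    forall e, 0 < e -> U [set x | M - e <= f x]].
Proof.
move=> [T HT]; pose E := [set s : R | exists t, forall x, t <= x -> f x <= s].
have EK : E K.
  by exists T => x /HT; rewrite ler_norml => /andP[].
have El s : E s -> - K <= s.
  move=> [t Ht]; have := HT (Num.max T t) ltac:(by rewrite le_max lexx).
  have := Ht (Num.max T t) ltac:(by rewrite le_max lexx orbT).
  by rewrite ler_norml => h /andP[h1 _]; apply: le_trans h.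
have hE : has_inf E by split; [exists K | exists (- K) => s; exact: El].
pose M := inf E.
have up e : 0 < e -> exists t, forall x, t <= x -> f x <= M + e.
  move=> e0; have [s [t Ht] se] := inf_adherent e0 hE.
  by exists t => x tx; apply: (le_trans (Ht x tx)); exact: ltW.
have lo e t : 0 < e -> exists x, t <= x /\ M - e <= f x.
  move=> e0; apply: contrapT => H.
  suff /(ge_inf hE.2) : E (M - e) by rewrite -/M; lra.
  exists t => x tx; rewrite leNgt; apply/negP => h; apply: H.
  by exists x; split => //; exact: ltW.
pose F : set_system R := [set A | exists t e, 0 < e /\
   forall x, t <= x -> M - e <= f x -> A x].
have FF : ProperFilter F.
  apply: Build_ProperFilter.
    by move=> [t [e [e0 H]]]; have [x [tx fx]] := lo e t e0; exact: (H x).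
  split; first by exists 0, 1.
    move=> A B [t [e [e0 HA]]] [t' [e' [e'0 HB]]].
    exists (Num.max t t'), (Num.min e e'); split; first by rewrite lt_min e0.
    move=> x; rewrite ge_max => /andP[h1 h2] h3; split; [apply: HA|apply: HB] => //.
      by apply: le_trans h3; rewrite lerD2l lerN2 ge_min lexx.
    by apply: le_trans h3; rewrite lerD2l lerN2 ge_min lexx orbT.
  by move=> A B AB [t [e [e0 HA]]]; exists t, e; split=> // x h1 h2; apply: AB; exact: HA.
have [U [UU FU]] := ultraFilterLemma FF.
exists M, U; split=> // [t|e e0]; apply: FU; first by exists t, 1.
by exists 0, e.
Qed.

End Ultralimit.

(** * The sum over prime powers *)

Section PrimePowerSum.
Variables (R : realType) (h : R -> R) (C : R).
Hypothesis h_pos : forall x : R, 2 <= x -> 0 < h x.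
Hypothesis h_ndecr : forall x y : R, 2 <= x -> x <= y -> h x <= h y.
Implicit Types (x y a b e : R).

Definition ppow_sum y := summatory (lam (fun n => h n%:R)) y.
Local Notation Phi := ppow_sum.
Local Notation S := (summatory (prime_power_sum h)).
Local Notation prime_ind := (@prime_ind R).
Local Notation ppow_ind := (@ppow_ind R).

Lemma lam_h_ge0 n : 0 <= lam (fun n => h n%:R) n.
Proof.
rewrite /lam; case e: (primes n) => [|p [|q s]] //.
by have [pp _ _] := primes_eq1 e; rewrite ltW // h_pos // ler_nat prime_gt1.
Qed.

Lemma ppow_sum_ge0 y : 0 <= Phi y.
Proof. by apply: summatory_ge0 => n _; exact: lam_h_ge0. Qed.

Lemma ppow_sum_mono x y : x <= y -> Phi x <= Phi y.
Proof. by apply: summatory_mono => n _; exact: lam_h_ge0. Qed.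

Lemma sum_prime_power_sum y : 0 <= y -> S y = summatory (fun m => Phi (y / m%:R)) y.
Proof.
move=> y0; have := @summatory_swap R (fun=> 1) (lam (fun n => h n%:R)) (fun=> 1) y y0.
rewrite (@eq_summatory _ _ (fun m => Phi (y / m%:R))); last first.
  by move=> n _ _; rewrite mul1r; apply: eq_summatory => m _ _; rewrite mulr1.
move=> ->; apply: eq_summatory => k k0 _; rewrite mulr1 /prime_power_sum -sum_divisors_lam //.
by under [RHS]eq_bigr do rewrite mul1r; rewrite sum_divisors_rev.
Qed.

Lemma prime_power_sum_ge0 y : 0 <= y -> 0 <= S y.
Proof.
move=> y0; rewrite sum_prime_power_sum //; apply: summatory_ge0 => n _; exact: ppow_sum_ge0.
Qed.

Lemma prime_power_sum_lower n y : n%:R <= y ->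
  \sum_(1 <= m < n.+1) Phi (y / m%:R) <= S y.
Proof.
move=> ny; have y0 : 0 <= y by apply: le_trans ny.
rewrite sum_prime_power_sum // -(@summatory_nat R).
by apply: summatory_mono => // m _; exact: ppow_sum_ge0.
Qed.

(** The terms with m >= n are grouped by n j <= m < n (j + 1), where Phi(y/m) <= Phi(y/(n j)); n
    equal terms for each j add up to n S(y/n). This controls the tail uniformly before any limit is
    taken. *)
Lemma prime_power_sum_upper n y : (0 < n)%N -> n%:R <= y ->
  S y <= \sum_(1 <= m < n.+1) Phi (y / m%:R) + n%:R * S (y / n%:R).
Proof.
move=> n0 ny; have y0 : 0 <= y by apply: le_trans ny.
have p : 0 < n%:R :> R by rewrite ltr0n.
have blocks J : \sum_(n <= m < n * J.+1) Phi (y / m%:R) <=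
   n%:R * \sum_(1 <= j < J.+1) Phi (y / n%:R / j%:R).
  elim: J => [|J IH]; first by rewrite muln1 !big_geq // mulr0.
  rewrite (@big_cat_nat _ _ _ (n * J.+1)) //=; [|by rewrite leq_pmulr|by rewrite leq_mul2l leqnSn orbT].
  rewrite [X in _ <= _ * X]big_nat_recr //= mulrDr; apply: lerD => //.
  apply: (@le_trans _ _ (\sum_(n * J.+1 <= m < n * J.+2) Phi (y / n%:R / J.+1%:R))).
    apply: ler_sum_nat => m /andP[m1 _]; apply: ppow_sum_mono.
    rewrite -mulrA -invfM -natrM ler_wpM2l // lef_pV2 ?posrE ?ltr0n ?muln_gt0 ?n0 ?ler_nat //.
    by apply: leq_trans m1; rewrite muln_gt0 n0.
  by rewrite sumr_const_nat -mulnBr subSnn muln1 mulr_natl.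
have yn0 : 0 <= y / n%:R by rewrite divr_ge0.
rewrite !sum_prime_power_sum //.
have h1 := blocks (Num.truncn (y / n%:R)).
apply: (@le_trans _ _ (\sum_(1 <= m < n) Phi (y / m%:R) +
   \sum_(n <= m < n * (Num.truncn (y / n%:R)).+1) Phi (y / m%:R))); last first.
  apply: lerD => //; rewrite big_nat_recr //= lerDl; exact: ppow_sum_ge0.
have nt : (n <= n * (Num.truncn (y / n%:R)).+1)%N by rewrite leq_pmulr.
rewrite -big_cat_nat // /summatory [leRHS](@big_cat_nat _ _ _ (Num.truncn y).+1) //=.
  by rewrite lerDl; apply: sumr_ge0 => m _; exact: ppow_sum_ge0.
rewrite truncn_lt_nat // natrM mulrC -ltr_pdivrMr //.
exact: truncnS_gt.
Qed.

(** A power p^k > a x may have a small p, so the lower bound keeps only the primes, where h(p) >=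
    h(a x). Above, h(p) <= h(b x) holds for every p^k <= b x, so all prime powers are counted. *)
Lemma ppow_sum_interval a b e : 0 < a -> a <= b -> b <= 1 -> 0 < e ->
  exists T, forall x, T <= x ->
  (b - a) * h (a * x) * x - e * (h x * x) <= (Phi (b * x) - Phi (a * x)) * ln x
  <= (b - a) * h (b * x) * x + e * (h x * x).
Proof.
move=> a0 ab b1 e0; have b0 : 0 < b by lra.
have [T HT] := prime_count_interval a0 ab e0.
exists (`|T| + 2 / a) => x xT; have nT := normr_ge0 T.
have a2 : 2 <= 2 / a by rewrite ler_peMr // invf_ge1 //; lra.
have [H1 H2] := HT x ltac:(have := ler_norm T; lra).
have x0 : 0 < x by lra.
have ax : 2 <= a * x by rewrite -ler_pdivrMl // mulrC; lra.
have abx : a * x <= b * x by rewrite ler_pM2r.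
have bx : b * x <= x by rewrite ler_piMl // ltW.
have ha := h_pos ax; have hb := h_pos (le_trans ax abx).
have hbx : h (b * x) <= h x by apply: h_ndecr => //; lra.
have hax : h (a * x) <= h x by apply: h_ndecr => //; lra.
have l0 : 0 <= ln x by apply: ln_ge0; lra.
have ex : 0 <= e * x by rewrite mulr_ge0 // ltW.
apply/andP; split.
  apply: (@le_trans _ _ (h (a * x) * (summatory prime_ind (b * x) - summatory prime_ind (a * x)) * ln x)).
    have := ler_wpM2l (ltW ha) H1; have := ler_wpM2r ex hax; lra.
  rewrite ler_wpM2r // mulrBr -!summatoryZ; apply: ler_summatory_sub => //; first lra.
  move=> m /andP[m1 m2]; rewrite /prime_ind.
  case: (boolP (prime m)) => pm; last by rewrite mulr0 lam_h_ge0.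
  by rewrite mulr1 -[m in leRHS]expn1 lam_pfactor // h_ndecr // ltW.
apply: (@le_trans _ _ (h (b * x) * (summatory ppow_ind (b * x) - summatory ppow_ind (a * x)) * ln x)).
  rewrite ler_wpM2r // mulrBr -!summatoryZ; apply: ler_summatory_sub => //; first lra.
  move=> m /andP[m1 m2]; rewrite /ppow_ind /lam.
  case em: (primes m) => [|p [|q s]]; rewrite ?mulr0 ?mulr1 //.
  have : p \in primes m by rewrite em inE.
  rewrite mem_primes => /and3P[pp mm0 pm].
  by rewrite h_ndecr ?ler_nat ?prime_gt1 // (le_trans _ m2) // ler_nat dvdn_leq.
have := ler_wpM2l (ltW hb) H2; have := ler_wpM2r ex hbx; lra.
Qed.

Hypothesis C_pos : 0 < C.
Hypothesis S_asymp : forall e, 0 < e -> exists T, forall y, T <= y ->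
  `|S y * ln y - C * h y * y| <= e * (h y * y).

(** The asymptotics at l x involve ln(l x); ln x exceeds it by the constant -ln l, which is at most
    d ln(l x) for large x. *)
Lemma prime_power_sum_scaled l e : 0 < l -> l <= 1 -> 0 < e ->
  exists T, forall x, T <= x ->
  `|S (l * x) * ln x - C * l * h (l * x) * x| <= e * (h x * x).
Proof.
move=> l0 l1 e0; have C0 := C_pos.
(* The change of logarithm costs d (C + 1), using d <= 1, and the hypothesis costs d: together d (C
   + 2) <= e. *)
pose d := Num.min 1 (e / (C + 2)).
have d0 : 0 < d by rewrite lt_min ltr01 divr_gt0 //; lra.
have d1 : d <= 1 by rewrite ge_min lexx.
have de : d * (C + 2) <= e by rewrite -ler_pdivlMr ?ge_min ?lexx ?orbT //; lra.
have [T HT] := S_asymp d0.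
exists ((`|T| + 2 + expR (- ln l / d)) / l) => x xT.
have nT := normr_ge0 T; have ne := expR_gt0 (- ln l / d).
have lx : `|T| + 2 + expR (- ln l / d) <= l * x by rewrite -ler_pdivrMl // mulrC.
have lx0 : 0 < l * x by lra.
have x0 : 0 < x by rewrite -(pmulr_rgt0 _ l0).
have HS := HT (l * x) ltac:(have := ler_norm T; lra).
have lxx' : l * x <= x by rewrite ler_piMl // ltW.
have h0 : 0 < h (l * x) by apply: h_pos; lra.
have hx : h (l * x) <= h x by apply: h_ndecr => //; lra.
have S0 := prime_power_sum_ge0 (ltW lx0).
have ll : ln l <= 0 by apply: ln_le0.
have lnE : ln x = ln (l * x) - ln l by rewrite lnM //; ring.
have ll2 : - ln l <= d * ln (l * x).
  have : - ln l / d <= ln (l * x) by rewrite -ler_expR lnK ?posrE //; lra.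
  by rewrite ler_pdivrMr // mulrC.
set y := l * x in lx lx0 HS lxx' h0 hx S0 lnE ll2 *.
have hyy : 0 < h y * y by rewrite mulr_gt0.
have -> : C * l * h y * x = C * (h y * y) by rewrite /y; ring.
have hyx : h y * y <= h x * x by rewrite ler_pM // ltW.
move: HS; rewrite -mulrA; set w := h y * y in hyy hyx *; set s := S y in S0 *.
rewrite !ler_norml => /andP[s1 s2].
have s3 : s * - ln l <= s * (d * ln y) by rewrite ler_wpM2l.
have s4 : 0 <= s * - ln l by rewrite mulr_ge0 // oppr_ge0.
have s5 : d * (s * ln y) <= d * ((C + 1) * w).
  rewrite ler_wpM2l ?(ltW d0) //.
  have : d * w <= 1 * w by rewrite ler_wpM2r // ltW.
  lra.
have s6 : d * (C + 2) * w <= e * w by rewrite ler_wpM2r // ltW.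
have s7 : e * w <= e * (h x * x) by rewrite ler_wpM2l // ltW.
have s8 : 0 <= d * w by rewrite mulr_ge0 // ltW.
have s9 : 0 <= d * C * w by rewrite !mulr_ge0 // ltW.
rewrite lnE mulrBr.
by apply/andP; split; lra.
Qed.

End PrimePowerSum.

(** * Limit profiles of h and convergence of the ratios *)

Section Profile.
Variables (R : realType) (h : R -> R) (C : R).
Hypothesis h_pos : forall x : R, 2 <= x -> 0 < h x.
Hypothesis h_ndecr : forall x y : R, 2 <= x -> x <= y -> h x <= h y.
Hypothesis C_pos : 0 < C.
Hypothesis S_asymp : forall e, 0 < e -> exists T, forall y, T <= y ->
  `|summatory (prime_power_sum h) y * ln y - C * h y * y| <= e * (h y * y).
Implicit Types (x y a b e l : R).
Local Notation Phi := (ppow_sum h).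
Local Notation S := (summatory (prime_power_sum h)).

(** In this normalisation the hypothesis says that sx(l) - C l gx(l) tends to 0, and both gx and bx
    are bounded. *)
Let W x := ln x / (h x * x).
Let gx l x := h (l * x) / h x.
Let bx l x := Phi (l * x) * W x.
Let sx l x := S (l * x) * W x.

Let arg_ge2 l x : 0 < l -> l <= 1 -> 2 / l <= x ->
  [/\ 2 <= l * x, l * x <= x, 0 < h (l * x), h (l * x) <= h x & 2 <= x].
Proof.
move=> l0 l1; rewrite ler_pdivrMr // mulrC => lx.
have x0 : 0 < x by rewrite -(pmulr_rgt0 _ l0); lra.
have xx : l * x <= x by rewrite ler_piMl // ltW.
by split=> //; [exact: h_pos | exact: h_ndecr | lra].
Qed.

Let gx_bounds l x : 0 < l -> l <= 1 -> 2 / l <= x -> 0 <= gx l x <= 1.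
Proof.
move=> l0 l1 lx; have [h1 h2 h3 h4 h5] := arg_ge2 l0 l1 lx.
have h6 : 0 < h x by apply: h_pos.
by rewrite /gx divr_ge0 ?(ltW h3) ?(ltW h6) //= ler_pdivrMr // mul1r.
Qed.

Let W_ge0 x : 2 <= x -> 0 <= W x.
Proof.
move=> x2; have hx := h_pos x2; rewrite divr_ge0 ?ln_ge0 ?mulr_ge0 //; lra.
Qed.

Let sx_ev l e : 0 < l -> l <= 1 -> 0 < e ->
  exists T, forall x, T <= x -> `|sx l x - C * l * gx l x| <= e.
Proof.
move=> l0 l1 e0; have [T HT] := prime_power_sum_scaled h_pos h_ndecr C_pos S_asymp l0 l1 e0.
exists (`|T| + 2) => x xT; have nT := normr_ge0 T; have lT := ler_norm T.
have hx : 0 < h x by apply: h_pos; lra.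
have x0 : 0 < x by lra.
have := HT x ltac:(lra); have hxx : 0 < h x * x by rewrite mulr_gt0.
have -> : sx l x - C * l * gx l x = (S (l * x) * ln x - C * l * h (l * x) * x) / (h x * x).
  by rewrite /sx /gx /W; field; rewrite !gt_eqF.
by rewrite normrM normfV [X in _ / X]gtr0_norm // ler_pdivrMr.
Qed.

Let sum_bx l n x : \sum_(1 <= m < n.+1) bx (l / m%:R) x =
  (\sum_(1 <= m < n.+1) Phi (l * x / m%:R)) * W x.
Proof. by rewrite mulr_suml; apply: eq_bigr => m _; rewrite /bx mulrAC. Qed.

Section Ultra.
Variable U : set_system R.
Hypotheses (UU : UltraFilter U) (Ui : at_infinity U).

Let Uev (Q : R -> Prop) : (exists T, forall x, T <= x -> Q x) -> U Q.
Proof. by move=> [T HT]; apply: filterS (Ui T) => x; exact: HT. Qed.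

Let bx_ev a b e : 0 < a -> a <= b -> b <= 1 -> 0 < e ->
  U [set x | (b - a) * gx a x - e <= bx b x - bx a x <= (b - a) * gx b x + e].
Proof.
move=> a0 ab b1 e0; apply: Uev.
have [T HT] := ppow_sum_interval h_pos h_ndecr a0 ab b1 e0.
exists (`|T| + 2) => x xT; have nT := normr_ge0 T; have lT := ler_norm T.
have hx : 0 < h x by apply: h_pos; lra.
have x0 : 0 < x by lra.
have hxx : 0 < h x * x by rewrite mulr_gt0.
have /andP[p1 p2] := HT x ltac:(lra).
have D : (bx b x - bx a x) * (h x * x) = (Phi (b * x) - Phi (a * x)) * ln x.
  by rewrite /bx /W; field; rewrite !gt_eqF.
have E l k : ((b - a) * gx l x + k) * (h x * x) = (b - a) * h (l * x) * x + k * (h x * x).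
  by rewrite /gx; field; rewrite gt_eqF.
by apply/andP; split; rewrite -(ler_pM2r hxx) D E ?mulNr.
Qed.

(** Eventually gx lies in [0, 1] and bx <= sx <= C + 1, so limits along U exist for each l in (0, 1]
    and are selected by choice; outside this range g and B are arbitrary. The properties of a
    profile are limits of inequalities valid for large x. *)
Lemma limit_profile_exists : exists g B, limit_profile C g B /\
  forall l, 0 < l -> l <= 1 -> ulim U (fun x => h (l * x) / h x) (g l).
Proof.
have C0 := C_pos.
have exg l : exists v, 0 < l -> l <= 1 -> ulim U (gx l) v.
  have [l0|l0] := ltP 0 l; last by exists 0.
  have [l1|l1] := leP l 1; last by exists 0.
  have [|v Hv] := @ulim_exists R U (gx l) 1 UU Ui; last by exists v.
  exists (2 / l) => x lx; have /andP[h1 h2] := gx_bounds l0 l1 lx.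
  by rewrite ger0_norm.
have exb l : exists v, 0 < l -> l <= 1 -> ulim U (bx l) v.
  have [l0|l0] := ltP 0 l; last by exists 0.
  have [l1|l1] := leP l 1; last by exists 0.
  have [|v Hv] := @ulim_exists R U (bx l) (C + 1) UU Ui; last by exists v.
  have [T HT] := sx_ev l0 l1 ltr01.
  exists (`|T| + 2 / l) => x xT; have nT := normr_ge0 T; have lT := ler_norm T.
  have l2 : 0 < 2 / l by rewrite divr_gt0.
  have xl : 2 / l <= x by lra.
  have [h1 h2 h3 h4 h5] := arg_ge2 l0 l1 xl.
  have /andP[g1 g2] := gx_bounds l0 l1 xl.
  have W0 := W_ge0 h5.
  have b0 : 0 <= bx l x by rewrite mulr_ge0 // ppow_sum_ge0.
  rewrite ger0_norm //.
  have bs : bx l x <= sx l x.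
    rewrite /bx /sx ler_wpM2r //.
    have := @prime_power_sum_lower _ _ h_pos 1 (l * x).
    by rewrite big_nat1 divr1; apply; lra.
  have := HT x ltac:(lra); rewrite ler_norml => /andP[_ s1].
  have : C * l * gx l x <= C.
    rewrite -mulrA ler_piMr ?(ltW C0) // mulr_ile1 // ltW //.
  lra.
have [g Hg] := choice exg; have [B HB] := choice exb.
have U2 l : 0 < l -> l <= 1 -> U [set x | 2 / l <= x] by move=> _ _; exact: Ui.
have Usx l e : 0 < l -> l <= 1 -> 0 < e -> U [set x | `|sx l x - C * l * gx l x| <= e].
  by move=> l0 l1 e0; apply: Uev; exact: sx_ev.
have PU : ProperFilter U by exact: ultra_proper.
exists g, B; split; last by move=> l l0 l1; exact: Hg.
split.
- have H1 := Hg 1 ltr01 (lexx _); have Hc := @ulim_cst R U PU 1.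
  have e1 x : 2 <= x -> gx 1 x = 1.
    by move=> x2; rewrite /gx mul1r divff // gt_eqF // h_pos.
  apply/eqP; rewrite eq_le; apply/andP; split.
    apply: (ulim_le H1 Hc) => e e0; apply: filterS (Ui 2) => x /= x2.
    by rewrite e1 // lerDl ltW.
  apply: (ulim_le Hc H1) => e e0; apply: filterS (Ui 2) => x /= x2.
  by rewrite e1 // lerDl ltW.
- move=> l l0 l1; apply: (ulim_le (@ulim_cst R U PU 0) (Hg l l0 l1)) => e e0.
  apply: filterS (U2 l l0 l1) => x /= lx; have /andP[h1 _] := gx_bounds l0 l1 lx.
  by rewrite addr_ge0 // ltW.
- move=> a b a0 ab b1; have b0 : 0 < b by lra.
  have a1 : a <= 1 by lra.
  apply: (ulim_le (Hg a a0 a1) (Hg b b0 b1)) => e e0.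
  apply: filterS (U2 a a0 a1) => x /= ax.
  have [h1 h2 h3 h4 h5] := arg_ge2 a0 a1 ax.
  apply: (@le_trans _ _ (gx b x)); last by rewrite lerDl ltW.
  rewrite /gx ler_pM2r ?invr_gt0 ?h_pos // h_ndecr // ler_pM2r //; lra.
- move=> l l0 l1; apply: (ulim_le (@ulim_cst R U PU 0) (HB l l0 l1)) => e e0.
  apply: filterS (Ui 2) => x /= x2.
  by rewrite addr_ge0 ?(ltW e0) // /bx mulr_ge0 ?ppow_sum_ge0 // W_ge0.
- move=> a b a0 ab b1; have b0 : 0 < b by lra.
  have a1 : a <= 1 by lra.
  have D := @ulimD _ U PU _ _ _ _ (HB b b0 b1) (@ulimZ _ U PU (-1) _ _ (HB a a0 a1)).
  have Ga := @ulimZ _ U PU (b - a) _ _ (Hg a a0 a1); have Gb := @ulimZ _ U PU (b - a) _ _ (Hg b b0 b1).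
  have -> : B b - B a = B b + (-1) * B a by ring.
  apply/andP; split.
    apply: (ulim_le Ga D) => e e0; apply: filterS (bx_ev a0 ab b1 e0) => x /= /andP[h1 h2]; lra.
  apply: (ulim_le D Gb) => e e0; apply: filterS (bx_ev a0 ab b1 e0) => x /= /andP[h1 h2]; lra.
- move=> n l l0 l1.
  have HS : ulim U (fun x => \sum_(1 <= m < n.+1) bx (l / m%:R) x) (\sum_(1 <= m < n.+1) B (l / m%:R)).
    apply: ulim_sum => m m0; have [p1 _ p2] := div_nat_itv l0 l1 m0; exact: HB.
  apply: (ulim_le HS (ulimZ (C * l) (Hg l l0 l1))) => e e0.
  apply: filterS (filterI (Usx l e l0 l1 e0) (Ui ((n%:R + 2) / l))) => x /= [].
  rewrite ler_norml => /andP[_ s1] nx.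
  have xl : 2 / l <= x.
    by apply: le_trans nx; rewrite ler_pM2r ?invr_gt0 // lerDr.
  have [h1 h2 h3 h4 h5] := arg_ge2 l0 l1 xl.
  have ny : n%:R <= l * x by move: nx; rewrite ler_pdivrMr // mulrC; lra.
  have := ler_wpM2r (W_ge0 h5) (prime_power_sum_lower h_pos ny).
  rewrite sum_bx -/(sx l x); lra.
- move=> n l n0 l0 l1; have [p1 _ p2] := div_nat_itv l0 l1 n0.
  have q0 : 0 < n%:R :> R by rewrite ltr0n.
  have HS : ulim U (fun x => \sum_(1 <= m < n.+1) bx (l / m%:R) x) (\sum_(1 <= m < n.+1) B (l / m%:R)).
    apply: ulim_sum => m m0; have [r1 _ r2] := div_nat_itv l0 l1 m0; exact: HB.
  apply: (ulim_le (ulimZ (C * l) (Hg l l0 l1)) (ulimD HS (ulimZ (2 * C * l) (Hg (l / n%:R) p1 p2)))) => e e0.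
  have e2 : 0 < e / 2 by lra.
  have en : 0 < e / 2 / n%:R by rewrite divr_gt0.
  apply: filterS (filterI (filterI (Usx l _ l0 l1 e2) (Usx _ _ p1 p2 en))
     (filterI (Ui ((n%:R + 2) / l)) (Ui (2 / (l / n%:R))))) => x /= [[]].
  rewrite !ler_norml => /andP[s1 _] /andP[_ s2] [nx xn].
  have xl : 2 / l <= x.
    by apply: le_trans nx; rewrite ler_pM2r ?invr_gt0 // lerDr.
  have [h1 h2 h3 h4 h5] := arg_ge2 l0 l1 xl.
  have ny : n%:R <= l * x by move: nx; rewrite ler_pdivrMr // mulrC; lra.
  have := ler_wpM2r (W_ge0 h5) (prime_power_sum_upper h_pos n0 ny).
  rewrite mulrDl -sum_bx -/(sx l x).
  rewrite (_ : n%:R * S _ * W x = n%:R * sx (l / n%:R) x); last first.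
    by rewrite /sx mulrA [l / n%:R * x]mulrAC.
  have s3 : n%:R * sx (l / n%:R) x <= C * l * gx (l / n%:R) x + e / 2.
    have := ler_wpM2l (ltW q0) s2.
    have -> : n%:R * (sx (l / n%:R) x - C * (l / n%:R) * gx (l / n%:R) x) =
      n%:R * sx (l / n%:R) x - C * l * gx (l / n%:R) x by field; rewrite gt_eqF.
    have -> : n%:R * (e / 2 / n%:R) = e / 2 by field; rewrite gt_eqF.
    lra.
  have : 0 <= C * l * gx (l / n%:R) x.
    have /andP[g1 _] := gx_bounds p1 p2 xn.
    exact: mulr_ge0 (mulr_ge0 (ltW C0) (ltW l0)) g1.
  lra.
Qed.

End Ultra.

Lemma ratio_limit c : 0 < c -> c < 1 -> exists rho, [/\ 0 < rho,
  C = zeta (rho + 1) / (rho + 1) &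
  forall e, 0 < e -> exists T, forall x, T <= x -> `|h (c * x) / h x - c `^ rho| <= e].
Proof.
move=> c0 c1; have c1' := ltW c1.
have bnd x : 2 / c <= x -> 0 <= h (c * x) / h x <= 1 := @gx_bounds c x c0 c1'.
have [|M1 [U1 [UU1 Ui1 up1 lo1]]] := @limsup_ultrafilter R (fun x => h (c * x) / h x) 1.
  by exists (2 / c) => x /bnd /andP[b1 b2]; rewrite ger0_norm.
(* The liminf is minus the limsup of the negated ratio, hence [g2 c] = - [M2]. *)
have [|M2 [U2 [UU2 Ui2 up2 lo2]]] := @limsup_ultrafilter R (fun x => - (h (c * x) / h x)) 1.
  by exists (2 / c) => x /bnd /andP[b1 b2]; rewrite normrN ger0_norm.
have [g1 [B1 [P1 H1]]] := limit_profile_exists UU1 Ui1.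
have [g2 [B2 [P2 H2]]] := limit_profile_exists UU2 Ui2.
have PU1 : ProperFilter U1 by exact: ultra_proper.
have PU2 : ProperFilter U2 by exact: ultra_proper.
have gc1 : g1 c = M1.
  apply/eqP; rewrite eq_le; apply/andP; split.
    apply: (ulim_le (H1 c c0 c1') (@ulim_cst R U1 PU1 M1)) => e e0.
    by have [t Ht] := up1 e e0; apply: filterS (Ui1 t) => x /= /Ht.
  apply: (ulim_le (@ulim_cst R U1 PU1 M1) (H1 c c0 c1')) => e e0.
  by apply: filterS (lo1 e e0) => x /=; rewrite lerBlDr.
have gc2 : g2 c = - M2.
  apply/eqP; rewrite eq_le; apply/andP; split.
    apply: (ulim_le (H2 c c0 c1') (@ulim_cst R U2 PU2 (- M2))) => e e0.
    by apply: filterS (lo2 e e0) => x /=; lra.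
  apply: (ulim_le (@ulim_cst R U2 PU2 (- M2)) (H2 c c0 c1')) => e e0.
  by have [t Ht] := up2 e e0; apply: filterS (Ui2 t) => x /= /Ht; lra.
have cmul l x : c * l * x = c * (l * x) by rewrite mulrA.
have K1 l : 0 < l -> l <= 1 -> g1 (c * l) <= g1 c * g1 l.
  move=> l0 l1; have cl0 : 0 < c * l by rewrite mulr_gt0.
  have cl1 : c * l <= 1 by rewrite mulr_ile1 // ltW.
  rewrite gc1; apply: (ulim_le (H1 _ cl0 cl1) (ulimZ M1 (H1 l l0 l1))) => e e0.
  have [t Ht] := up1 e e0.
  apply: filterS (filterI (Ui1 (`|t| / l)) (Ui1 (2 / (l)))) => x /= [x1 x2].
  have [q1 q2 q3 q4 q5] := arg_ge2 l0 l1 x2.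
  have lx : t <= l * x.
    by apply: (le_trans (ler_norm t)); rewrite -ler_pdivrMl // mulrC.
  have hx := h_pos q5.
  have /andP[r0 r1] := gx_bounds l0 l1 x2; rewrite /gx in r0 r1.
  (* The first factor is the ratio for c taken at l x, bounded by M1 + e because l x >= t. *)
  have -> : h (c * l * x) / h x = h (c * (l * x)) / h (l * x) * (h (l * x) / h x).
    by rewrite cmul; field; rewrite !gt_eqF.
  have := ler_wpM2r r0 (Ht _ lx); have := ler_wpM2l (ltW e0) r1; lra.
have K2 l : 0 < l -> l <= 1 -> g2 c * g2 l <= g2 (c * l).
  move=> l0 l1; have cl0 : 0 < c * l by rewrite mulr_gt0.
  have cl1 : c * l <= 1 by rewrite mulr_ile1 // ltW.
  rewrite gc2; apply: (ulim_le (ulimZ (- M2) (H2 l l0 l1)) (H2 _ cl0 cl1)) => e e0.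
  have [t Ht] := up2 e e0.
  apply: filterS (filterI (Ui2 (`|t| / l)) (Ui2 (2 / (l)))) => x /= [x1 x2].
  have [q1 q2 q3 q4 q5] := arg_ge2 l0 l1 x2.
  have lx : t <= l * x.
    by apply: (le_trans (ler_norm t)); rewrite -ler_pdivrMl // mulrC.
  have hx := h_pos q5.
  have /andP[r0 r1] := gx_bounds l0 l1 x2; rewrite /gx in r0 r1.
  have -> : h (c * l * x) / h x = h (c * (l * x)) / h (l * x) * (h (l * x) / h x).
    by rewrite cmul; field; rewrite !gt_eqF.
  have := ler_wpM2r r0 (Ht _ lx); have := ler_wpM2l (ltW e0) r1; lra.
have [r1 [r10 e1 E1]] := lp_exponent C_pos P1 c0 c1 (or_introl K1).
have [r2 [r20 e2 E2]] := lp_exponent C_pos P2 c0 c1 (or_intror K2).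
have r12 : r2 = r1.
  apply: (@addIr _ 1); apply: zeta_div_inj; rewrite ?ltrDr //.
  by rewrite -e1 -e2.
exists r1; split=> // e e0.
have [t1 Ht1] := up1 e e0; have [t2 Ht2] := up2 e e0.
exists (Num.max t1 t2) => x; rewrite ge_max => /andP[x1 x2].
have := Ht1 x x1; have := Ht2 x x2; rewrite -gc1 E1.
have -> : M2 = - c `^ r1 by rewrite -r12 -E2 gc2 opprK.
by rewrite ler_norml => q1 q2; apply/andP; split; lra.
Qed.

End Profile.

(** * Limits at infinity in epsilon form, and the conclusion *)

Lemma near_pinftyP (R : realType) (Q : R -> Prop) :
  (\forall x \near +oo, Q x) <-> exists T, forall x, T <= x -> Q x.
Proof.
split=> [[M [_ HM]]|[T HT]].
  by exists (M + 1) => x Mx; apply: HM; lra.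
by exists T; split; [exact: num_real | move=> x /ltW; exact: HT].
Qed.

Lemma cvg_pinftyP (R : realType) (f : R -> R) (l : R) :
  (f x @[x --> +oo] --> l) <->
  forall e, 0 < e -> exists T, forall x, T <= x -> `|f x - l| <= e.
Proof.
split=> [/cvgrPdist_le H e e0|H].
  have /near_pinftyP[T HT] := H e e0.
  by exists T => x /HT; rewrite distrC.
apply/cvgrPdist_le => e e0; apply/near_pinftyP.
by have [T HT] := H e e0; exists T => x /HT; rewrite distrC.
Qed.

Unset Implicit Arguments.
Set Strict Implicit.
Set Printing Implicit Defensive.

Theorem mainTheorem4 (R : realType) (h : R -> R) (C : R)
  (h_pos : forall x : R, 2 <= x -> 0 < h x)
  (h_cont : {within `[2, +oo[, continuous h})
  (h_ndecr : forall x y : R, 2 <= x -> x <= y -> h x <= h y)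
  (C_pos : 0 < C)
  (h_asymp : exists2 e : R -> R, e x @[x --> +oo] --> 0 &
     \forall x \near +oo,
       summatory (prime_power_sum h) x = (C + e x) * h x * (x / ln x)) :
  exists rho : R,
    unique (fun r : R => 0 < r /\ C = zeta (r + 1) / (r + 1)) rho /\
    regularly_varying h rho.
Proof.
have asymp d : 0 < d -> exists T, forall y, T <= y ->
    `|summatory (prime_power_sum h) y * ln y - C * h y * y| <= d * (h y * y).
  case: h_asymp => e /cvg_pinftyP e0 /near_pinftyP[T1 H1] d0.
  have [T2 H2] := e0 d d0; exists (`|T1| + `|T2| + 2) => y yT.
  have n1 := normr_ge0 T1; have n2 := normr_ge0 T2.
  have m1 := ler_norm T1; have m2 := ler_norm T2.
  have y0 : 0 < y by lra.
  have l0 : 0 < ln y by apply: ln_gt0; lra.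
  have hy : 0 < h y by apply: h_pos; lra.
  rewrite H1; last by lra.
  have -> : (C + e y) * h y * (y / ln y) * ln y - C * h y * y = e y * (h y * y).
    by field; rewrite gt_eqF.
  have := H2 y ltac:(lra); rewrite subr0 => he.
  by rewrite normrM [`|h y * y|]gtr0_norm ?mulr_gt0 // ler_wpM2r // mulr_ge0 // ltW.
have ratio := ratio_limit h_pos h_ndecr C_pos asymp.
(* Any c in (0, 1) would do: the profile at one value shows that the equation has a positive
   solution. *)
have [rho [rho0 rhoE _]] := ratio (1 / 2) ltac:(lra) ltac:(lra).
have uniq r : 0 < r -> C = zeta (r + 1) / (r + 1) -> rho = r.
  move=> r0 rE; apply: (@addIr _ 1); apply: zeta_div_inj; rewrite ?ltrDr //.
  by rewrite -rhoE -rE.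
exists rho; split; first by split=> // r [r0 rE]; exact: uniq.
have small c : 0 < c -> c < 1 -> h (c * x) / h x @[x --> +oo] --> c `^ rho.
  move=> c0 c1; have [r [r0 rE Hr]] := ratio c c0 c1.
  by apply/cvg_pinftyP; rewrite (uniq r r0 rE).
move=> c c0; have [c1|c1|->] := ltgtP c 1; first exact: small.
  (* For c > 1, h(c x) / h(x) is the inverse of the ratio for c^-1 at the point c x. *)
  have d0 : 0 < c^-1 by rewrite invr_gt0.
  have d1 : c^-1 < 1 by rewrite invf_lt1.
  have dr : c^-1 `^ rho != 0 by rewrite gt_eqF // powR_gt0.
  have cv : (h (c^-1 * x) / h x)^-1 @[x --> +oo] --> (c^-1 `^ rho)^-1.
    by apply: cvgV => //; exact: small.
  move/cvg_pinftyP: cv => H.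
  have cE : c `^ rho = (c^-1 `^ rho)^-1.
    by rewrite -(powR_inv1 (ltW c0)) -powRrM mulN1r powRN invrK.
  rewrite cE; apply/cvg_pinftyP => e e0; have [T HT] := H e e0.
  exists (T / c) => x; rewrite ler_pdivrMr // mulrC => /HT.
  by rewrite /= mulKf ?gt_eqF // invf_div.
rewrite powR1; apply/cvg_pinftyP => e e0; exists 2 => x x2.
by rewrite mul1r divff ?subrr ?normr0 ?gt_eqF ?h_pos // ltW.
Qed.
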